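(* For each $\nu\in\mathcal P(Y)$ there exists a unique minimiser of $F_\nu$ over $\mathcal P_{\mathrm{ac}}(B)$. In particular, $$\min_{\bar p\in\mathcal P_{\mathrm{ac}}(B)}F_\nu(\bar p)=\max_{\psi\in\mathcal C(Y)}G_\nu(\psi),$$ and $\bar p\in\mathcal P_{\mathrm{ac}}(B)$ and $\psi\in\mathcal C(Y)$ are optimal in their respective problems (i.e. $\bar p$ minimises $F_\nu$ over $\mathcal P_{\mathrm{ac}}(B)$ and $\psi$ maximises $G_\nu$ over $\mathcal C(Y)$) if and only if $\bar p=\bar p_\psi$ and $\psi$ is a Kantorovich potential from $\mu_{\bar p}$ to $\nu$.
   Context: Setting. Let $d\ge 2$, let $B\subset\mathbb R^{d-1}$ be compact with non-empty interior, let $X:=B\times[0,+\infty)$ with points written $x=(s,p)$, and let $Y\subset\mathbb R^d$ be non-empty and compact. The cost $c:X\times Y\to[0,+\infty)$ satisfies: (A) $c$ is locally Lipschitz; (B) for all $s\in B$ and $y\in Y$ the function $c((s,\cdot),y):[0,+\infty)\to[0,+\infty)$ is strictly increasing and unbounded; (C) the set of functions $\{c((\cdot,p),y):B\to[0,+\infty)\mid p\in[0,+\infty),\,y\in Y\}$ is equicontinuous. Notation. $\mathcal C(Y)$ is the space of continuous real functions on $Y$; $\mathcal P(A)$ is the set of Borel probability measures on $A$; $\mathcal P_{\mathrm{ac}}(B)$ is the set of those on $B$ absolutely continuous with respect to Lebesgue measure $\mathcal L^{d-1}$, identified with their densities (as elements of $L^1(B)$). For $\bar p\in\mathcal P_{\mathrm{ac}}(B)$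 let $X_{\bar p}:=\{(s,p)\in X: p\le\bar p(s)\}$ and let $\mu_{\bar p}:=\mathcal L^d|_{X_{\bar p}}$ (restriction of Lebesgue measure), a probability measure on $X$. For $\mu\in\mathcal P(X)$, $\nu\in\mathcal P(Y)$, $\mathcal T_c(\mu,\nu):=\inf_{\gamma\in\Gamma(\mu,\nu)}\int_{X\times Y}c\,\mathrm d\gamma$, where $\Gamma(\mu,\nu)$ is the set of probability measures on $X\times Y$ with marginals $\mu,\nu$. The primal functional is $F_\nu:\mathcal P_{\mathrm{ac}}(B)\to[0,+\infty]$, $F_\nu(\bar p):=\mathcal T_c(\mu_{\bar p},\nu)$. For $\psi\in\mathcal C(Y)$, $\psi^c(x):=\inf_{y\in Y}\{c(x,y)-\psi(y)\}$ for $x\in X$, and $K(\psi;\mu,\nu):=\int_X\psi^c\,\mathrm d\mu+\int_Y\psi\,\mathrm d\nu$. The dual functional is $G_\nu:\mathcal C(Y)\to\mathbb R$, $G_\nu(\psi):=\inf_{\bar p\in\mathcal P_{\mathrm{ac}}(B)}K(\psi;\mu_{\bar p},\nu)$. A Kantorovich potential from $\mu$ to $\nu$ is a maximiser of $K(\cdot\,;\mu,\nu)$ over $\mathcal C(Y)$. Define $q:B\times Y\times\mathbb R\to[0,+\infty)$ by $q(s,y,\sigma):=c((s,\cdot),y)^{-1}(\sigma)$ if $\sigma\ge c((s,0),y)$, and $q(s,y,\sigma):=0$ otherwise. For each $\psi\in\mathcal C(Y)$ there is a unique constant $\tau_\psi\in\mathbb R$ such that $\bar p_\psi:B\to\mathbb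 R$, $\bar p_\psi(s):=\max_{y\in Y}q(s,y,\psi(y)+\tau_\psi)$, is a probability density on $B$; this defines $\tau_\psi$ and $\bar p_\psi$. *)

(* Defs.v *)
From HB Require Import structures.
From mathcomp Require Import all_boot all_order all_algebra.
From mathcomp Require Import all_classical all_reals all_analysis.
From mathcomp Require Import measurable_realfun.

Set Implicit Arguments.
Unset Strict Implicit.
Unset Printing Implicit Defensive.

Import Order.TTheory GRing.Theory Num.Theory.
Import numFieldNormedType.Exports.

Local Open Scope classical_set_scope.
Local Open Scope ring_scope.

Section borel_rV.
Context (R : realType) (n : nat).

Let borel : set (set 'rV[R]_n) := <<s open >>.

HB.instance Definition _ := @isMeasurable.Build (sigma_display (@open 'rV[R]_n))
  'rV[R]_n borel (@sigma_algebra0 _ setT open) (@sigma_algebraC _ open)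
  (@sigma_algebra_bigcup _ setT open).

End borel_rV.

Section lebesgue_rV.
Context {R : realType}.

Lemma open_measurable_rV n (U : set 'rV[R]_n) : open U -> measurable U.
Proof. exact: sub_sigma_algebra. Qed.

(* The identification of R^n x R with R^(n+1); lebesgue_rV_box below shows that
   the resulting measure is the usual Lebesgue measure. *)
Definition rV_cons n (z : 'rV[R]_n * measurableTypeR R) : 'rV[R]_n.+1 :=
  row_mx (const_mx z.2 : 'rV[R]_1) z.1.

Lemma rV_cons0 n z i : @rV_cons n z i ord0 = z.2.
Proof.
transitivity ((const_mx z.2 : 'rV[R]_1) i ord0); last by rewrite mxE.
rewrite -(row_mxEl (const_mx z.2 : 'rV[R]_1) z.1).
by apply: (congr1 (@rV_cons n z i)); exact/val_inj.
Qed.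

Lemma rV_consS n z i j : @rV_cons n z i (lift ord0 j) = z.1 i j.
Proof.
rewrite -(row_mxEr (const_mx z.2 : 'rV[R]_1) z.1 i j).
by apply: (congr1 (@rV_cons n z i)); exact/val_inj.
Qed.

Lemma rV_cons_ball n (q : 'rV[R]_n.+1) (r : R) :
  @rV_cons n @^-1` ball q r =
  ball (\row_i q ord0 (lift ord0 i)) r `*` ball (q ord0 ord0 : R) r.
Proof.
apply/seteqP; split=> -[v t] /=.
  case=> r0 qr; split; last by have := qr ord0 ord0; rewrite rV_cons0.
  by split=> // i j; have := qr i (lift ord0 j); rewrite rV_consS mxE (ord1 i).
move=> [[r0 qv] qt]; split=> // i j; rewrite (ord1 i).
case: (unliftP ord0 j) => [k|] ->; last by rewrite rV_cons0.
by rewrite rV_consS; have := qv ord0 k; rewrite mxE.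
Qed.

Lemma open_rV_ratball n (U : set 'rV[R]_n) : open U ->
  U = \bigcup_(k in [set k : 'rV[rat]_n * rat |
          ball (map_mx ratr k.1 : 'rV[R]_n) (ratr k.2 : R) `<=` U])
        ball (map_mx ratr k.1 : 'rV[R]_n) (ratr k.2 : R).
Proof.
move=> oU; apply/seteqP; split=> [x Ux|x [k /= + kx]]; last exact.
have /nbhs_ballP[e /= e0 xeU] := open_nbhs_nbhs (conj oU Ux).
have [|r] := @rat_in_itvoo R 0 (e / 2); first exact: divr_gt0.
rewrite in_itv/= => /andP[r0 re].
have qP i : exists q : rat, `|x ord0 i - ratr q| < ratr r.
  have [|q] := @rat_in_itvoo R (x ord0 i - ratr r) (x ord0 i + ratr r).
    by rewrite ltrBlDr -addrA ltrDl addr_gt0.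
  rewrite in_itv/= => xq; exists q.
  by rewrite distrC ltr_distl.
pose q : 'rV[rat]_n := \row_i projT1 (cid (qP i)).
have qx : ball (map_mx ratr q : 'rV[R]_n) (ratr r : R) x.
  split=> // i j; rewrite !mxE /ball/= (ord1 i) distrC.
  exact: projT2 (cid (qP j)).
exists (q, r) => //= y qy; apply: xeU.
apply: (@le_ball _ _ _ (ratr r + ratr r)).
  by rewrite (splitr e) lerD// ltW.
by apply: ball_triangle qy; exact: ball_sym.
Qed.

Lemma measurable_rV_cons n : measurable_fun setT (@rV_cons n).
Proof.
apply: (@measurability _ _ _ _ setT (@rV_cons n) open erefl) => _ [U oU <-].
rewrite setTI.
rewrite (open_rV_ratball oU) preimage_bigcup bigcup_mkcond.
apply: countable_bigcupT_measurable => // k.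
case: ifPn => // _; have [r0|r0] := ltP 0 (ratr k.2 : R); last first.
  rewrite (_ : ball _ _ = set0) ?preimage_set0//.
  by apply/seteqP; split=> // x []; rewrite ltNge r0.
rewrite rV_cons_ball; apply: measurableX.
  by apply: open_measurable_rV; exact: ball_open.
by apply: open_measurable; exact: ball_open.
Qed.

Definition pushforward_measure d1 d2 (T1 : measurableType d1)
    (T2 : measurableType d2) (m : {measure set T1 -> \bar R}) (f : T1 -> T2)
    (mf : measurable_fun setT f) : {measure set T2 -> \bar R} :=
  measure_function_pushforward__canonical__measure_function_Measure m mf.

Fixpoint lebesgue_rV n : {measure set 'rV[R]_n -> \bar R} :=
  match n with
  | 0 => dirac (0 : 'rV[R]_0)
  | m.+1 => pushforward_measure
     ((lebesgue_rV m \x @lebesgue_measure R)%E : {measure set _ -> \bar R})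
     (@measurable_rV_cons m)
  end.

Lemma lebesgue_rV_box n (a b : 'rV[R]_n) : (forall i, a ord0 i <= b ord0 i) ->
  lebesgue_rV n [set x : 'rV[R]_n | forall i, x ord0 i \in `[a ord0 i, b ord0 i]] =
  (\prod_(i < n) (b ord0 i - a ord0 i))%:E.
Proof.
elim: n a b => [|n ih] a b ab.
  by rewrite big_ord0 /= diracE mem_set// => -[].
pose tl (x : 'rV[R]_n.+1) : 'rV[R]_n := \row_i x ord0 (lift ord0 i).
have mbox m (u v : 'rV[R]_m) :
    measurable [set x : 'rV[R]_m | forall i, x ord0 i \in `[u ord0 i, v ord0 i]].
  rewrite -[X in measurable X]setCK; apply: measurableC.
  apply: open_measurable_rV; apply: closed_openC.
  rewrite (_ : mkset _ = \bigcap_i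
    ((fun x : 'rV[R]_m => x ord0 i) @^-1` `[u ord0 i, v ord0 i])); last first.
    by apply/seteqP; split=> x /= xuv i; [move=> _|]; exact: xuv.
  apply: closed_bigI => i _; apply: preimage_closed; last exact: itv_closed.
  by move=> x _; exact: coord_continuous.
set A := mkset _.
rewrite (_ : lebesgue_rV n.+1 A =
  (lebesgue_rV n \x @lebesgue_measure R)%E (@rV_cons n @^-1` A))//.
rewrite (_ : @rV_cons n @^-1` A =
  [set x : 'rV[R]_n | forall i, x ord0 i \in `[tl a ord0 i, tl b ord0 i]] `*`
  `[a ord0 ord0, b ord0 ord0]); last first.
  apply/seteqP; split=> -[x t] /=.
    move=> xab; split; last by have := xab ord0; rewrite rV_cons0.
    by move=> i; have := xab (lift ord0 i); rewrite rV_consS !mxE.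
  move=> [xab tab] i; case: (unliftP ord0 i) => [k|] ->; last by rewrite rV_cons0.
  by rewrite rV_consS; have := xab k; rewrite !mxE.
rewrite product_measure1E; [|exact: mbox|exact: measurable_itv].
rewrite ih; last by move=> i; rewrite !mxE.
rewrite [X in (_ * X)%E](_ : _ = (b ord0 ord0 - a ord0 ord0)%:E); last first.
  apply: etrans (lebesgue_measure_itv `[a ord0 ord0, b ord0 ord0]) _.
  rewrite /= lte_fin; case: ltP => [_|ba]; first by rewrite EFinB.
  by have := ab ord0; case: ltgtP ba => // -> _ _; rewrite subrr.
rewrite big_ord_recl mulrC EFinM.
by congr (_ * _)%E; congr EFin; apply: eq_bigr => i _; rewrite !mxE.
Qed.

End lebesgue_rV.

Definition minimises {R : realType} {T : Type} (A : set T) (f : T -> \bar R)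
  (a : T) := A a /\ forall b, A b -> (f a <= f b)%E.

Definition maximises {R : realType} {T : Type} (A : set T) (f : T -> \bar R)
  (a : T) := A a /\ forall b, A b -> (f b <= f a)%E.

(* A point x = (s, p) of R^d is a pair with s in R^(d-1) and p in R. Functions
   on X, Y or B are total functions of which only the values on these sets
   matter. The norms are sup norms. *)
Section transport.
Context {R : realType} {d : nat}.

Notation base := 'rV[R]_d.-1.
Notation source := ('rV[R]_d.-1 * measurableTypeR R)%type.
Notation target := 'rV[R]_d.

Variables (B : set base) (Y : set target) (c : base * R -> target -> R).

Definition lebesgue_source : {measure set source -> \bar R} :=
  (lebesgue_rV d.-1 \x @lebesgue_measure R)%E.

Definition half_cylinder : set source := B `*` [set p | 0 <= p].

Definition locally_lipschitz_cost : Prop :=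
  forall z, (half_cylinder `*` Y) z ->
  exists2 U : set ((base * R) * target), nbhs z U &
    [lipschitz (c w.1 w.2 : R) | w in U `&` (half_cylinder `*` Y)].

Definition strictly_increasing_cost : Prop :=
  forall s y, B s -> Y y -> forall p1 p2 : R, 0 <= p1 -> p1 < p2 ->
  c (s, p1) y < c (s, p2) y.

Definition unbounded_cost : Prop :=
  forall s y, B s -> Y y -> forall M : R, exists2 p : R, 0 <= p & M < c (s, p) y.

Definition equicontinuous_cost : Prop :=
  equicontinuous [set i : R * target | 0 <= i.1 /\ Y i.2]
    (fun i => (fun s => c (s, i.1) i.2) : subspace B -> R).

(* Densities are represented by Borel functions on B; the elements of L^1(B)
   are their classes for a.e. equality on B. *)
Definition P_ac : set (base -> R) :=
  [set p : base -> R | [/\ measurable_fun B p, forall s, B s -> 0 <= p s &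
    (\int[lebesgue_rV d.-1]_(s in B) (p s)%:E = 1)%E]].

Definition C_Y : set (target -> R) := [set psi | {within Y, continuous psi}].

Definition under_graph (p : base -> R) : set source :=
  [set x | half_cylinder x /\ x.2 <= p x.1].

Definition mu_of (p : base -> R) : set source -> \bar R :=
  fun A => lebesgue_source (A `&` under_graph p).

Definition couplings (mu : set source -> \bar R) (nu : set target -> \bar R) :
    set (probability (source * target)%type R) :=
  [set g | (forall A, measurable A -> g (fst @^-1` A) = mu A) /\
           (forall A, measurable A -> g (snd @^-1` A) = nu A)].

Definition transport_cost (mu : set source -> \bar R)
    (nu : set target -> \bar R) : \bar R :=
  ereal_inf [set (\int[g]_(z in half_cylinder `*` Y) (c z.1 z.2)%:E)%E |
    g in couplings mu nu].

Definition primal (nu : set target -> \bar R) (p : base -> R) : \bar R :=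
  transport_cost (mu_of p) nu.

Definition c_transform (psi : target -> R) (x : base * R) : R :=
  inf [set c x y - psi y | y in Y].

Definition kantorovich (psi : target -> R) (mu : set source -> \bar R)
    (nu : set target -> \bar R) : \bar R :=
  (\int[mu]_(x in half_cylinder) (c_transform psi x)%:E +
   \int[nu]_(y in Y) (psi y)%:E)%E.

Definition dual (nu : set target -> \bar R) (psi : target -> R) : \bar R :=
  ereal_inf [set kantorovich psi (mu_of p) nu | p in P_ac].

Definition kantorovich_potential (mu : set source -> \bar R)
    (nu : set target -> \bar R) (psi : target -> R) : Prop :=
  maximises C_Y (fun phi => kantorovich phi mu nu) psi.

(* For s in B and y in Y, strict monotonicity makes the selected p unique. *)
Definition cost_inverse (s : base) (y : target) (sigma : R) : R :=
  if c (s, 0) y <= sigma then xget 0 [set p | 0 <= p /\ c (s, p) y = sigma]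
  else 0.

(* The supremum over the compact set Y is attained for psi in C(Y). *)
Definition density_at_level (psi : target -> R) (tau : R) (s : base) : R :=
  sup [set cost_inverse s y (psi y + tau) | y in Y].

(* Exactly one tau makes this profile a probability density on B, so the default
   value of xget is never used. *)
Definition tau_of (psi : target -> R) : R :=
  xget 0 [set tau | P_ac (density_at_level psi tau)].

Definition density_of (psi : target -> R) : base -> R :=
  density_at_level psi (tau_of psi).

End transport.

(* Main.v *)
Require Import Defs.
From HB Require Import structures.
From mathcomp Require Import all_boot all_order all_algebra finmap.
From mathcomp Require Import all_classical all_reals all_analysis.
From mathcomp Require Import measurable_realfun cantor ring lra.

(** Fix a potential [psi]. Every measure [mu_of B p] has total mass 1 and lies
    below Lebesgue measure on the half cylinder [X], so the integral of the
    transform [c_transform Y c psi] is smallest when the mass fills a sublevel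
    set of volume 1 (bathtub principle: [bathtub_ge], [bathtub_eq]). The
    transform increases strictly in the height, hence that sublevel set is, up
    to height 0, the subgraph of [density_of B Y c psi] ([le_density],
    [mu_of_density]). This computes the dual functional ([dual_value]) and shows
    that only [density_of B Y c psi] attains it ([kantorovich_le_dual_eq]).
    Together with the chain dual <= kantorovich <= primal ([weak_duality]),
    every claim follows from one pair: a [psi0] maximising the dual such that
    the primal value of [density_of B Y c psi0] is at most the dual value of
    [psi0] ([strong_duality]). Uniqueness and the optimality conditions are the
    equality cases of that chain.

    The pair comes from a relaxed transport problem in which the first marginal
    is only required to lie below Lebesgue measure on a truncated cylinder
    [cylinder_to B M]. Its dual objective is [truncated_dual]: the integral of
    [psi] minus the integral of the negative part of the transform. Shifting
    [psi] by its level [tau_of B Y c psi] shows that the dual functional never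
    exceeds its maximum ([dual_le_truncated]); for large [M] the dual functional
    reaches that maximum at the same potential ([truncated_le_dual]).

    A maximiser [psi0] exists by compactness ([truncated_dual_max]): replacing a
    potential by a double transform does not decrease the objective and gives it
    the modulus of continuity of the cost, and the objective penalises
    potentials with a large maximum because the cylinder has volume larger
    than 1.

    Let [h] be the maximal value. The conditions on a measure on
    [cylinder_to B M `*` Y] to have second marginal [nu], first marginal below
    Lebesgue measure and cost at most [h] bound its integrals of functions
    [t * c x y + u x + v y]; maximality of [h] says that these bounds are
    consistent ([constraint_positive]). A Hahn-Banach argument
    ([cone_domination]) extends them to a positive linear functional, and a
    Riesz representation ([riesz_cone]) turns it into a measure. Representation
    is proved on the Cantor space, where clopen sets form an algebra on which a
    positive functional is automatically a sigma-additive content, and the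
    result is pushed forward along a continuous surjection onto the compact set
    ([compact_cantor_image]). The cost of the resulting coupling is at most the
    dual value of [psi0] ([exists_coupling]), so by the equality case of the
    bathtub principle its first marginal is the measure of
    [density_of B Y c psi0], which closes the duality gap. *)

Set Implicit Arguments.
Unset Strict Implicit.
Unset Printing Implicit Defensive.

Import Order.TTheory GRing.Theory Num.Theory.
Import numFieldNormedType.Exports.

Local Open Scope classical_set_scope.
Local Open Scope ring_scope.

(** * Linear functionals dominated by a cone of bounds *)

Section domination.
Context {R : realType} {V : lmodType R}.
Variable D : set V.
Hypothesis D0 : D 0.
Hypothesis DD : forall u v, D u -> D v -> D (u + v).
Hypothesis DZ : forall a u, D u -> D (a *: u).

Definition sublinear_on (q : V -> R) :=
  (forall u v, D u -> D v -> q (u + v) <= q u + q v) /\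
  (forall a u, 0 < a -> D u -> q (a *: u) = a * q u).

Definition linear_on (q : V -> R) :=
  (forall u v, D u -> D v -> q (u + v) = q u + q v) /\
  (forall a u, D u -> q (a *: u) = a * q u).

Lemma sublinear_on0 q : sublinear_on q -> q 0 = 0.
Proof.
by move=> [_ /(_ 2 0 ltac:(by []) D0)]; rewrite scaler0; lra.
Qed.

Let DN u : D u -> D (- u).
Proof. by rewrite -scaleN1r; exact: DZ. Qed.

Lemma sublinear_onN q u : sublinear_on q -> D u -> - q (- u) <= q u.
Proof.
move=> qs Du; have := qs.1 _ _ Du (DN Du).
by rewrite subrr sublinear_on0//; lra.
Qed.

(** Lower bounds of chains, as needed for Zorn's lemma below; a directed family is
    enough. *)
Lemma inf_sublinear (I : set (V -> R)) (P : V -> R) : sublinear_on P ->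
  I !=set0 -> (forall q, I q -> sublinear_on q /\ forall u, D u -> q u <= P u) ->
  (forall q1 q2, I q1 -> I q2 -> exists q, I q /\ forall u, D u -> q u <= q1 u /\ q u <= q2 u) ->
  let q := fun u => inf [set q u | q in I] in
  sublinear_on q /\ forall r u, I r -> D u -> q u <= r u.
Proof.
move=> Ps [q0 Iq0] IP Idir.
have hi u : D u -> has_inf [set q u | q in I].
  move=> Du; split; first by exists (q0 u), q0.
  exists (- P (- u)) => _ [q Iq <-]; have [qs qP] := IP _ Iq.
  by rewrite (le_trans _ (sublinear_onN qs Du))// lerN2 qP//; exact: DN.
have qle r u : I r -> D u -> inf [set q u | q in I] <= r u.
  by move=> Ir Du; apply: ge_inf; [exact: (hi _ Du).2|exists r].
split; last by [].
split=> [u v Du Dv|a u a0 Du].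
  apply/ler_addgt0Pr => e e0.
  have e20 : 0 < e / 2 by rewrite divr_gt0.
  have [_ [q1 Iq1 <-] q1u] := inf_adherent e20 (hi _ Du).
  have [_ [q2 Iq2 <-] q2v] := inf_adherent e20 (hi _ Dv).
  have [q [Iq qq]] := Idir _ _ Iq1 Iq2.
  have := qle _ _ Iq (DD Du Dv); have := (IP _ Iq).1.1 _ _ Du Dv.
  have [+ _] := qq _ Du; have [_ +] := qq _ Dv.
  by rewrite (splitr e); lra.
have le1 b w : 0 < b -> D w -> b * inf [set q w | q in I] <= inf [set q (b *: w) | q in I].
  move=> b0 Dw; apply: lb_le_inf; first by have [] := hi _ (DZ b Dw).
  move=> _ [q Iq <-]; rewrite (IP _ Iq).1.2// ler_pM2l//.
  exact: qle.
apply/eqP; rewrite eq_le le1// andbT.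
have := le1 a^-1 _ _ (DZ a Du); rewrite invr_gt0 => /(_ a0).
by rewrite scalerA mulVf ?gt_eqF// scale1r ler_pdivrMl.
Qed.

(** Zorn's lemma gives a sublinear [q] that is minimal below [P]. For each [v],
    the functional [r u = inf_(t >= 0) (q (u + t *: v) - t * q v)] is again
    sublinear and below [q], so [q <= r]; at [u = - v], [t = 1] this says
    [q (- v) <= - q v], and an odd sublinear functional is linear. The
    properties are required on a subspace [D] only, so that [V] can be a space
    of arbitrary functions and [D] the continuous ones. *)
Lemma hahn_banach (P : V -> R) : sublinear_on P ->
  exists q : V -> R, linear_on q /\ forall u, D u -> q u <= P u.
Proof.
move=> Ps.
pose T := {q : V -> R | sublinear_on q /\ forall u, D u -> q u <= P u}.
pose le (q r : T) : bool := `[< forall u, D u -> sval r u <= sval q u >].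
have t0 : T by exists P; split.
have [|r s t /asboolP rs /asboolP st|A Atot|[q [qs qP]] qmax] :=
    @ZL_preorder T t0 le.
- by move=> t; apply/asboolP.
- by apply/asboolP => u Du; exact: le_trans (st _ Du) (rs _ Du).
- have [[t At]|A0] := pselect (A !=set0); last first.
    by exists t0 => s As; exfalso; apply: A0; exists s.
  pose I := [set sval q | q in A].
  have I0 : I !=set0 by exists (sval t), t.
  have IP q : I q -> sublinear_on q /\ forall u, D u -> q u <= P u.
    by move=> [x Ax <-]; exact: (svalP x).
  have Idir q1 q2 : I q1 -> I q2 ->
      exists q, I q /\ forall u, D u -> q u <= q1 u /\ q u <= q2 u.
    move=> [x Ax <-] [y Ay <-].
    by have [/asboolP xy|/asboolP yx] := Atot _ _ Ax Ay;
      [exists (sval y)|exists (sval x)]; split=> [|u Du]; do ?[by exists x|by exists y];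
      split=> //; [exact: xy|exact: yx].
  have [Is Ile] := inf_sublinear Ps I0 IP Idir.
  pose m : V -> R := fun u => inf [set q u | q in I].
  have mP : sublinear_on m /\ forall u, D u -> m u <= P u.
    split=> // u Du; rewrite /m; rewrite (le_trans (Ile (sval t) u _ Du))//; first by exists t.
    exact: (svalP t).2.
  exists (exist (fun q => sublinear_on q /\ forall u, D u -> q u <= P u) m mP) => s As; apply/asboolP => u Du /=.
  by apply: Ile => //; exists s.
have qmin r : sublinear_on r -> (forall u, D u -> r u <= q u) ->
    forall u, D u -> q u <= r u.
  move=> rs rq; have rP : sublinear_on r /\ forall u, D u -> r u <= P u.
    by split=> // u Du; exact: le_trans (rq _ Du) (qP _ Du).
  have /asboolP := qmax (exist (fun q => sublinear_on q /\ forall u, D u -> q u <= P u) r rP) ltac:(by apply/asboolP).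
  by [].
have qN v : D v -> q (- v) = - q v.
  move=> Dv; apply/eqP; rewrite eq_le; apply/andP; split; last first.
    by have := sublinear_onN qs (DN Dv); rewrite opprK.
  have q00 := sublinear_on0 qs.
  have qZ t u : 0 <= t -> D u -> q (t *: u) = t * q u.
    rewrite le_eqVlt => /predU1P[<-|t0'] Du; last exact: qs.2.
    by rewrite scale0r mul0r.
  (* the case [t = 0] gives [r <= q] *)
  pose r := fun u => inf [set q (u + t *: v) - t * q v | t in [set t : R | 0 <= t]].
  have hi u : D u -> has_inf [set q (u + t *: v) - t * q v | t in [set t : R | 0 <= t]].
    move=> Du; split; first by exists (q (u + 0 *: v) - 0 * q v), 0 => /=.
    exists (- q (- u)) => _ [t /= tge0 <-].
    have := qs.1 (u + t *: v) (- u) (DD Du (DZ t Dv)) (DN Du).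
    by rewrite addrAC subrr add0r qZ//; lra.
  have rle t u : 0 <= t -> D u -> r u <= q (u + t *: v) - t * q v.
    by move=> tge0 Du; apply: ge_inf; [exact: (hi _ Du).2|exists t].
  have rq u : D u -> r u <= q u.
    by move=> Du; have := rle 0 u (lexx _) Du; rewrite scale0r addr0 mul0r subr0.
  have rs : sublinear_on r.
    split=> [u w Du Dw|a u a0 Du].
      apply/ler_addgt0Pr => e e0.
      have e20 : 0 < e / 2 by rewrite divr_gt0.
      have [_ [t /= tge0 <-] tu] := inf_adherent e20 (hi _ Du).
      have [_ [s /= s0 <-] sw] := inf_adherent e20 (hi _ Dw).
      have := rle (t + s) _ (addr_ge0 tge0 s0) (DD Du Dw).
      have := qs.1 _ _ (DD Du (DZ t Dv)) (DD Dw (DZ s Dv)).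
      rewrite addrACA -scalerDl mulrDl.
      by move: tu sw; rewrite -/(r u) -/(r w) => tu sw; lra.
    have le1 b w : 0 < b -> D w -> b * r w <= r (b *: w).
      move=> b0 Dw; apply: lb_le_inf; first by have [] := hi _ (DZ b Dw).
      move=> _ [t /= tge0 <-].
      have bt : 0 <= b^-1 * t by rewrite mulr_ge0 // invr_ge0 ltW.
      have := rle (b^-1 * t) w bt Dw.
      rewrite -(ler_pM2l b0) mulrBr -(qs.2 b)//; last by apply: DD => //; exact: DZ.
      by rewrite scalerDr scalerA !mulrA divff ?gt_eqF// mul1r.
    apply/eqP; rewrite eq_le le1// andbT.
    have := le1 a^-1 _ _ (DZ a Du); rewrite invr_gt0 => /(_ a0).
    by rewrite scalerA mulVf ?gt_eqF// scale1r ler_pdivrMl.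
  have := qmin _ rs rq _ (DN Dv); have := rle 1 _ ler01 (DN Dv).
  by rewrite scale1r addNr q00 mul1r; lra.
exists q; split=> //; split=> [u v Du Dv|a u Du].
  apply/eqP; rewrite eq_le qs.1//=.
  have := qs.1 _ _ (DN Du) (DN Dv); rewrite -opprD !qN//; last exact: DD.
  by lra.
have [a0|a0|->] := ltgtP a 0; last by rewrite scale0r mul0r sublinear_on0.
  rewrite -[in LHS](opprK a) scaleNr qN; last exact: DZ.
  by rewrite qs.2 ?oppr_gt0//; ring.
exact: qs.2.
Qed.

(** [S u a] records the requirement that a functional be at most [a] at [u]. If
    these requirements form a cone and are consistent at [0], then the best bound
    [inf a] is finite and sublinear, and Hahn-Banach applies to it. *)
Lemma cone_domination (S : V -> R -> Prop) :
  (forall u v a b, S u a -> S v b -> S (u + v) (a + b)) ->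
  (forall t u a, 0 < t -> S u a -> S (t *: u) (t * a)) ->
  (forall u, D u -> exists a, S u a) ->
  (forall a, S 0 a -> 0 <= a) ->
  exists q, linear_on q /\ forall u a, D u -> S u a -> q u <= a.
Proof.
move=> SD SZ Stot S0.
pose P u := inf [set a | S u a].
have hi u : D u -> has_inf [set a | S u a].
  move=> Du; split; first by have [a ?] := Stot _ Du; exists a.
  have [b Sb] := Stot _ (DN Du); exists (- b) => a /= Sa.
  by have := SD _ _ _ _ Sa Sb; rewrite subrr => /S0; lra.
have Ple u a : D u -> S u a -> P u <= a.
  by move=> Du Sa; apply: ge_inf => //; exact: (hi _ Du).2.
have Ps : sublinear_on P.
  split=> [u v Du Dv|a u a0 Du].
    apply/ler_addgt0Pr => e e0.
    have e20 : 0 < e / 2 by rewrite divr_gt0.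
    have [a /= Sa au] := inf_adherent e20 (hi _ Du).
    have [b /= Sb bv] := inf_adherent e20 (hi _ Dv).
    have := Ple _ _ (DD Du Dv) (SD _ _ _ _ Sa Sb).
    by move: au bv; rewrite -/(P u) -/(P v); lra.
  have le1 b w : 0 < b -> D w -> b * P w <= P (b *: w).
    move=> b0 Dw; apply: lb_le_inf; first by have [] := hi _ (DZ b Dw).
    move=> x /= Sx; rewrite -ler_pdivlMl//; apply: Ple => //.
    have := SZ b^-1 _ _ _ Sx; rewrite invr_gt0 => /(_ b0).
    by rewrite scalerA mulVf ?gt_eqF// scale1r.
  apply/eqP; rewrite eq_le le1// andbT.
  have := le1 a^-1 _ _ (DZ a Du); rewrite invr_gt0 => /(_ a0).
  by rewrite scalerA mulVf ?gt_eqF// scale1r ler_pdivrMl.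
have [q [ql qP]] := hahn_banach Ps.
by exists q; split=> // u a Du Sa; exact: le_trans (qP _ Du) (Ple _ _ Du Sa).
Qed.

End domination.

(** * Positive functionals on the Cantor space are measures *)

(** A copy of the Cantor space on which the clopen sets are the algebra of
    measurable sets; a content on it extends to the sigma-algebra of
    [cantor_measurable], which is the one generated by the clopen sets. *)
Definition clopen_cantor : Type := cantor_space.
Definition clopen_display : measure_display.
Proof. exact: (sigma_display (@clopen cantor_space)). Qed.

HB.instance Definition _ := Pointed.on clopen_cantor.
HB.instance Definition _ := isAlgebraOfSets.Build clopen_display clopen_cantor
  (@clopen0 cantor_space) (@clopenU cantor_space)
  (fun A cA => @clopenC cantor_space A set0 cA).

Notation cantor_measurable := (g_sigma_algebraType (@measurable _ clopen_cantor)).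

Section clopen_separation.

(** Clopen neighbourhoods form a base, and finitely many of them inside [O] cover
    the compact set [F]. *)
Lemma clopen_between (F O : set cantor_space) : closed F -> open O ->
  F `<=` O -> exists U, [/\ clopen U, F `<=` U & U `<=` O].
Proof.
move=> cF oO FO.
have cptF : compact F.
  by apply: (subclosed_compact cF cantor_space_compact).
have h (x : cantor_space) : exists V : set cantor_space,
    clopen V /\ (F x -> V x /\ V `<=` O).
  have [Fx|nFx] := pselect (F x); last by exists set0; split; first exact: clopen0.
  have := zero_dimensional_cvg (x := x) cantor_space_hausdorff cantor_zero_dimensional
    cantor_space_compact.
  move=> /(_ O (open_nbhs_nbhs (conj oO (FO _ Fx))))[V [Vx cV] VO].
  by exists V.
pose V x := projT1 (cid (h x)).
have VP x : clopen (V x) /\ (F x -> V x x /\ V x `<=` O) := projT2 (cid (h x)).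
move: cptF; rewrite compact_cover => /(_ _ F V)[|x Fx|D DF FD].
- by move=> x _; have [[]] := VP x.
- by exists x => //; exact: ((VP x).2 Fx).1.
exists (\bigcup_(x in [set` D]) V x); split.
- split; first by apply: bigcup_open => x _; have [[]] := VP x.
  rewrite -bigsetU_fset_set ?set_fsetK//; apply: closed_bigsetU => x _.
  by have [[]] := VP x.
- by [].
- move=> y [x /= /DF/set_mem Fx]; exact: ((VP x).2 Fx).2.
Qed.

Lemma continuous_clopen_between {R : realType} (f : cantor_space -> R) (a b : R) :
  continuous f -> a < b ->
  exists U, [/\ clopen U, forall x, b <= f x -> U x & forall x, U x -> a < f x].
Proof.
move=> cf ab.
have [||x /= bfx|U [cU bU Ua]] := @clopen_between (f @^-1` [set y | b <= y]) (f @^-1` [set y | a < y]).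
- by apply: preimage_closed => [x _|]; [exact: cf|exact: closed_ge].
- by apply: open_comp => [x _|]; [exact: cf|exact: open_gt].
- exact: lt_le_trans bfx.
- by exists U; split.
Qed.

Lemma clopen_indic_continuous {R : realType} (A : set cantor_space) :
  clopen A -> continuous (\1_A : cantor_space -> R).
Proof.
move=> [oA cA] x; have [Ax|nAx] := pselect (A x).
  have E : (\1_A x : R) = 1 by rewrite indicE mem_set.
  have nA : nbhs x A by apply: open_nbhs_nbhs; split.
  rewrite /continuous_at E; apply: cvg_near_cst.
  by apply: filterS nA => y Ay; rewrite indicE mem_set.
have E : (\1_A x : R) = 0 by rewrite indicE memNset.
have nA : nbhs x (~` A).
  by apply: open_nbhs_nbhs; split => //; exact: closed_openC.
rewrite /continuous_at E; apply: cvg_near_cst.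
by apply: filterS nA => y Ay; rewrite indicE memNset.
Qed.

End clopen_separation.

Section clopen_step.
Context {R : realType}.

(** With [U k] clopen between [f >= a + (k + 1) e] and [f > a + k e], the sum of
    the indicators counts the thresholds below [f x] up to one. *)
Lemma clopen_step_approx (f : cantor_space -> R) (a e : R) (N : nat) :
  continuous f -> 0 < e -> (forall x, a <= f x <= a + N%:R * e) ->
  exists U : nat -> set cantor_space, (forall k, clopen (U k)) /\
    forall x, `|f x - (a + e * \sum_(k < N) \1_(U k) x)| <= e.
Proof.
move=> cf e0 af.
have lt_step k : a + k%:R * e < a + k.+1%:R * e.
  by rewrite ltrD2l ltr_pM2r// ltr_nat.
pose U k := projT1 (cid (continuous_clopen_between cf (lt_step k))).
have UP k := projT2 (cid (continuous_clopen_between cf (lt_step k))).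
exists U; split=> [k|x]; first by have [] := UP k.
have /andP[afx fxN] := af x; rewrite ler_distl; apply/andP; split.
  suff H n : a + e * \sum_(k < n) \1_(U k) x <= f x + e by rewrite lerBlDr.
  elim: n => [|n IH]; first by rewrite big_ord0 mulr0 addr0 ler_wpDr// ltW.
  rewrite big_ord_recr/= indicE.
  have [/set_mem Ux|] := boolP (x \in U n); last by rewrite addr0.
  have fxn : a + n%:R * e < f x by have [_ _] := UP n; apply.
  have : \sum_(k < n) \1_(U k) x <= n%:R :> R.
    have -> : n%:R = \sum_(k < n) 1 :> R by rewrite sumr_const card_ord.
    by apply: ler_sum => i _; rewrite indicE; case: (_ \in _).
  by rewrite mulrDr mulr1 -(ler_pM2l e0) => le_n; rewrite mulrC in fxn *; lra.
have H n : f x <= a + n%:R * e -> f x <= a + e * \sum_(k < n) \1_(U k) x + e.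
  elim: n => [|n IH] fxn; first by rewrite big_ord0 mulr0 addr0; rewrite mul0r in fxn; lra.
  have [/IH fxn'|fxn'] := leP (f x) (a + n%:R * e).
    apply: (le_trans fxn'); rewrite big_ord_recr/= lerD2r lerD2l ler_pM2l// lerDl indicE.
    by case: (_ \in _).
  rewrite big_ord_recr/= (eq_bigr (fun=> 1)) => [|k _].
    rewrite sumr_const card_ord -[X in _ * (X + _)]/(n%:R).
    have : 0 <= e * \1_(U n) x by rewrite mulr_ge0 ?indicE ?ler0n// ltW.
    by move: fxn; rewrite -natr1; lra.
  rewrite indicE mem_set//; have [_ + _] := UP k; apply.
  by apply: le_trans (ltW fxn'); rewrite lerD2l ler_pM2r// ler_nat.
exact: H.
Qed.

Let C : set (cantor_space -> R) := [set f | continuous f].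

Lemma continuous_cantor_bounded (f : cantor_space -> R) : continuous f ->
  exists2 M, 0 < M & forall x, `|f x| <= M.
Proof.
move=> cf.
have [||x _ xmax] := @compact_EVT_max _ R (fun x => `|f x|) setT _ cantor_space_compact.
- by exists point.
- apply: continuous_subspaceT => x; apply: cvg_norm; exact: cf.
exists (`|f x| + 1) => [|y]; first by rewrite ltr_wpDl.
by rewrite (le_trans (xmax y _))//= ?lerDl// in_setT.
Qed.

(** A superlevel set [a < f] is the union of clopen sets between
    [f >= a + 1 / (n + 1)] and [a < f]. *)
Lemma continuous_cantor_measurable (f : cantor_space -> R) : continuous f ->
  measurable_fun [set: cantor_measurable] (f : cantor_measurable -> R).
Proof.
move=> cf; apply: (measurability _ (RGenOInfty.measurableE R)) => _ [_ [a ->] <-].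
rewrite setTI.
have aS n : a < a + n.+1%:R^-1 by rewrite ltrDl invr_gt0.
pose U n := projT1 (cid (continuous_clopen_between cf (aS n))).
have UP n := projT2 (cid (continuous_clopen_between cf (aS n))).
rewrite (_ : _ @^-1` _ = \bigcup_n (U n : set cantor_measurable)); last first.
  apply/seteqP; split=> x /=.
    rewrite in_itv/= andbT => afx.
    have [n nfx] : exists n, n.+1%:R^-1 < f x - a.
      near \oo => n; exists n; near: n; apply: near_infty_natSinv_lt (PosNum _).
      by rewrite subr_gt0.
    by exists n => //; have [_ + _] := UP n; apply; rewrite -lerBrDl ltW.
  move=> [n _ Ux]; rewrite in_itv/= andbT.
  by have [_ _ +] := UP n; apply.
apply: bigcup_measurable => n _; apply: sub_sigma_algebra.
by have [] := UP n.
Unshelve. all: by end_near. Qed.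

Lemma continuous_cantor_integrable (m : {measure set cantor_measurable -> \bar R})
    (f : cantor_space -> R) :
  (m setT < +oo)%E -> continuous f -> m.-integrable setT (EFin \o f).
Proof.
move=> moo cf; apply: (@measurable_bounded_integrable _ cantor_measurable) => //.
- exact: continuous_cantor_measurable.
- have [M M0 fM] := continuous_cantor_bounded cf.
  exists M; split; first exact: num_real.
  by move=> N MN x _; apply: (le_trans (fM x)); exact: ltW.
Qed.

(** Both functionals agree on clopen step functions, which approximate [f]
    uniformly; positivity controls the error by a multiple of the value at the
    constant 1. *)
Lemma positive_functional_ext (L1 L2 : (cantor_space -> R) -> R) :
  linear_on C L1 -> linear_on C L2 ->
  (forall f g, C f -> C g -> (forall x, f x <= g x) -> L1 f <= L1 g) ->
  (forall f g, C f -> C g -> (forall x, f x <= g x) -> L2 f <= L2 g) ->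
  (forall A, @clopen cantor_space A -> L1 \1_A = L2 \1_A) ->
  forall f, C f -> L1 f = L2 f.
Proof.
move=> l1 l2.
wlog suff Hle : L1 L2 l1 l2 / (forall f g, C f -> C g -> (forall x, f x <= g x) -> L1 f <= L1 g) ->
  (forall f g, C f -> C g -> (forall x, f x <= g x) -> L2 f <= L2 g) ->
  (forall A, @clopen cantor_space A -> L1 \1_A = L2 \1_A) ->
  forall f, C f -> L1 f <= L2 f.
  move=> m1 m2 L12 f Cf; apply/eqP; rewrite eq_le !Hle// => A cA.
  by rewrite L12.
move=> m1 m2 L12 f Cf; apply/ler_addgt0Pr => d d0.
have C1 a : C (cst a) by move=> x; exact: cst_continuous.
have CD g h : C g -> C h -> C (g + h).
  by move=> Cg Ch x; apply: cvgD; [exact: Cg|exact: Ch].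
have CZ a g : C g -> C (a *: g) by move=> Cg x; apply: cvgZr; exact: Cg.
have C0 : C 0 by exact: C1.
have L1E : L1 (cst 1) = L2 (cst 1) by rewrite -indicT L12//; exact: clopenT.
have L0 L : linear_on C L -> L 0 = 0.
  by move=> l; have := l.2 0 _ C0; rewrite scale0r mul0r.
have L1ge0 : 0 <= L1 (cst 1).
  by have := m1 0 (cst 1) C0 (C1 1) (fun=> ler01); rewrite L0.
have [M M0 fM] := continuous_cantor_bounded Cf.
(* the step [e] makes the total error [2 * e * L1 1] at most [d] *)
pose e := d / (2 * (L1 (cst 1) + 1)).
have L1p : 0 < 2 * (L1 (cst 1) + 1) by rewrite mulr_gt0// ltr_wpDl.
have e0 : 0 < e by rewrite divr_gt0.
have [N MN] : exists N : nat, 2 * M <= N%:R * e.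
  exists (Num.bound (2 * M / e)); rewrite -ler_pdivrMr//.
  by apply/ltW/archi_boundP/ltW; rewrite divr_gt0// mulr_gt0.
have [|U [cU fU]] := @clopen_step_approx f (- M) e N Cf e0.
  move=> x; have := fM x; rewrite ler_norml => /andP[-> fxM] /=; lra.
pose S := \sum_(k < N) (\1_(U k) : cantor_space -> R).
have CS n : C (\sum_(k < n) (\1_(U k) : cantor_space -> R)).
  elim: n => [|n IH]; first by rewrite big_ord0.
  by rewrite big_ord_recr; apply: CD => //; apply: clopen_indic_continuous; exact: cU.
have LS : L1 S = L2 S.
  rewrite /S; elim: N {MN fU S} => [|n IH].
    by rewrite big_ord0 !L0.
  have cUn := clopen_indic_continuous (cU n).
  by rewrite !big_ord_recr l1.1// l2.1// IH L12.
pose s (b : R) : cantor_space -> R := b *: cst 1 + e *: S.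
have Cs b : C (s b) by apply: CD; apply: CZ; [exact: C1|exact: CS].
have sE b x : s b x = b + e * \sum_(k < N) \1_(U k) x.
  by rewrite /s /S !fctE fct_sumE /= /GRing.scale/= mulr1.
have Ls L b : linear_on C L -> L (s b) = b * L (cst 1) + e * L S.
  by move=> l; rewrite /s l.1 ?l.2//; [exact: CS|exact: CZ|apply: CZ; exact: CS].
have up : L1 f <= L1 (s (- M + e)).
  by apply: m1 => // x; rewrite sE; have := fU x; rewrite ler_norml => /andP[]; lra.
have lo : L2 (s (- M - e)) <= L2 f.
  by apply: m2 => // x; rewrite sE; have := fU x; rewrite ler_norml => /andP[]; lra.
have eL : 2 * e * L1 (cst 1) <= d.
  have : e * (2 * (L1 (cst 1) + 1)) = d by rewrite /e divfK ?gt_eqF.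
  by lra.
by move: up lo; rewrite !Ls// -L1E LS; lra.
Qed.

End clopen_step.

Section cantor_measure.
Context {R : realType} (Lam : (cantor_space -> R) -> R).
Let C : set (cantor_space -> R) := [set f | continuous f].
Hypothesis Lam_linear : linear_on C Lam.
Hypothesis Lam_le0 : forall f, C f -> (forall x, f x <= 0) -> Lam f <= 0.

Let C0 : C 0.
Proof. by move=> x; exact: cst_continuous. Qed.

Let CD f g : C f -> C g -> C (f + g).
Proof. by move=> Cf Cg x; apply: cvgD; [exact: Cf|exact: Cg]. Qed.

Let CZ a f : C f -> C (a *: f).
Proof. by move=> Cf x; apply: cvgZr; exact: Cf. Qed.

Let CI A : @clopen cantor_space A -> C \1_A.
Proof. exact: clopen_indic_continuous. Qed.

Lemma positive_functional_le f g : C f -> C g -> (forall x, f x <= g x) -> Lam f <= Lam g.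
Proof.
move=> Cf Cg fg; have := @Lam_le0 (f + (-1) *: g) (CD Cf (@CZ (-1) _ Cg)).
rewrite Lam_linear.1 ?Lam_linear.2//; last exact: CZ.
rewrite mulN1r subr_le0; apply => x.
by rewrite fctE scaleN1r subr_le0.
Qed.

Definition clopen_content (A : set clopen_cantor) : \bar R :=
  if `[< @clopen cantor_space A >] then (Lam \1_A)%:E else 0%E.

Lemma clopen_contentE A : @clopen cantor_space A -> clopen_content A = (Lam \1_A)%:E.
Proof. by move=> cA; rewrite /clopen_content asboolT. Qed.

Let Lam0 : Lam 0 = 0.
Proof. by rewrite -(scale0r 0) Lam_linear.2// mul0r. Qed.

Let content_ge0 A : (0 <= clopen_content A)%E.
Proof.
rewrite /clopen_content; case: asboolP => // cA; rewrite lee_fin -Lam0.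
apply: (positive_functional_le C0 (CI cA)) => x.
by rewrite indicE ler0n.
Qed.

Let content_set0 : clopen_content set0 = 0%E.
Proof. by rewrite clopen_contentE ?indic0 ?Lam0//; exact: clopen0. Qed.

Let content_additive : measure_function.semi_additive clopen_content.
Proof.
apply/additive2P => // A B mA mB AB0.
rewrite (clopen_contentE mA) (clopen_contentE mB) (clopen_contentE (clopenU mA mB)).
rewrite -EFinD -Lam_linear.1; [|exact: CI|exact: CI].
congr (Lam _)%:E; apply/funext => x; rewrite fctE !indicE in_setU.
have [/set_mem Ax|] := boolP (x \in A); have [/set_mem Bx|] := boolP (x \in B).
- by have : (A `&` B) x by []; rewrite AB0.
- by rewrite addr0.
- by rewrite add0r.
- by rewrite addr0.
Qed.

HB.instance Definition _ := isContent.Build _ _ _ clopen_content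
  content_ge0 content_additive.

(** A disjoint sequence of clopen sets with a clopen, hence compact, union has only
    finitely many non-empty terms, so sigma-additivity reduces to additivity. *)
Let content_sigma_additive : measure_function.semi_sigma_additive clopen_content.
Proof.
move=> F mF tF mUF.
have cptU : compact (\bigcup_n F n : set cantor_space).
  by apply: (subclosed_compact mUF.2 cantor_space_compact).
move: cptU; rewrite compact_cover => /(_ nat setT F)[i _|x [i _ Fix]|D _ DF].
- by have [] := mF i.
- by exists i.
have [N DN] : exists N, forall i, i \in D -> (i < N)%N.
  exists (\max_(i <- D) i).+1 => i iD; rewrite ltnS.
  by rewrite (big_rem i)//= leq_maxl.
have UN n : (N <= n)%N -> \bigcup_n F n = \big[setU/set0]_(i < n) F i.
  move=> Nn; rewrite -bigcup_mkord; apply/seteqP; split=> x.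
    by move=> /DF[i /= /DN iN Fix]; exists i => //=; exact: leq_trans Nn.
  by move=> [i _ Fix]; exists i.
apply: cvg_near_cst; near=> n.
rewrite [in RHS](UN n); last by near: n; exists N.
rewrite content_additive//; last by rewrite -UN//; near: n; exists N.
by rewrite big_mkord.
Unshelve. all: by end_near. Qed.

HB.instance Definition _ := Content_isMeasure.Build _ _ _ clopen_content
  content_sigma_additive.

Definition cantor_measure : {measure set cantor_measurable -> \bar R} :=
  measure_extension clopen_content.

Lemma cantor_measureE A : @clopen cantor_space A -> cantor_measure A = (Lam \1_A)%:E.
Proof.
move=> cA; rewrite -(clopen_contentE cA).
exact: (@measurable_mu_extE _ R _ (clopen_content : {measure set clopen_cantor -> \bar R}) A cA).
Qed.

Let m := cantor_measure.
Let M1 := Lam (cst 1).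

Let C1 a : C (cst a).
Proof. by move=> x; exact: cst_continuous. Qed.

Lemma cantor_measureT : m setT = M1%:E.
Proof. by rewrite /m (cantor_measureE (@clopenT _)) indicT. Qed.

Let m_lty : (m setT < +oo)%E.
Proof. by rewrite cantor_measureT ltry. Qed.

Lemma cantor_integralE (f : cantor_space -> R) : continuous f ->
  \int[m]_x f x = Lam f.
Proof.
apply: (@positive_functional_ext R (fun g => \int[m]_x g x)) => //.
- split=> [g h cg ch|a g cg].
    by apply: RintegralD => //; exact: continuous_cantor_integrable.
  by apply: RintegralZl => //; exact: continuous_cantor_integrable.
- move=> g h cg ch gh; apply: le_Rintegral => //.
  + exact: continuous_cantor_integrable.
  + exact: continuous_cantor_integrable.
- by move=> g h cg ch; exact: positive_functional_le.
- move=> A cA; rewrite /Rintegral integral_indic//; last exact: sub_sigma_algebra.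
  by rewrite setIT /m cantor_measureE.
Qed.

End cantor_measure.

(** Since [S f 0] holds for [f <= 0], a functional dominated by [S] is positive, and
    the measure extending its values on clopen sets represents it. The bound at
    the constant 1 gives a bound at every continuous function. *)
Lemma riesz_cone {R : realType} (S : (cantor_space -> R) -> R -> Prop) (a1 : R) :
  (forall u v a b, S u a -> S v b -> S (u + v) (a + b)) ->
  (forall t u a, 0 < t -> S u a -> S (t *: u) (t * a)) ->
  (forall u, (forall x, u x <= 0) -> S u 0) ->
  S (cst 1) a1 ->
  (forall a, S 0 a -> 0 <= a) ->
  exists m : {measure set cantor_measurable -> \bar R}, (m setT < +oo)%E /\
    forall f a, continuous f -> S f a -> \int[m]_x f x <= a.
Proof.
move=> SD SZ Sle0 S1 S0.
pose C : set (cantor_space -> R) := [set f | continuous f].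
have C0 : C 0 by move=> x; exact: cst_continuous.
have CD g h : C g -> C h -> C (g + h).
  by move=> Cg Ch x; apply: cvgD; [exact: Cg|exact: Ch].
have CZ a g : C g -> C (a *: g) by move=> Cg x; apply: cvgZr; exact: Cg.
have [|Lam [lLam LamS]] := cone_domination C0 CD CZ SD SZ _ S0.
  move=> u /continuous_cantor_bounded[M M0 uM].
  exists (M * a1 + 0); rewrite (_ : u = M *: cst 1 + (u - M *: cst 1)); last first.
    by rewrite addrCA subrr addr0.
  apply: SD; first exact: SZ.
  apply: Sle0 => x; rewrite !fctE /GRing.scale/= mulr1 subr_le0.
  by rewrite (le_trans _ (uM x))// ler_norm.
have Lam_le0 f : C f -> (forall x, f x <= 0) -> Lam f <= 0.
  by move=> Cf /Sle0; exact: LamS.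
exists (cantor_measure lLam Lam_le0); split; first by rewrite cantor_measureT ltry.
by move=> f a Cf Sfa; rewrite cantor_integralE//; exact: LamS.
Qed.

(** * Compact sets as images of the Cantor space *)

Lemma set_val_continuous {T : topologicalType} (Z : set T) : continuous (set_val : Z -> T).
Proof. exact: initial_continuous. Qed.

(** A non-empty compact metrisable space is an image of the Cantor space
    ([cantor_surj]); the set [Z] is made into such a space through its subtype. *)
Lemma compact_cantor_image_pointed {R : realType} {T : pseudoPMetricType R} (Z : set T) :
  hausdorff_space T -> compact Z -> Z !=set0 ->
  exists h : cantor_space -> T, continuous h /\ range h = Z.
Proof.
move=> hT cZ [z Zz].
pose z0 : Z := SigSub (mem_set Zz).
pose ZP : pseudoPMetricType R := HB.pack (set_type Z) (isPointed.Build (set_type Z) z0).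
have cptZ : compact [set: ZP].
  rewrite compact_cover => J D f fop fcov.
  have fop' i : exists U : set T, D i -> open U /\ f i = set_val @^-1` U.
    have [Di|] := pselect (D i); last by exists setT.
    by have [U oU Uf] := fop _ Di; exists U.
  pose U i := projT1 (cid (fop' i)).
  have UP i := projT2 (cid (fop' i)).
  move: cZ; rewrite compact_cover => /(_ J D U)[i /UP[]//|x Zx|F FD FU].
    have [i Di fi] := fcov (SigSub (mem_set Zx)) I.
    by exists i => //; move: fi; rewrite (UP _ Di).2.
  exists F => // x _; have [i iF Ui] := FU _ (set_valP x).
  by exists i => //; rewrite (UP i _).2//; exact/set_mem/FD.
have hZ : hausdorff_space ZP.
  rewrite open_hausdorff => x y xy.
  have := hT; rewrite open_hausdorff => /(_ (set_val x) (set_val y)).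
  case=> [|[U V] [/= Ux Vy] [oU oV UV0]].
    by apply: contra xy => /eqP/val_inj ->.
  exists (set_val @^-1` U, set_val @^-1` V) => /=; first by rewrite !inE in Ux Vy *.
  split; [by exists U|by exists V|].
  by rewrite -preimage_setI (eqP UV0) preimage_set0.
have [f cf] := @cantor_surj R ZP cptZ hZ.
exists (set_val \o f); split.
  by move=> x; apply: continuous_comp; [exact: cf|exact: set_val_continuous].
apply/seteqP; split=> [_ [x _ <-]|x Zx]; first exact: set_valP.
have [y _ fy] := @surj _ _ _ _ f (SigSub (mem_set Zx)) I.
by exists y => //=; rewrite fy.
Qed.

Lemma compact_cantor_image {R : realType} {T : pseudoMetricType R} (Z : set T) :
  hausdorff_space T -> compact Z -> Z !=set0 ->
  exists h : cantor_space -> T, continuous h /\ range h = Z.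
Proof.
move=> hT cZ [z Zz].
pose TP : pseudoPMetricType R := HB.pack (PseudoMetric.sort T) (isPointed.Build T z).
by apply: (@compact_cantor_image_pointed R TP Z hT cZ); exists z.
Qed.

(** * Borel sets and continuous functions on product spaces *)

Section countable_base.

(** A countable base exhibits open sets of a product as countable unions of boxes,
    hence as measurable sets for the product sigma-algebra. *)
Definition countable_base (T : topologicalType) (I : countType) (B : I -> set T) :=
  (forall i, open (B i)) /\
  forall U x, open U -> U x -> exists i, B i x /\ B i `<=` U.

Lemma countable_base_bigcup (T : topologicalType) (I : countType) (B : I -> set T) U :
  countable_base B -> open U -> U = \bigcup_(i in [set i | B i `<=` U]) B i.
Proof.
move=> [_ bB] oU; apply/seteqP; split=> [x Ux|x [i /= + Bix]]; last exact.
by have [i [Bix BiU]] := bB _ _ oU Ux; exists i.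
Qed.

Lemma openX (T1 T2 : topologicalType) (A : set T1) (B : set T2) :
  open A -> open B -> open (A `*` B).
Proof.
move=> oA oB; rewrite openE => -[x y] [/= Ax By].
by exists (A, B) => //; split; apply: open_nbhs_nbhs.
Qed.

Lemma countable_baseX (T1 T2 : topologicalType) (I1 I2 : countType)
    (B1 : I1 -> set T1) (B2 : I2 -> set T2) :
  countable_base B1 -> countable_base B2 ->
  @countable_base (T1 * T2)%type (I1 * I2)%type (fun i => B1 i.1 `*` B2 i.2).
Proof.
move=> [op1 b1] [op2 b2]; split=> [i|U [x y] oU Uxy].
  by apply: openX.
have : nbhs (x, y) U by exact: open_nbhs_nbhs.
move=> [] [V W] /= [Vx Wy] VWU.
move: Vx Wy; rewrite !nbhsE => -[V' [oV' V'x] VV'] -[W' [oW' W'y] WW'].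
have [i [Bix BiV]] := b1 _ _ oV' V'x; have [j [Bjy BjW]] := b2 _ _ oW' W'y.
exists (i, j); split=> // -[u v] /= [Biu Bjv]; apply: VWU; split=> /=.
  exact/VV'/BiV.
exact/WW'/BjW.
Qed.

Context {R : realType}.

Lemma rV_countable_base n : countable_base
  (fun k : 'rV[rat]_n * rat => if 0 < (ratr k.2 : R)
     then ball (map_mx ratr k.1 : 'rV[R]_n) (ratr k.2 : R) else set0).
Proof.
split=> [k|U x oU]; first by case: ifP => _; [exact: ball_open|exact: open0].
rewrite {1}(open_rV_ratball oU) => -[k /= kU kx]; exists k.
by case: ifPn => // k0; have [] := kx; rewrite (negbTE k0).
Qed.

Lemma R_countable_base : countable_base (fun k : rat * rat => `]ratr k.1 : R, ratr k.2[%classic).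
Proof.
split=> [k|U x oU Ux]; first exact: interval_open.
have /nbhs_ballP[e /= e0 eU] := open_nbhs_nbhs (conj oU Ux).
have [|p] := @rat_in_itvoo R (x - e) x; first by rewrite ltrBlDr ltrDl.
rewrite in_itv/= => /andP[p1 p2].
have [|q] := @rat_in_itvoo R x (x + e); first by rewrite ltrDl.
rewrite in_itv/= => /andP[q1 q2].
exists (p, q) => /=; split; first by rewrite in_itv/= p2 q1.
by move=> y /=; rewrite in_itv/= => /andP[py yq]; apply: eU; rewrite /ball/= ltr_distl; lra.
Qed.

Lemma base_source n : countable_base (fun k : ('rV[rat]_n * rat) * (rat * rat) =>
  (if 0 < (ratr k.1.2 : R)
     then ball (map_mx ratr k.1.1 : 'rV[R]_n) (ratr k.1.2 : R) else set0) `*`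
  `]ratr k.2.1 : R, ratr k.2.2[%classic).
Proof. exact: (countable_baseX (@rV_countable_base n) R_countable_base). Qed.

Lemma open_measurable_source n (U : set ('rV[R]_n * R)) : open U ->
  measurable (U : set ('rV[R]_n * measurableTypeR R)).
Proof.
move=> oU; rewrite (countable_base_bigcup (@base_source n) oU) bigcup_mkcond.
apply: countable_bigcupT_measurable => [//|k]; case: ifPn => // _.
apply: measurableX; last exact: measurable_itv.
by case: ifP => // _; apply: open_measurable_rV; exact: ball_open.
Qed.

Lemma open_measurable_source_target n m (U : set (('rV[R]_n * R) * 'rV[R]_m)) : open U ->
  measurable (U : set (('rV[R]_n * measurableTypeR R) * 'rV[R]_m)).
Proof.
move=> oU.
rewrite (countable_base_bigcup (countable_baseX (@base_source n) (@rV_countable_base m)) oU).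
rewrite bigcup_mkcond; apply: countable_bigcupT_measurable => [//|k]; case: ifPn => // _.
apply: measurableX; last by case: ifP => // _; apply: open_measurable_rV; exact: ball_open.
apply: open_measurable_source; apply: openX; last exact: interval_open.
by case: ifP => _; [exact: ball_open|exact: open0].
Qed.

(** The map [phi] is meant to be the identity between two types with the same
    carrier, one with the topology and one with the sigma-algebra. *)
Lemma within_continuous_measurable (T : topologicalType) d (T' : measurableType d)
  (phi : T' -> T) (A : set T) (f : T -> R) :
  (forall U, open U -> measurable (phi @^-1` U)) ->
  {within A, continuous f} -> measurable_fun (phi @^-1` A) (f \o phi).
Proof.
move=> mphi /continuousP cf mA; apply: (measurability _ (RGenOInfty.measurableE R)) => //.
move=> _ [_ [a ->] <-].
have := cf `]a, +oo[%classic (@interval_open R (BRight a) +oo%O isT isT).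
move=> /open_subspaceP[V oV VA].
rewrite (_ : _ `&` _ = phi @^-1` V `&` phi @^-1` A); first by apply: measurableI => //; exact: mphi.
have VAE z : (V `&` A) z <-> (f @^-1` `]a, +oo[%classic `&` A) z by rewrite VA.
by apply/seteqP; split=> x /= [? ?]; have [VA1 VA2] := VAE (phi x);
  [have [] := VA2 (conj _ _)|have [] := VA1 (conj _ _)].
Qed.

Lemma continuous_cantor_measurable_rV n (h : cantor_space -> 'rV[R]_n) :
  continuous h -> measurable_fun [set: cantor_measurable] (h : cantor_measurable -> _).
Proof.
move=> ch; apply: (@measurability _ _ cantor_measurable _ setT h open erefl) => _ [U oU <-].
rewrite setTI (open_rV_ratball oU) preimage_bigcup bigcup_mkcond.
apply: countable_bigcupT_measurable => [//|k]; case: ifPn => // _.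
set q := map_mx _ _; set r := ratr _.
rewrite (_ : _ @^-1` _ = setT `&` (fun x => r - `|q - h x|) @^-1` `]0, +oo[%classic).
  apply: (@continuous_cantor_measurable R (fun x => r - `|q - h x|)) => //.
  by move=> x; apply: cvgB; [exact: cvg_cst|apply: cvg_norm; apply: cvgB; [exact: cvg_cst|exact: ch]].
rewrite setTI; apply/seteqP; split=> x; rewrite /preimage/= in_itv/= andbT subr_gt0 -ball_normE//.
Qed.

Lemma continuous_rV_measurable n (f : 'rV[R]_n -> R) : continuous f ->
  measurable_fun setT f.
Proof.
move=> cf; have := @within_continuous_measurable _ _ _ (id : 'rV[R]_n -> 'rV[R]_n) setT f.
apply; first by move=> U; exact: open_measurable_rV.
exact: continuous_subspaceT.
Qed.

(** These functions increase to the indicator of [0 < f]. *)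
Let ramp (T : Type) (f : T -> R) (k : nat) (x : T) : R :=
  Num.min 1 (k%:R * Num.max 0 (f x)).

Let ramp_ge0 T (f : T -> R) k x : 0 <= ramp f k x.
Proof. by rewrite /ramp le_min ler01/= mulr_ge0// le_max lexx. Qed.

Let ramp_le1 T (f : T -> R) k x : ramp f k x <= 1.
Proof. by rewrite /ramp ge_min lexx. Qed.

Let ramp_continuous (T : topologicalType) (f : T -> R) k : continuous f -> continuous (ramp f k).
Proof.
move=> cf x; apply: (@continuous_min R _ (cst 1) (fun x => k%:R * Num.max 0 (f x))).
  exact: cst_continuous.
apply: cvgMr; apply: (@continuous_max R _ (cst 0) f); first exact: cst_continuous.
exact: cf.
Qed.

Let ramp_cvg d (T : measurableType d) (m : {measure set T -> \bar R}) (f : T -> R) :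
  (forall k, measurable_fun setT (ramp f k)) ->
  (fun k => \int[m]_x (ramp f k x)%:E)%E @ \oo --> m [set x | 0 < f x].
Proof.
move=> mf.
have rlim x : EFin \o (ramp f ^~ x) @ \oo --> (\1_[set x | 0 < f x] x)%:E.
  apply: cvg_near_cst; have [fx0|fx0] := ltP 0 (f x); last first.
    have nfx : ~ [set x | 0 < f x] x by rewrite /= ltNge fx0.
    by near=> k; rewrite /= indicE memNset// /ramp (max_l fx0) mulr0 min_r.
  near=> k; rewrite /= indicE mem_set//; congr EFin; rewrite /ramp max_r ?ltW//.
  rewrite min_l// -ler_pdivrMr// mul1r; near: k.
  exists (Num.bound (f x)^-1) => // k /= kb.
  have fx_ge0 : 0 <= (f x)^-1 by rewrite invr_ge0 ltW.
  by apply: (le_trans (ltW (archi_boundP fx_ge0))); rewrite ler_nat.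
have -> : m [set x | 0 < f x] = (\int[m]_x limn (fun k => (ramp f k x)%:E))%E.
  rewrite -[X in m X = _]setIT -integral_indic//; last first.
    rewrite (_ : [set x | _] = setT `&` ramp f 1 @^-1` `]0, +oo[%classic); first exact: mf.
    rewrite setTI; apply/seteqP; split=> x /=; rewrite in_itv/= andbT /ramp mul1r.
      by move=> fx0; rewrite lt_min ltr01/= lt_max fx0 orbT.
    by rewrite lt_min ltr01/= lt_max ltxx.
  by apply: eq_integral => x _; apply/esym/cvg_lim => //; exact: rlim.
apply: cvg_monotone_convergence => //.
- by move=> k; apply/measurable_EFinP.
- by move=> k x _; rewrite lee_fin.
- move=> x _ k l kl; rewrite lee_fin /ramp le_min !ge_min lexx/=.
  by rewrite ler_wpM2r ?orbT// ?le_max ?lexx// ler_nat.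
Unshelve. all: by end_near. Qed.

(** The sets [0 < f] with [f] continuous form a pi-system that generates the Borel
    sets, and the integrals of [ramp f k] converge to their measures. *)
Lemma rV_measure_eq n (m1 m2 : {measure set 'rV[R]_n -> \bar R}) :
  (m1 setT < +oo)%E ->
  (forall f : 'rV[R]_n -> R, continuous f -> (forall x, 0 <= f x <= 1) ->
    (\int[m1]_x (f x)%:E = \int[m2]_x (f x)%:E)%E) ->
  forall A, measurable A -> m1 A = m2 A.
Proof.
move=> m1oo m12.
pose G : set (set 'rV[R]_n) := [set [set x | 0 < f x] | f in [set f : 'rV[R]_n -> R | continuous f]].
have mG : @measurable _ 'rV[R]_n = <<s G >>.
  apply/seteqP; split; apply: smallest_sub.
  - exact: smallest_sigma_algebra.
  - move=> U oU; rewrite (open_rV_ratball oU) bigcup_mkcond.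
    apply: (@countable_bigcupT_measurable _ (g_sigma_algebraType G)) => [//|k].
    case: ifPn => // _; set q := map_mx _ _; set r := ratr _.
    have cr : continuous (fun x : 'rV[R]_n => r - `|q - x|).
      move=> x; apply: (@cvgB _ _ _ (nbhs x) _ (cst r) (fun x => `|q - x|)); first exact: cvg_cst.
      apply: cvg_norm; apply: (@cvgB _ _ _ (nbhs x) _ (cst q) id); first exact: cvg_cst.
      exact: cvg_id.
    apply: sub_sigma_algebra; exists (fun x => r - `|q - x|) => //.
    by apply/seteqP; split=> x /=; rewrite subr_gt0 -ball_normE.
  - exact: sigma_algebra_measurable.
  - move=> _ [f /= cf <-].
    have of0 : open (f @^-1` [set y | 0 < y]).
      by apply: open_comp => [x _|]; [exact: cf|exact: open_gt].
    exact: (open_measurable_rV of0).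
move=> A mA; apply: (measure_unique G (fun=> setT)) => //.
- move=> _ _ [f cf <-] [g cg <-]; exists (fun x => Num.min (f x) (g x)) => /=.
    by move=> x; apply: (@continuous_min _ _ f g); [exact: cf|exact: cg].
  by apply/seteqP; split=> x /=; rewrite lt_min => /andP.
- move=> k; have c1 : continuous (cst 1 : 'rV[R]_n -> R) by move=> x; exact: cst_continuous.
  by exists (cst 1) => //; apply/seteqP; split=> x //= _; exact: ltr01.
- by rewrite bigcup_const//; exists 0%N.
- move=> B [f cf <-].
  have mr k : measurable_fun setT (ramp f k).
    by apply: continuous_rV_measurable; exact: ramp_continuous.
  have E : (fun k => \int[m1]_x (ramp f k x)%:E)%E = (fun k => \int[m2]_x (ramp f k x)%:E)%E.
    apply/funext => k; apply: m12 => [|x]; last by rewrite ramp_ge0 ramp_le1.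
    exact: ramp_continuous.
  have h1 := @ramp_cvg _ _ m1 f mr; have h2 := @ramp_cvg _ _ m2 f mr.
  rewrite -E in h2; rewrite -(cvg_lim _ h1)// -(cvg_lim _ h2)//.
Qed.

End countable_base.

Section source_measure.
Context {R : realType} (n : nat).
Local Notation source := ('rV[R]_n * measurableTypeR R)%type.

Definition rV_uncons (w : 'rV[R]_n.+1) : source :=
  (\row_j w ord0 (lift ord0 j), w ord0 ord0).

Lemma rV_consK : cancel (@rV_cons R n) rV_uncons.
Proof.
move=> [x t]; rewrite /rV_uncons rV_cons0; congr pair.
by apply/rowP => j; rewrite mxE rV_consS.
Qed.

Lemma continuous_rV_cons : continuous (@rV_cons R n : 'rV[R]_n * R -> 'rV[R]_n.+1).
Proof.
move=> z; apply/cvg_ballP => e e0.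
have := rV_cons_ball (rV_cons z) e.
have [-> ->] : \row_i rV_cons z ord0 (lift ord0 i) = z.1 /\ rV_cons z ord0 ord0 = z.2.
  by split; [apply/rowP => j; rewrite mxE rV_consS|rewrite rV_cons0].
move=> E; suff : nbhs (z : 'rV[R]_n * R) ((@rV_cons R n) @^-1` ball (rV_cons z) e) by [].
rewrite E; by exists (ball z.1 e, ball (z.2 : R) e) => //=; split; exact: nbhsx_ballx.
Qed.

Lemma measurable_rV_uncons : measurable_fun setT rV_uncons.
Proof.
apply: measurable_fun_pair.
  apply: (@measurability _ _ 'rV[R]_n.+1 'rV[R]_n setT _ open erefl) => _ [U oU <-].
  rewrite setTI.
  have co : continuous (fun w : 'rV[R]_n.+1 => \row_j w ord0 (lift ord0 j) : 'rV[R]_n).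
    move=> w; apply: (@cvg_ballP R 'rV[R]_n _ (nbhs w) (nbhs_filter w) _ _).2 => e e0; have := nbhsx_ballx w e e0.
    apply: (@filterS _ (nbhs w) (nbhs_filter w)) => v [_ wv].
    by split => // i j; rewrite !mxE; exact: wv.
  have oU' : open ((fun w : 'rV[R]_n.+1 => \row_j w ord0 (lift ord0 j) : 'rV[R]_n) @^-1` U).
    by apply: open_comp => // x _; exact: co.
  exact: (open_measurable_rV oU').
by apply: continuous_rV_measurable => w; exact: coord_continuous.
Qed.

(** [rV_cons] is a homeomorphism of [R^n * R] onto [R^(n+1)], where
    [rV_measure_eq] applies. *)
Lemma source_measure_eq (m1 m2 : {measure set source -> \bar R}) :
  (m1 setT < +oo)%E ->
  (forall f : 'rV[R]_n * R -> R, continuous f -> (forall x, 0 <= f x <= 1) ->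
    (\int[m1]_x (f x)%:E = \int[m2]_x (f x)%:E)%E) ->
  forall A, measurable A -> m1 A = m2 A.
Proof.
move=> m1oo m12 A mA.
have AE : A = @rV_cons R n @^-1` (rV_uncons @^-1` A).
  by apply/seteqP; split=> x /=; rewrite rV_consK.
have mA' : measurable (rV_uncons @^-1` A).
  by rewrite -[X in measurable X]setTI; exact: measurable_rV_uncons.
pose p1 := pushforward_measure m1 (@measurable_rV_cons R n).
pose p2 := pushforward_measure m2 (@measurable_rV_cons R n).
suff : p1 (rV_uncons @^-1` A) = p2 (rV_uncons @^-1` A) by rewrite /p1 /p2 /= /pushforward -AE.
apply: rV_measure_eq mA'; first by rewrite /p1/= /pushforward preimage_setT.
move=> f cf f01.
have mf : measurable_fun setT (EFin \o f).
  by apply/measurable_EFinP; exact: continuous_rV_measurable.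
have f0 : {in setT, forall y, (0 <= (EFin \o f) y)%E}.
  by move=> y _; rewrite /= lee_fin; have /andP[] := f01 y.
have P (m : {measure set source -> \bar R}) :
    (\int[pushforward_measure m (@measurable_rV_cons R n)]_x (f x)%:E =
     \int[m]_x (f (rV_cons x))%:E)%E.
  by rewrite (ge0_integral_pushforward (@measurable_rV_cons R n) m measurableT mf f0) preimage_setT.
rewrite /p1 /p2 !P; apply: (m12 (fun x => f (rV_cons x))) => // x.
apply: (@continuous_comp _ _ _ (@rV_cons R n : 'rV[R]_n * R -> 'rV[R]_n.+1) f).
  exact: continuous_rV_cons.
exact: cf.
Qed.

End source_measure.

(** * Uniformity over compact sets *)

Section compactness.
Context {R : realType}.

Lemma within_continuous_nearP (T : topologicalType) (A : set T) (f : T -> R) :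
  {within A, continuous f} <->
  forall x, A x -> forall e : R, 0 < e -> \forall w \near x, A w -> `|f x - f w| < e.
Proof.
rewrite (@subspace_continuousP T A R f); split=> H x Ax.
  move=> e e0; have := H x Ax.
  by move=> /cvgrPdist_lt/(_ e e0).
by apply/cvgrPdist_lt => e e0; exact: H.
Qed.

(** The neighbourhoods on which continuity at the points [(a, k)] controls [f]
    contain, by compactness of [K], a common tube around [a]. *)
Lemma compact_equicontinuity (T U : topologicalType) (A : set T) (K : set U)
    (f : T -> U -> R) : compact K ->
  {within A `*` K, continuous (fun w : T * U => f w.1 w.2)} ->
  forall (a : T) (e : R), A a -> 0 < e ->
  \forall a' \near a, A a' -> forall k, K k -> `|f a k - f a' k| <= e.
Proof.
move=> /compact_near_coveringP/near_covering_withinP cK /within_continuous_nearP cf a e Aa e0.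
have H k : K k -> \forall k' \near k & a' \near a, K k' ->
    (A a' -> `|f a k' - f a' k'| <= e).
  move=> Kk; have e20 : 0 < e / 2 by rewrite divr_gt0.
  have [[V W] /= [Va Wk] VW] := cf (a, k) (conj Aa Kk) _ e20.
  exists (W, V) => // -[k' a'] /= [Wk' Va'] Kk' Aa'.
  have := VW (a, k') (conj (nbhs_singleton Va) Wk') (conj Aa Kk').
  have := VW (a', k') (conj Va' Wk') (conj Aa' Kk').
  move=> /= h1 h2; rewrite (le_trans (ler_distD (f a k) _ _))// distrC (splitr e).
  by rewrite lerD// ltW.
have Hn := cK T (nbhs a) (fun a' k => A a' -> `|f a k - f a' k| <= e) (nbhs_filter a) H.
by move: Hn; apply: filterS => a' Ha Aa' k Kk; exact: Ha.
Qed.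

Lemma within_compact_bounded (T : topologicalType) (A : set T) (f : T -> R) :
  compact A -> {within A, continuous f} -> exists2 M, 0 < M & forall x, A x -> `|f x| <= M.
Proof.
move=> cA cf; have [[a Aa]|A0] := pselect (A !=set0); last first.
  by exists 1 => // x Ax; exfalso; apply: A0; exists x.
have [||x Ax xmax] := @compact_EVT_max _ R (fun x => `|f x|) A _ cA.
- by exists a.
- move: cf => /within_continuous_nearP cf; apply/within_continuous_nearP => x Ax e e0.
  have := cf x Ax e e0; apply: filterS => w + Aw => /(_ Aw).
  by apply: le_lt_trans; exact: ler_dist_dist.
exists (`|f x| + 1) => [|y Ay]; first by rewrite ltr_wpDl.
by rewrite (le_trans (xmax y _)) ?lerDl//; exact/mem_set.
Qed.

End compactness.

(** * The cost function *)

Record transport_setting {R : realType} {d : nat} (B : set 'rV[R]_d.-1)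
    (Y : set 'rV[R]_d) (c : 'rV[R]_d.-1 * R -> 'rV[R]_d -> R) : Prop := {
  base_compact : compact B ;
  base_interior : B° !=set0 ;
  target_neq0 : Y !=set0 ;
  target_compact : compact Y ;
  cost_ge0 : forall x y, half_cylinder B x -> Y y -> 0 <= c x y ;
  cost_lip : locally_lipschitz_cost B Y c ;
  cost_incr : strictly_increasing_cost B Y c ;
  cost_unbounded : unbounded_cost B Y c }.

Section cost.
Context {R : realType} {d : nat}.
Variables (B : set 'rV[R]_d.-1) (Y : set 'rV[R]_d) (c : 'rV[R]_d.-1 * R -> 'rV[R]_d -> R).
Hypothesis setting : transport_setting B Y c.
Let B_compact : compact B := base_compact setting.
Let Y_compact : compact Y := target_compact setting.
Let c_lip := cost_lip setting.
Let c_incr := cost_incr setting.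
Let c_unbounded := cost_unbounded setting.

Let X : set ('rV[R]_d.-1 * R) := half_cylinder B.

Lemma cost_continuous : {within X `*` Y, continuous (fun w => c w.1 w.2)}.
Proof.
apply/within_continuous_nearP => z Xz e e0.
have [U Uz lipU] := c_lip Xz.
have [M M0 cM] : exists2 M : R, 0 < M & forall w, U w -> (X `*` Y) w ->
    `|c z.1 z.2 - c w.1 w.2| <= M * `|z - w|.
  near +oo_R => M; exists M => // w Uw Xw.
  have : M.-lipschitz_(U `&` (X `*` Y)) (fun w => c w.1 w.2 : R) by near: M.
  by move=> /(_ (z, w)); apply; split=> //=; split=> //; exact: nbhs_singleton.
have eM : 0 < e / M by rewrite divr_gt0.
have := nbhsx_ballx z _ eM; rewrite -ball_normE => zM.
near=> w => Xw; apply: le_lt_trans (cM w _ Xw) _; first by near: w.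
rewrite mulrC -ltr_pdivlMr//; near: w; exact: zM.
Unshelve. all: by end_near. Qed.

Lemma cost_equicontinuous_source x e : X x -> 0 < e ->
  \forall x' \near x, X x' -> forall y, Y y -> `|c x y - c x' y| <= e.
Proof. by move=> Xx; apply: compact_equicontinuity => //; exact: cost_continuous. Qed.

Lemma cost_swap_continuous : {within Y `*` X, continuous (fun w => c w.2 w.1)}.
Proof.
apply/within_continuous_nearP => -[y x] [Yy Xx] e e0.
have /within_continuous_nearP/(_ (x, y) (conj Xx Yy) e e0) := cost_continuous.
move=> [[V W] /= [Vx Wy] VW]; exists (W, V) => // -[y' x'] /= [Wy' Vx'] [Yy' Xx'].
exact: (VW (x', y') (conj Vx' Wy')).
Qed.

Lemma cost_equicontinuous_target (K : set ('rV[R]_d.-1 * R)) y e : compact K -> K `<=` X ->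
  Y y -> 0 < e ->
  \forall y' \near y, Y y' -> forall x, K x -> `|c x y - c x y'| <= e.
Proof.
move=> cK KX Yy; apply: (@compact_equicontinuity R _ _ Y K (fun y x => c x y)) => //.
apply: continuous_subspaceW cost_swap_continuous => -[y' x] [/= Yy' /KX Xx]; split=> //.
Qed.

Lemma cost_le s p p' y : B s -> Y y -> 0 <= p -> p <= p' -> c (s, p) y <= c (s, p') y.
Proof.
by move=> Bs Yy p0; rewrite le_eqVlt => /predU1P[->//|pp']; exact/ltW/c_incr.
Qed.

Definition cylinder_to (M : R) : set ('rV[R]_d.-1 * R) := B `*` `[0, M]%classic.

Lemma compact_cylinder_to M : compact (cylinder_to M).
Proof. by apply: compact_setX => //; exact: segment_compact. Qed.

Lemma cylinder_to_sub M : cylinder_to M `<=` X.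
Proof. by move=> [s p] [/= Bs]; rewrite in_itv/= => /andP[]. Qed.

(** If [c (s, p) y > K], then [c (s', p) y' > K] for [(s', y')] near [(s, y)] by
    continuity, and the inequality persists for larger heights by monotonicity;
    compactness of [B `*` Y] makes the height uniform. *)
Lemma cost_uniformly_large (K : R) :
  exists2 M, 0 <= M & forall s p y, B s -> Y y -> M <= p -> K < c (s, p) y.
Proof.
have /compact_near_coveringP/near_covering_withinP cBY : compact (B `*` Y) by exact: compact_setX.
have H z : (B `*` Y) z -> \forall z' \near z & M \near +oo,
    (B `*` Y) z' -> 0 <= M /\ K < c (z'.1, M) z'.2.
  move=> [/= Bs Yy]; have [p p0 Kp] := c_unbounded Bs Yy K.
  have Xsp : X (z.1, p) by split.
  have e0 : 0 < c (z.1, p) z.2 - K by rewrite subr_gt0.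
  have /within_continuous_nearP/(_ ((z.1, p), z.2) (conj Xsp Yy) _ e0) := cost_continuous.
  move=> [[V W] /= [[[V1 V2] /= [V1s V2p] V12] Wy] VW].
  exists (V1 `*` W, [set M | p <= M]) => /=.
    by split; [exists (V1, W)|apply: nbhs_pinfty_ge; exact: num_real].
  move=> [[s' y'] M] /= [[V1s' Wy'] pM] [Bs' Yy']; split; first exact: le_trans pM.
  have /= := VW ((s', p), y') (conj (V12 (s', p) (conj V1s' (nbhs_singleton V2p))) Wy').
  move=> /(_ (conj (conj Bs' p0) Yy')) h.
  apply: (lt_le_trans _ (cost_le Bs' Yy' p0 pM)).
  by move: h; rewrite ltr_norml; lra.
have Hn := cBY R +oo (fun M z => 0 <= M /\ K < c (z.1, M) z.2) (@filter_filter _ _ proper_pinfty_nbhs) H.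
near +oo_R => M; exists M => [|s p y Bs Yy Mp].
  by near: M; apply: nbhs_pinfty_ge; exact: num_real.
have HM : B `*` Y `<=` (fun z => 0 <= M /\ K < c (z.1, M) z.2) by near: M.
have [M0 KM] := HM (s, y) (conj Bs Yy).
by apply: (lt_le_trans KM); exact: cost_le.
Unshelve. all: by end_near. Qed.

Lemma cost_bounded M : exists2 K, 0 < K &
  forall x y, cylinder_to M x -> Y y -> c x y <= K.
Proof.
have [|K K0 cK] := within_compact_bounded (compact_setX (@compact_cylinder_to M) Y_compact)
   (f := fun w => c w.1 w.2).
  apply: continuous_subspaceW cost_continuous => -[x y] [/= Xx Yy]; split=> //.
  exact: cylinder_to_sub Xx.
by exists K => // x y Mx Yy; rewrite (le_trans _ (cK (x, y) _))// ler_norm.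
Qed.

End cost.

(** * The transform of a potential and its sublevel sets *)

Section c_transform.
Context {R : realType} {d : nat}.
Variables (B : set 'rV[R]_d.-1) (Y : set 'rV[R]_d) (c : 'rV[R]_d.-1 * R -> 'rV[R]_d -> R).
Hypothesis setting : transport_setting B Y c.
Let Y_neq0 := target_neq0 setting.
Let Y_compact := target_compact setting.
Let c_incr := cost_incr setting.

Let X : set ('rV[R]_d.-1 * R) := half_cylinder B.

Lemma potential_bounded psi : C_Y Y psi -> exists2 M, 0 < M & forall y, Y y -> `|psi y| <= M.
Proof. by move=> Cpsi; apply: within_compact_bounded. Qed.

Lemma C_Y_cst a : C_Y Y (cst a).
Proof. by move=> x; apply: cst_continuous. Qed.

Lemma C_YD f g : C_Y Y f -> C_Y Y g -> C_Y Y (fun y => f y + g y).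
Proof. by move=> Cf Cg x; apply: cvgD; [exact: Cf|exact: Cg]. Qed.

Lemma C_YZ a f : C_Y Y f -> C_Y Y (fun y => a * f y).
Proof. by move=> Cf x; apply: cvgMr; exact: Cf. Qed.

Section fixed_potential.
Variable psi : 'rV[R]_d -> R.
Hypothesis Cpsi : C_Y Y psi.
Let phi := c_transform Y c psi.

Lemma c_transform_attained x : X x -> exists2 y, Y y & phi x = c x y - psi y /\
  forall y', Y y' -> phi x <= c x y' - psi y'.
Proof.
move=> Xx.
have cont : {within Y, continuous (fun y => c x y - psi y)}.
  move/within_continuous_nearP : Cpsi => Cpsi'.
  have /within_continuous_nearP cc := cost_continuous setting.
  apply/within_continuous_nearP => y Yy e e0.
  have e20 : 0 < e / 2 by rewrite divr_gt0.
  have [[V W] /= [Vx Wy] VW] := cc (x, y) (conj Xx Yy) _ e20.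
  have := Cpsi' y Yy _ e20; apply: filterS2 Wy => y' Wy' h Yy'.
  have := VW (x, y') (conj (nbhs_singleton Vx) Wy') (conj Xx Yy').
  move=> /= h2; have h3 := h Yy'.
  have -> : c x y - psi y - (c x y' - psi y') = (c x y - c x y') - (psi y - psi y') by ring.
  by apply: (le_lt_trans (ler_normB _ _)); rewrite [ltRHS]splitr ltrD.
have [y /set_mem Yy ymin] := compact_EVT_min Y_neq0 Y_compact cont.
have lb : lbound [set c x y - psi y | y in Y] (c x y - psi y).
  by move=> _ [y' Yy' <-]; exact/ymin/mem_set.
exists y => //; suff E : phi x = c x y - psi y by split=> // y' Yy'; rewrite E; exact/ymin/mem_set.
apply/eqP; rewrite eq_le; apply/andP; split.
  by apply: ge_inf; [exists (c x y - psi y)|exists y].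
by apply: lb_le_inf => //; exists (c x y - psi y), y.
Qed.

Lemma c_transform_le x y : X x -> Y y -> phi x <= c x y - psi y.
Proof. by move=> /c_transform_attained[y' _ [_ +]]; exact. Qed.

Lemma c_transform_ge x r : X x -> (forall y, Y y -> r <= c x y - psi y) -> r <= phi x.
Proof. by move=> /c_transform_attained[y Yy [-> _]]; exact. Qed.

Lemma c_transform_continuous : {within X, continuous phi}.
Proof.
apply/within_continuous_nearP => x Xx e e0.
have e20 : 0 < e / 2 by rewrite divr_gt0.
have := cost_equicontinuous_source setting Xx e20.
apply: filterS => x' H Xx'; apply: (@le_lt_trans _ _ (e / 2)); last first.
  by rewrite ltr_pdivrMr// mulr_natr mulr2n ltrDl.
have [y Yy [Ey _]] := c_transform_attained Xx.
have [y' Yy' [Ey' _]] := c_transform_attained Xx'.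
have := c_transform_le Xx' Yy; have := c_transform_le Xx Yy'.
have := H Xx' _ Yy; have := H Xx' _ Yy'.
by rewrite !ler_norml Ey Ey' => /andP[] ? ? /andP[] ? ? ? ?; lra.
Qed.

Lemma c_transform_lt s p1 p2 : B s -> 0 <= p1 -> p1 < p2 -> phi (s, p1) < phi (s, p2).
Proof.
move=> Bs p10 p12.
have X1 : X (s, p1) by split.
have X2 : X (s, p2) by split=> //=; rewrite (le_trans p10)// ltW.
have [y Yy [-> _]] := c_transform_attained X2.
apply: (le_lt_trans (c_transform_le X1 Yy)).
by rewrite ltrD2r; exact: c_incr.
Qed.

End fixed_potential.

Lemma c_transformD psi a x : C_Y Y psi -> X x ->
  c_transform Y c (fun y => psi y + a) x = c_transform Y c psi x - a.
Proof.
move=> Cpsi Xx; have Cpsi' := C_YD Cpsi (@C_Y_cst a).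
have [y Yy [Ey _]] := c_transform_attained Cpsi Xx.
have [y' Yy' [Ey' _]] := c_transform_attained Cpsi' Xx.
apply/eqP; rewrite eq_le; apply/andP; split.
  by rewrite Ey (le_trans (c_transform_le Cpsi' Xx Yy))//=; lra.
by rewrite Ey' /=; have := c_transform_le Cpsi Xx Yy'; lra.
Qed.

Lemma cost_section_continuous s y : B s -> Y y ->
  {within [set p : R | 0 <= p], continuous (fun p => c (s, p) y)}.
Proof.
move=> Bs Yy; apply/within_continuous_nearP => p p0 e e0.
have Xsp : X (s, p) by split.
have /within_continuous_nearP/(_ ((s, p), y) (conj Xsp Yy) _ e0) := cost_continuous setting.
move=> [[V W] /= [[[V1 V2] /= [V1s V2p] V12] Wy] VW].
apply: filterS V2p => p' V2p' p'0.
apply: (VW ((s, p'), y)); last by [].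
by split => /=; [apply: V12; split => //; exact: nbhs_singleton|exact: nbhs_singleton].
Qed.

Lemma cost_inverse_ge0 s y sigma : 0 <= cost_inverse c s y sigma.
Proof.
rewrite /cost_inverse; case: ifP => // _.
by case: xgetP => [p -> []//|].
Qed.

(** Positivity of [t] makes the equivalence hold also for arguments below the range
    of the cost, where the inverse is 0 by convention. *)
Lemma le_cost_inverse s y sigma t : B s -> Y y -> 0 < t ->
  (t <= cost_inverse c s y sigma) = (c (s, t) y <= sigma).
Proof.
move=> Bs Yy t0; rewrite /cost_inverse; case: ifPn => [c0|]; last first.
  rewrite -ltNge => c0; rewrite leNgt t0/=; apply/esym/negbTE; rewrite -ltNge.
  by apply: (lt_trans c0); exact: c_incr.
have [p [p0 cp]] : exists p, 0 <= p /\ c (s, p) y = sigma.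
  have [M M0 cM] := cost_uniformly_large setting sigma.
  have cMs := cM s M y Bs Yy (lexx _).
  have [||p pM cp] := @IVT R (fun p => c (s, p) y) 0 M sigma M0.
  - apply: continuous_subspaceW (cost_section_continuous Bs Yy) => p /=.
    by rewrite in_itv/= => /andP[].
  - by rewrite ge_min c0/= le_max (ltW cMs) orbT.
  - by exists p; split=> //; move: pM; rewrite in_itv/= => /andP[].
case: xgetP => [q _ [q0 <-]|/(_ p)]; last by move=> /(_ (conj p0 cp)).
have [tq|qt] := leP t q; first by rewrite (cost_le setting)// ltW.
by apply/esym/negbTE; rewrite -ltNge; exact: c_incr.
Qed.

Section level.
Variables (psi : 'rV[R]_d -> R) (tau : R).
Hypothesis Cpsi : C_Y Y psi.
Let phi := c_transform Y c psi.
Let dens := density_at_level Y c psi tau.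

Let inv_bounded : exists2 M, 0 <= M &
  forall s y, B s -> Y y -> cost_inverse c s y (psi y + tau) <= M.
Proof.
have [K K0 psiK] := potential_bounded Cpsi.
have [M M0 cM] := cost_uniformly_large setting (K + tau).
exists (M + 1) => [|s y Bs Yy]; first by rewrite addr_ge0.
rewrite leNgt; apply/negP => /ltW; rewrite le_cost_inverse ?ltr_wpDl//.
have /cM : M <= M + 1 by rewrite lerDl.
move=> /(_ s y Bs Yy); have := psiK _ Yy; rewrite ler_norml => /andP[_ ?] ? ?; lra.
Qed.

Let has_sup_inv s : B s -> has_sup [set cost_inverse c s y (psi y + tau) | y in Y].
Proof.
move=> Bs; have [M M0 invM] := inv_bounded; split.
  by have [y Yy] := Y_neq0; exists (cost_inverse c s y (psi y + tau)), y.
by exists M => _ [y Yy <-]; exact: invM.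
Qed.

Lemma density_ge0 s : B s -> 0 <= dens s.
Proof.
move=> Bs; have [y Yy] := Y_neq0.
apply: (@le_trans _ _ (cost_inverse c s y (psi y + tau))); first exact: cost_inverse_ge0.
by apply: ub_le_sup; [have [] := has_sup_inv Bs|exists y].
Qed.

(** Both sides say that [c (s, t) y <= psi y + tau] for some [y] in [Y]. The
    transform attains its infimum; on the side of the supremum, attainment is
    replaced by the continuity of the transform at a slightly smaller height. *)
Lemma le_density s t : B s -> 0 < t -> (t <= dens s) = (phi (s, t) <= tau).
Proof.
move=> Bs t0; have Xst : X (s, t) by split=> //=; exact: ltW.
apply/idP/idP => [tdens|].
  rewrite leNgt; apply/negP => tau_phi.
  have e0 : 0 < phi (s, t) - tau by rewrite subr_gt0.
  have /within_continuous_nearP/(_ (s, t) Xst _ e0) := c_transform_continuous Cpsi.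
  move=> [[V1 V2] /= [V1s /nbhs_ballP[e /= ep V2t]] V12].
  (* still positive, and within [e] of [t], so the transform exceeds [tau] at [t'] *)
  pose t' := t - Num.min (e / 2) (t / 2).
  have t'0 : 0 < t' by rewrite subr_gt0 gt_min; apply/orP; right; lra.
  have t't : t' < t by rewrite ltrBlDr ltrDl lt_min !divr_gt0.
  have V2t' : V2 t'.
    apply: V2t; rewrite /ball/= ger0_norm; last by rewrite subr_ge0 ltW.
    have -> : t - t' = Num.min (e / 2) (t / 2) by rewrite /t'; ring.
    by rewrite gt_min; apply/orP; left; rewrite ltr_pdivrMr// mulr_natr mulr2n ltrDl.
  have Xst' : X (s, t') by split=> //=; exact: ltW.
  have := V12 (s, t') (conj (nbhs_singleton V1s) V2t') Xst'.
  rewrite ltr_norml -/phi => /andP[_ phit'].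
  have : dens s <= t'.
    apply: ge_sup; first by have [] := has_sup_inv Bs.
    move=> _ [y Yy <-]; rewrite leNgt; apply/negP => /ltW; rewrite le_cost_inverse// => ct'.
    by have := c_transform_le Cpsi Xst' Yy; rewrite -/phi; lra.
  by lra.
have [y Yy [Ey _]] := c_transform_attained Cpsi Xst; rewrite /phi Ey => cy.
apply: (@le_trans _ _ (cost_inverse c s y (psi y + tau))).
  by rewrite le_cost_inverse//; lra.
by apply: ub_le_sup; [have [] := has_sup_inv Bs|exists y].
Qed.

End level.
End c_transform.

(** * Volume in the half cylinder *)

(** The second summand may have an infinite integral: a transform need not be
    integrable for every competitor, only its negative part is. *)
Lemma integralD_ge0 {d} {T : measurableType d} {R : realType}
    (mu : {measure set T -> \bar R}) (D : set T) (f' g' : T -> R) :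
  measurable D -> mu.-integrable D (EFin \o f') -> measurable_fun D g' ->
  (forall x, D x -> 0 <= g' x) ->
  (\int[mu]_(x in D) (f' x + g' x)%:E =
   \int[mu]_(x in D) (f' x)%:E + \int[mu]_(x in D) (g' x)%:E)%E.
Proof.
move=> mD fi /measurable_EFinP mg g'0.
pose f x := (f' x)%:E; pose g x := (g' x)%:E.
suff : (\int[mu]_(x in D) (f x + g x) = \int[mu]_(x in D) f x + \int[mu]_(x in D) g x)%E by [].
have g0 x : D x -> (0 <= g x)%E by move=> Dx; rewrite lee_fin g'0. have mf := measurable_int mu fi.
have [goo|goo] := ltP (\int[mu]_(x in D) g x)%E +oo%E.
  apply: integralD => //; apply/integrableP; split=> //.
  by rewrite (eq_integral g)// => x /[!inE] Dx; rewrite gee0_abs// g0.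
have gE : (\int[mu]_(x in D) g x = +oo)%E by apply/eqP; rewrite -leye_eq.
have mfg : measurable_fun D (fun x => f x + g x)%E by exact: emeasurable_funD.
have f_neg := integral_funeneg_lt_pinfty mD fi.
have f_fin : (\int[mu]_(x in D) f x)%E \is a fin_num by exact: integrable_fin_num.
rewrite gE addey; last by move: f_fin; rewrite fin_numE => /andP[].
have fg_neg : (\int[mu]_(x in D) (fun x => f x + g x)^\- x < +oo)%E.
  apply: le_lt_trans f_neg; apply: ge0_le_integral => //.
  - exact: measurable_funeneg.
  - exact: measurable_funeneg.
  - move=> x Dx; rewrite !funenegE ge_max !le_max lexx orbT andbT leeN2.
    by rewrite leeDl// g0.
have fg_pos : (\int[mu]_(x in D) (fun x => f x + g x)^\+ x = +oo)%E.
  apply/eqP; rewrite -leye_eq leNgt; apply/negP => fg_pos.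
  suff : (\int[mu]_(x in D) g x < +oo)%E by rewrite gE.
  have I1 := @ge0_integralD _ _ _ mu D mD ((fun x => f x + g x)^\+)%E (f^\-)%E
    (fun x _ => funepos_ge0 _ _) (measurable_funepos mfg)
    (fun x _ => funeneg_ge0 _ _) (measurable_funeneg mf).
  apply: le_lt_trans (lte_add_pinfty fg_pos f_neg); rewrite -I1.
  apply: ge0_le_integral => //.
  - by apply: emeasurable_funD; [exact: measurable_funepos|exact: measurable_funeneg].
  - move=> x Dx; have := g0 x Dx; rewrite funeposE funenegE.
    rewrite /f /g -EFinD -EFinN -!EFin_max -EFinD !lee_fin => s0.
    by case: (leP (f' x + g' x) 0) => ?; case: (leP (- f' x) 0) => ?; lra.
apply: etrans (integralE mu D _) _; rewrite fg_pos addye//.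
by rewrite eqe_oppLR/= lt_eqF.
Qed.

Section base_measure.
Context {R : realType} {n : nat}.

Lemma compact_rV_measurable (B : set 'rV[R]_n) : compact B -> measurable B.
Proof.
move=> cB; rewrite -[B]setCK; apply: measurableC; apply: open_measurable_rV.
by apply: closed_openC; apply: compact_closed => //; exact: norm_hausdorff.
Qed.

Lemma measurable_rV_closed_box (a b : 'rV[R]_n) :
  measurable [set x : 'rV[R]_n | forall i, x ord0 i \in `[a ord0 i, b ord0 i]].
Proof.
rewrite -[X in measurable X]setCK; apply: measurableC.
apply: open_measurable_rV; apply: closed_openC.
rewrite (_ : mkset _ = \bigcap_i
    ((fun x : 'rV[R]_n => x ord0 i) @^-1` `[a ord0 i, b ord0 i])); last first.
  by apply/seteqP; split=> x /= xuv i; [move=> _|]; exact: xuv.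
apply: closed_bigI => i _; apply: preimage_closed; last exact: itv_closed.
by move=> x _; exact: coord_continuous.
Qed.

Lemma compact_lebesgue_lty (B : set 'rV[R]_n) : compact B -> (lebesgue_rV n B < +oo)%E.
Proof.
move=> cB; have [M [_ BM]] := compact_bounded cB.
pose r := `|M| + 2.
have r0 : 0 <= r by rewrite addr_ge0.
have {}BM x : B x -> ball (0 : 'rV[R]_n) r x.
  move=> Bx; rewrite -ball_normE /ball_/= sub0r normrN.
  apply: (@le_lt_trans _ _ (`|M| + 1)); last by rewrite /r ltrD2l ltr1n.
  by apply: BM => //; rewrite (le_lt_trans (ler_norm _))// ltrDl.
pose a : 'rV[R]_n := const_mx (- r); pose b : 'rV[R]_n := const_mx r.
have ab i : a ord0 i <= b ord0 i by rewrite !mxE ge0_cp.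
have := lebesgue_rV_box ab; set A := mkset _ => AE.
apply: (@le_lt_trans _ _ (lebesgue_rV n A)); last by rewrite AE ltry.
apply: le_measure; rewrite ?inE; [exact: compact_rV_measurable|exact: measurable_rV_closed_box|].
move=> x /BM [_ xr] i; have := xr ord0 i; rewrite !mxE /ball/= sub0r normrN in_itv/= ltr_norml.
by move=> /andP[h1 h2]; rewrite !ltW.
Qed.

Lemma interior_lebesgue_gt0 (B : set 'rV[R]_n) : measurable B -> B° !=set0 -> (0 < lebesgue_rV n B)%E.
Proof.
move=> mB [x /nbhs_ballP[e /= e0 eB]].
pose r := e / 2.
have r0 : 0 < r by rewrite divr_gt0.
pose a : 'rV[R]_n := \row_i (x ord0 i - r); pose b : 'rV[R]_n := \row_i (x ord0 i + r).
have ab i : a ord0 i <= b ord0 i by rewrite !mxE lerD2l ge0_cp// ltW.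
have := lebesgue_rV_box ab; set A := mkset _ => AE.
apply: (@lt_le_trans _ _ (lebesgue_rV n A)).
  rewrite AE lte_fin prodr_gt0// => i _; rewrite !mxE.
  have -> : x ord0 i + r - (x ord0 i - r) = r + r by ring.
  exact: addr_gt0.
apply: le_measure; rewrite ?inE; [exact: measurable_rV_closed_box|exact: mB|].
move=> y Ay; apply: eB; split=> // i j; rewrite (ord1 i); have := Ay j.
rewrite !mxE in_itv/= /ball/= => /andP[h1 h2]; rewrite ltr_distl.
have re : r < e by rewrite /r ltr_pdivrMr// mulr_natr mulr2n ltrDl.
by apply/andP; split; lra.
Qed.

End base_measure.

Section mass.
Context {R : realType} {d : nat}.
Variables (B : set 'rV[R]_d.-1) (Y : set 'rV[R]_d) (c : 'rV[R]_d.-1 * R -> 'rV[R]_d -> R).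
Hypothesis setting : transport_setting B Y c.
Local Notation source := ('rV[R]_d.-1 * measurableTypeR R)%type.
Let X : set source := half_cylinder B.
Let L : {measure set source -> \bar R} := @lebesgue_source R d.

Lemma measurable_base : measurable B.
Proof. exact: compact_rV_measurable (base_compact setting). Qed.

Lemma measurable_half_cylinder : measurable (half_cylinder B : set source).
Proof.
apply: measurableX; first exact: measurable_base.
rewrite (_ : [set p | 0 <= p] = `[0, +oo[%classic); first exact: measurable_itv.
by apply/seteqP; split=> p /=; rewrite in_itv/= andbT.
Qed.

Lemma measurable_cylinder_to M : measurable (cylinder_to B M : set source).
Proof. by apply: measurableX; [exact: measurable_base|exact: measurable_itv]. Qed.

Lemma cylinder_to_mass M : 0 <= M ->
  L (cylinder_to B M) = (lebesgue_rV d.-1 B * M%:E)%E.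
Proof.
move=> M0; rewrite /L/= product_measure1E; [|exact: measurable_base|exact: measurable_itv].
congr (_ * _)%E; apply: etrans (lebesgue_measure_itv `[0, M]) _.
by rewrite /= lte_fin; case: ltgtP M0 => // [_ _|<- _]; rewrite ?sube0.
Qed.

Lemma cylinder_to_mass_lty M : (L (cylinder_to B M) < +oo)%E.
Proof.
have [M0|M0] := leP 0 M.
  rewrite cylinder_to_mass// lte_mul_pinfty//.
  - have := compact_lebesgue_lty (base_compact setting).
    by rewrite ge0_fin_numE.
  - exact: ltry.
rewrite (_ : cylinder_to B M = set0) ?measure0//.
by apply/seteqP; split=> // -[s p] [/= _]; rewrite in_itv/= => /andP[p0 pM]; lra.
Qed.

(** Vertical sections are contained in a single point. *)
Lemma zero_height_null (A : set source) : measurable A -> (forall x, A x -> x.2 = 0) -> L A = 0%E.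
Proof.
move=> mA A0; rewrite /L/= /lebesgue_source/= /product_measure1.
apply: integral0_eq => s _ /=.
apply/eqP; rewrite eq_le measure_ge0 andbT.
rewrite -(@lebesgue_measure_set1 R 0); apply: le_measure; rewrite ?inE.
- exact: measurable_xsection.
- exact: measurable_set1.
- by move=> t /xsectionP /A0 /= ->.
Qed.

Section level_sets.
Variables (psi : 'rV[R]_d -> R).
Hypothesis Cpsi : C_Y Y psi.
Let phi : source -> R := c_transform Y c psi.

Lemma c_transform_measurable : measurable_fun X phi.
Proof.
apply: (@within_continuous_measurable R ('rV[R]_d.-1 * R)%type _ source id X phi).
  exact: open_measurable_source.
exact: (c_transform_continuous setting Cpsi).
Qed.

Definition sublevel tau : set source := [set x | X x /\ phi x <= tau].

Lemma measurable_sublevel tau : measurable (sublevel tau).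
Proof.
have := measurable_fun_le measurable_half_cylinder c_transform_measurable (measurable_cst tau).
by congr measurable; apply/seteqP; split.
Qed.

Lemma sublevel_sub_cylinder tau : exists2 M, 0 <= M & sublevel tau `<=` cylinder_to B M.
Proof.
have [K K0 psiK] := potential_bounded setting Cpsi.
have [M M0 cM] := cost_uniformly_large setting (tau + K).
exists M => // -[s p] [[/= Bs p0] phip]; split=> //=; rewrite in_itv/= p0/= leNgt.
apply/negP => /ltW Mp.
have [y Yy [Ey _]] := c_transform_attained setting Cpsi (conj Bs p0 : half_cylinder B (s, p)).
have := cM s p y Bs Yy Mp; have := psiK _ Yy; rewrite ler_norml => /andP[_].
by move: phip; rewrite /phi Ey; lra.
Qed.

Lemma sublevel_mass_lty tau : (L (sublevel tau) < +oo)%E.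
Proof.
have [M M0 DM] := sublevel_sub_cylinder tau.
apply: le_lt_trans (cylinder_to_mass_lty M).
by apply: le_measure => //; rewrite inE; [exact: measurable_sublevel|exact: measurable_cylinder_to].
Qed.

Lemma measurable_level tau : measurable [set x : source | X x /\ phi x = tau].
Proof.
have h1 := measurable_fun_le measurable_half_cylinder c_transform_measurable (measurable_cst tau).
have h2 := measurable_fun_le measurable_half_cylinder (measurable_cst tau) c_transform_measurable.
have := measurableI _ _ h1 h2; congr measurable; apply/seteqP; split=> x /=.
  by move=> [[Xx p1] [_ p2]]; split=> //; apply/eqP; rewrite eq_le p1.
by move=> [Xx ->]; rewrite lexx.
Qed.

(** The transform is strictly increasing along each vertical half-line, so a
    level set has at most one point above each [s]. *)
Lemma level_null tau : L [set x | X x /\ phi x = tau] = 0%E.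
Proof.
set A := mkset _; have mA : measurable A := measurable_level tau.
rewrite /L/= /lebesgue_source/= /product_measure1; apply: integral0_eq => s _ /=.
have [[t0 At0]|E] := pselect (exists t, A (s, t)); last first.
  rewrite (_ : xsection A s = set0) ?measure0//.
  by apply/seteqP; split=> // t /xsectionP At; apply: E; exists t.
apply/eqP; rewrite eq_le measure_ge0 andbT.
rewrite -(@lebesgue_measure_set1 R t0); apply: le_measure; rewrite ?inE.
- exact: measurable_xsection.
- exact: measurable_set1.
- move=> t /xsectionP [[/= Bs t_ge0] phit]; have [[/= _ t0_ge0] phit0] := At0.
  have [tt0|tt0|//] := ltgtP t t0.
    by have := c_transform_lt setting Cpsi Bs t_ge0 tt0; rewrite -/phi phit phit0 ltxx.
  by have := c_transform_lt setting Cpsi Bs t0_ge0 tt0; rewrite -/phi phit phit0 ltxx.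
Qed.

End level_sets.
End mass.

(** * Densities and their subgraphs *)

Section densities.
Context {R : realType} {d : nat}.
Variables (B : set 'rV[R]_d.-1) (Y : set 'rV[R]_d) (c : 'rV[R]_d.-1 * R -> 'rV[R]_d -> R).
Hypothesis setting : transport_setting B Y c.
Local Notation source := ('rV[R]_d.-1 * measurableTypeR R)%type.
Let X : set source := half_cylinder B.
Let L : {measure set source -> \bar R} := @lebesgue_source R d.
Let mB : measurable B := measurable_base setting.
Let mX : measurable X := measurable_half_cylinder setting.

Lemma measurable_under_graph (p : 'rV[R]_d.-1 -> R) : measurable_fun B p -> measurable (under_graph B p : set source).
Proof.
move=> mp.
have mpX : measurable_fun X (fun x : source => p x.1).
  apply: (@measurable_comp _ _ _ _ _ _ B p X fst) => //; first by move=> _ [x [Xx _] <-].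
  by apply: measurable_funTS; exact: measurable_fst.
have mX2 : measurable_fun X (fun x : source => x.2) by apply: measurable_funTS; exact: measurable_snd.
have := measurable_fun_le mX mX2 mpX.
by congr measurable; apply/seteqP; split.
Qed.

Definition under_graph_measure (p : 'rV[R]_d.-1 -> R) (mp : measurable_fun B p) : {measure set source -> \bar R} :=
  mrestr L (measurable_under_graph mp).

Lemma mu_ofE (p : 'rV[R]_d.-1 -> R) (mp : measurable_fun B p) : mu_of B p = under_graph_measure mp.
Proof. by []. Qed.

Lemma under_graph_mass (p : 'rV[R]_d.-1 -> R) : measurable_fun B p -> (forall s, B s -> 0 <= p s) ->
  L (under_graph B p) = (\int[lebesgue_rV d.-1]_(s in B) (p s)%:E)%E.
Proof.
move=> mp p0; rewrite [RHS]integral_mkcond /L/= /lebesgue_source/= /product_measure1.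
apply: eq_integral => s _ /=; rewrite patchE; case: ifPn => [/set_mem Bs|/negP nBs].
  rewrite (_ : xsection _ s = `[0, p s]%classic); last first.
    apply/seteqP; split=> t; first by move=> /xsectionP[[/= _ t0] tp]; rewrite in_itv/= t0.
    by rewrite /= in_itv/= => /andP[t0 tp]; apply/xsectionP.
  apply: etrans (lebesgue_measure_itv `[0, p s]) _.
  by rewrite /= lte_fin; case: ltgtP (p0 _ Bs) => // [_ _|<- _]; rewrite ?sube0.
rewrite (_ : xsection _ s = set0) ?measure0//.
by apply/seteqP; split=> // t /xsectionP[[/= Bs _] _]; apply: nBs; exact/mem_set.
Qed.

(** A subgraph contains the points at height 0 even where the density vanishes, so
    it is compared with a sublevel set only at non-zero heights. *)
Lemma mass_eq_above (A1 A2 : set source) : measurable A1 -> measurable A2 ->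
  (forall x, x.2 != 0 -> A1 x <-> A2 x) -> L A1 = L A2.
Proof.
wlog suff le12 : A1 A2 / measurable A1 -> measurable A2 ->
    (forall x, x.2 != 0 -> A1 x <-> A2 x) -> (L A1 <= L A2)%E.
  move=> m1 m2 A12; apply/eqP; rewrite eq_le !le12// => x x0.
  by split=> ?; apply/(A12 _ x0).
move=> m1 m2 A12; have E : A1 = (A1 `&` A2) `|` (A1 `\` A2).
  apply/seteqP; split=> x; last by move=> [[]|[]].
  by move=> A1x; have [?|?] := pselect (A2 x); [left|right].
have mI : measurable (A1 `&` A2) by exact: measurableI.
have mD : measurable (A1 `\` A2) by exact: measurableD.
have U2 : (L ((A1 `&` A2) `|` (A1 `\` A2)) <= L (A1 `&` A2) + L (A1 `\` A2))%E.
  exact: measureU2.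
have N0 : L (A1 `\` A2) = 0%E.
  apply: zero_height_null => // x [A1x nA]; apply/eqP/negP => /negP x0; apply: nA.
  by apply/(A12 _ x0).
move: U2; rewrite N0 adde0 -E => /le_trans; apply.
by apply: le_measure; rewrite ?inE.
Qed.

Lemma mu_of_ae_eq (p p' : 'rV[R]_d.-1 -> R) : measurable_fun B p -> measurable_fun B p' ->
  p = p' %[ae lebesgue_rV d.-1 in B] ->
  forall A : set source, measurable A -> mu_of B p A = mu_of B p' A.
Proof.
move=> mp mp' pp' A mA; rewrite /mu_of/= /lebesgue_source/= /product_measure1.
have mU q : measurable_fun B q -> measurable (A `&` under_graph B q).
  by move=> mq; apply: measurableI => //; exact: measurable_under_graph.
apply: ge0_ae_eq_integral => //.
- exact: measurable_fun_xsection (mU _ mp).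
- exact: measurable_fun_xsection (mU _ mp').
- move: pp'; apply: filterS => s pp' _ /=; congr (lebesgue_measure _).
  apply/seteqP; split=> t /xsectionP [At [[/= Bs t0] /= tp]]; apply/xsectionP; split=> //; split=> //=.
    by rewrite -pp'.
  by rewrite pp'.
Qed.

Section level_density.
Variables (psi : 'rV[R]_d -> R).
Hypothesis Cpsi : C_Y Y psi.
Let phi : source -> R := c_transform Y c psi.

(** By [le_density], the set where the density is at least [t > 0] is a sublevel
    set of the continuous function [phi (_, t)]. *)
Lemma density_measurable tau : measurable_fun B (density_at_level Y c psi tau).
Proof.
move=> _; apply: (measurability _ (RGenCInfty.measurableE R)) => // _ [_ [t ->] <-].
have [t0|t0] := leP t 0.
  rewrite (_ : _ `&` _ = B)//; apply/seteqP; split=> s; first by case.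
  move=> Bs; split=> //=; rewrite in_itv/= andbT (le_trans t0)//.
  exact: (density_ge0 setting).
have mphit : measurable_fun B (fun s => phi (s, t)).
  apply: (@within_continuous_measurable R 'rV[R]_d.-1 _ 'rV[R]_d.-1 id B (fun s => phi (s, t))).
    exact: open_measurable_rV.
  apply/within_continuous_nearP => s Bs e e0.
  have Xst : half_cylinder B (s, t) by split=> //=; exact: ltW.
  have /within_continuous_nearP/(_ (s, t) Xst e e0) := c_transform_continuous setting Cpsi.
  move=> [[V1 V2] /= [V1s V2t] V12].
  move: V1s; apply: filterS => s' V1s' Bs'.
  by apply: (V12 (s', t)); [split=> //; exact: nbhs_singleton|split=> //=; exact: ltW].
have := measurable_fun_le mB mphit (measurable_cst tau).
congr measurable; apply/seteqP; split=> s /= [Bs].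
  by rewrite -(le_density setting _ Cpsi)// in_itv/= andbT.
by rewrite in_itv/= andbT (le_density setting _ Cpsi).
Qed.

Lemma mu_of_density tau (A : set source) : measurable A ->
  mu_of B (density_at_level Y c psi tau) A = L (A `&` sublevel B Y c psi tau).
Proof.
move=> mA; rewrite /mu_of; apply: mass_eq_above.
- by apply: measurableI => //; apply: measurable_under_graph; exact: density_measurable.
- by apply: measurableI => //; exact: (measurable_sublevel setting).
move=> [s t] /= t_neq0; have H : half_cylinder B (s, t) ->
    (t <= density_at_level Y c psi tau s) = (phi (s, t) <= tau).
  by move=> [/= Bs tge0]; apply: (le_density setting _ Cpsi) => //; rewrite lt_neqAle eq_sym t_neq0.
by split=> -[At [Xst /= tp]]; split=> //; split=> //=; move: tp; rewrite H.
Qed.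

Lemma P_ac_densityP tau :
  P_ac B (density_at_level Y c psi tau) <-> L (sublevel B Y c psi tau) = 1%E.
Proof.
have mdens := density_measurable tau.
have dens0 s : B s -> 0 <= density_at_level Y c psi tau s by exact: (density_ge0 setting).
have E : (\int[lebesgue_rV d.-1]_(s in B) (density_at_level Y c psi tau s)%:E)%E =
    L (sublevel B Y c psi tau).
  by rewrite -under_graph_mass//; have := mu_of_density tau measurableT; rewrite /mu_of !setTI.
by split=> [[_ _ <-]//|L1]; split=> //; rewrite E.
Qed.

(** The infimum [t0] of the levels with volume at least 1. Sublevel sets above
    [t0] decrease to the one at [t0], which gives volume at least 1; those
    below [t0] increase to it up to the null level set [phi = t0], which gives
    volume at most 1. *)
Lemma exists_level : exists tau, L (sublevel B Y c psi tau) = 1%E.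
Proof.
pose D := sublevel B Y c psi.
have mD tau : measurable (D tau) by exact: (measurable_sublevel setting).
have Doo tau : (L (D tau) < +oo)%E by exact: (sublevel_mass_lty setting).
have Dle t1 t2 : t1 <= t2 -> D t1 `<=` D t2 by move=> t12 x [Xx xt1]; split=> //; exact: le_trans t12.
have LDle t1 t2 : t1 <= t2 -> (L (D t1) <= L (D t2))%E.
  by move=> t12; apply: le_measure; rewrite ?inE//; exact: Dle.
have [K K0 psiK] := potential_bounded setting Cpsi.
pose S := [set tau | (1 <= L (D tau))%E].
have S_lb : lbound S (- K).
  move=> tau; rewrite /S/= => L1; rewrite leNgt; apply/negP => tauK.
  suff D0 : D tau = set0 by move: L1; rewrite D0 measure0 lee_fin ler10.
  apply/seteqP; split=> // x [Xx phix].
  have [y Yy [Ey _]] := c_transform_attained setting Cpsi Xx.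
  have := psiK _ Yy; rewrite ler_norml => /andP[_]; have := cost_ge0 setting Xx Yy.
  by move: phix; rewrite Ey; lra.
have S0 : S !=set0.
  have B0 := interior_lebesgue_gt0 mB (base_interior setting).
  have Boo := compact_lebesgue_lty (base_compact setting).
  have BE : lebesgue_rV d.-1 B = (fine (lebesgue_rV d.-1 B))%:E by rewrite fineK// ge0_fin_numE.
  have b0 : 0 < fine (lebesgue_rV d.-1 B) by rewrite -lte_fin -BE.
  (* the cylinder of height [P] has volume 1, and lies in the sublevel set [C + K] *)
  pose P := (fine (lebesgue_rV d.-1 B))^-1.
  have P0 : 0 < P by rewrite invr_gt0.
  have [C C0 cC] := cost_bounded setting P.
  exists (C + K); rewrite /S/= (@le_trans _ _ (L (cylinder_to B P)))//.
    by rewrite (cylinder_to_mass setting (ltW P0)) BE -EFinM divff// gt_eqF.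
  apply: le_measure; rewrite ?inE//; first exact: (measurable_cylinder_to setting).
  move=> x Px; have Xx := cylinder_to_sub Px; split=> //.
  have [y Yy] := target_neq0 setting.
  apply: (le_trans (c_transform_le setting Cpsi Xx Yy)).
  by have := cC _ _ Px Yy; have := psiK _ Yy; rewrite ler_norml => /andP[]; lra.
have hi : has_inf S by split=> //; exists (- K).
pose t0 := inf S; exists t0; rewrite -/(D t0).
have eS n : t0 < t0 + n.+1%:R^-1 by rewrite ltrDl invr_gt0.
have upper n : (1 <= L (D (t0 + n.+1%:R^-1)%R))%E.
  have n0 : 0 < n.+1%:R^-1 :> R by rewrite invr_gt0.
  have [t St tt0] := inf_adherent n0 hi.
  by apply: (le_trans St); apply: LDle; exact: ltW.
have lower t : t < t0 -> (L (D t) <= 1)%E.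
  move=> tt0; apply: ltW; rewrite ltNge; apply/negP => St.
  have t0t : t0 <= t by apply: ge_inf; [exact: hi.2|exact: St].
  by move: tt0; rewrite ltNge t0t.
apply/eqP; rewrite eq_le; apply/andP; split; last first.
  have DE : D t0 = \bigcap_n D (t0 + n.+1%:R^-1)%R.
    apply/seteqP; split=> [x Dx n _|x Dx]; first exact: Dle (ltW (eS n)) _ Dx.
    have [Xx _] := Dx 0%N I; split=> //.
    apply/ler_addgt0Pr => e e0.
    near \oo => n; apply: (le_trans (Dx n I).2); rewrite lerD2l ltW//.
    by near: n; exact: (near_infty_natSinv_lt (PosNum e0)).
  have niD : nonincreasing_seq (fun n => D (t0 + n.+1%:R^-1)%R).
    move=> m n mn; apply/subsetPset/Dle; rewrite lerD2l lef_pV2 ?posrE//.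
    by rewrite ler_nat.
  have mDE : measurable (\bigcap_n D (t0 + n.+1%:R^-1)%R) by rewrite -DE.
  have := @nonincreasing_cvg_mu _ _ _ L (fun n => D (t0 + n.+1%:R^-1)%R) (Doo _) (fun n => mD _) mDE niD.
  rewrite -DE => LD; rewrite -(cvg_lim _ LD)//; apply: lime_ge; first by apply/cvg_ex; exists (L (D t0)).
  by apply: nearW => n; exact: upper.
have DE : D t0 `<=` (\bigcup_n D (t0 - n.+1%:R^-1)%R) `|` [set x | X x /\ phi x = t0].
  move=> x [Xx]; rewrite le_eqVlt => /predU1P[phix|phix]; [by right|left].
  have e0 : 0 < t0 - phi x by rewrite subr_gt0.
  near \oo => n; exists n => //; split=> //; rewrite lerBrDr -lerBrDl ltW//.
  by near: n; exact: (near_infty_natSinv_lt (PosNum e0)).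
have ndD : nondecreasing_seq (fun n => D (t0 - n.+1%:R^-1)%R).
  move=> m n mn; apply/subsetPset/Dle; rewrite lerD2l lerN2 lef_pV2 ?posrE//.
  by rewrite ler_nat.
have mU : measurable (\bigcup_n D (t0 - n.+1%:R^-1)%R) by exact: bigcup_measurable.
have mN : measurable [set x | X x /\ phi x = t0] := measurable_level setting Cpsi t0.
have LU : (L (\bigcup_n D (t0 - n.+1%:R^-1)%R) <= 1)%E.
  have LD := @nondecreasing_cvg_mu _ _ _ L (fun n => D (t0 - n.+1%:R^-1)%R) (fun n => mD _) mU ndD.
  rewrite -(cvg_lim _ LD)//; apply: lime_le.
    by apply/cvg_ex; exists (L (\bigcup_n D (t0 - n.+1%:R^-1)%R)).
  by apply: nearW => n; apply: lower; rewrite ltrBlDr.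
have U2 : (L ((\bigcup_n D (t0 - n.+1%:R^-1)%R) `|` [set x | X x /\ phi x = t0]) <=
    L (\bigcup_n D (t0 - n.+1%:R^-1)%R) + L [set x | X x /\ phi x = t0])%E.
  exact: measureU2.
have N0 : L [set x | X x /\ phi x = t0] = 0%E by exact: (level_null setting Cpsi).
apply: (@le_trans _ _ (L ((\bigcup_n D (t0 - n.+1%:R^-1)%R) `|` [set x | X x /\ phi x = t0]))).
  by apply: le_measure; rewrite ?inE//; exact: measurableU.
by apply: (le_trans U2); rewrite N0 adde0.
Unshelve. all: by end_near. Qed.

End level_density.
End densities.

(** * The bathtub principle *)

Section bathtub.
Context {R : realType} {d : nat}.
Variables (B : set 'rV[R]_d.-1) (Y : set 'rV[R]_d) (c : 'rV[R]_d.-1 * R -> 'rV[R]_d -> R).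
Hypothesis setting : transport_setting B Y c.
Local Notation source := ('rV[R]_d.-1 * measurableTypeR R)%type.
Let X : set source := half_cylinder B.
Let L : {measure set source -> \bar R} := @lebesgue_source R d.
Let mX : measurable X := measurable_half_cylinder setting.
Variables (psi : 'rV[R]_d -> R) (tau : R).
Hypothesis Cpsi : C_Y Y psi.
Let phi : source -> R := c_transform Y c psi.
Let D : set source := sublevel B Y c psi tau.
Let mphi : measurable_fun X phi := c_transform_measurable setting Cpsi.
Let mD : measurable D := measurable_sublevel setting Cpsi tau.

Definition level_deficit : source -> R :=
  (fun x => Num.max 0 (tau - c_transform Y c psi x)) \_ X.
Definition level_excess : source -> R :=
  (fun x => Num.max 0 (c_transform Y c psi x - tau)) \_ X.
Local Notation b := level_deficit.
Local Notation a := level_excess.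

Lemma measurable_level_deficit : measurable_fun setT b.
Proof.
apply/(measurable_restrictT _ _).1 => //.
by apply: measurable_maxr; [exact: measurable_cst|apply: measurable_funB => //; exact: measurable_cst].
Qed.

Lemma measurable_level_excess : measurable_fun setT a.
Proof.
apply/(measurable_restrictT _ _).1 => //.
by apply: measurable_maxr; [exact: measurable_cst|apply: measurable_funB => //; exact: measurable_cst].
Qed.

Lemma level_deficit_ge0 x : 0 <= b x.
Proof. by rewrite /b patchE; case: ifP => // _; rewrite le_max lexx. Qed.

Lemma level_excess_ge0 x : 0 <= a x.
Proof. by rewrite /a patchE; case: ifP => // _; rewrite le_max lexx. Qed.

Lemma level_deficitE x : X x -> b x = Num.max 0 (tau - phi x).
Proof. by move=> Xx; rewrite /b patchE mem_set. Qed.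

Lemma level_excessE x : X x -> a x = Num.max 0 (phi x - tau).
Proof. by move=> Xx; rewrite /a patchE mem_set. Qed.

(** The deficit is bounded and supported in the sublevel set [D], the excess is
    non-negative and vanishes on [D]; competitors are compared on each of them
    separately. *)
Lemma c_transform_level x : X x -> phi x = (tau - b x) + a x.
Proof.
move=> Xx; rewrite level_deficitE// level_excessE//.
by case: (leP 0 (tau - phi x)) => ?; case: (leP 0 (phi x - tau)) => ?; lra.
Qed.

Lemma level_deficit_bounded : exists2 C, 0 < C & forall x, b x <= C.
Proof.
have [K K0 psiK] := potential_bounded setting Cpsi.
exists (`|tau| + K) => [|x]; first by rewrite ltr_wpDl.
rewrite /b patchE; case: ifPn => [/set_mem Xx|_]; last by rewrite addr_ge0// ltW.
rewrite ge_max addr_ge0 ?(ltW K0)//=.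
have [y Yy [-> _]] := c_transform_attained setting Cpsi Xx.
have := psiK _ Yy; rewrite ler_norml => /andP[_]; have := cost_ge0 setting Xx Yy.
by have := ler_norm tau; lra.
Qed.

Lemma level_deficit_outside x : ~ D x -> b x = 0.
Proof.
rewrite /b patchE => nDx; case: ifPn => // /set_mem Xx.
apply/max_l; rewrite subr_le0 leNgt; apply/negP => /ltW phix.
by apply: nDx; split.
Qed.

(** For any competitor [mu] below Lebesgue measure, the integral of the deficit
    against [mu] is at most this constant, and the excess only adds. *)
Definition deficit_mass : \bar R := (\int[L]_(x in X) (b x)%:E)%E.

Lemma deficit_mass_ge0 : (0 <= deficit_mass)%E.
Proof. by apply: integral_ge0 => x _; rewrite lee_fin level_deficit_ge0. Qed.

Lemma deficit_mass_fin : deficit_mass \is a fin_num.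
Proof.
rewrite ge0_fin_numE ?deficit_mass_ge0//.
have [C C0 bC] := level_deficit_bounded.
apply: (@le_lt_trans _ _ (\int[L]_(x in X) (C * \1_D x)%:E)%E).
  apply: ge0_le_integral => //.
  - by move=> x _; rewrite lee_fin level_deficit_ge0.
  - by apply/measurable_EFinP; apply: measurable_funTS; exact: measurable_level_deficit.
  - by apply/measurable_EFinP; apply: measurable_funM; [exact: measurable_cst|apply: measurable_funTS; exact: measurable_indic].
  - move=> x _; rewrite lee_fin indicE; have [/set_mem Dx|/negP nDx] := boolP (x \in D).
      by rewrite mulr1.
    by rewrite mulr0 level_deficit_outside// => Dx; apply: nDx; exact: mem_set.
under eq_integral do rewrite EFinM.
have mI : measurable_fun X (EFin \o (\1_D : source -> R)).
  by apply/measurable_EFinP; apply: measurable_funTS; exact: measurable_indic.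
have C_ge0 : (0 <= C%:E)%E by rewrite lee_fin ltW.
have I0 x : X x -> (0 <= (EFin \o (\1_D : source -> R)) x)%E by rewrite /= lee_fin.
rewrite (ge0_integralZl L mX mI I0 C_ge0).
rewrite integral_indic// lte_mul_pinfty//.
apply: le_lt_trans (sublevel_mass_lty setting Cpsi tau).
by apply: le_measure; rewrite ?inE//; exact: measurableI.
Qed.

Section competitor.
Variable mu : {measure set source -> \bar R}.
Hypothesis mu1 : mu setT = 1%E.
Hypothesis muL : forall A, measurable A -> (mu A <= L (A `&` X))%E.

Let muX : mu X = 1%E.
Proof.
have muC : mu (~` X) = 0%E.
  apply/eqP; rewrite eq_le measure_ge0 andbT.
  have := muL (measurableC mX); by rewrite setICl measure0.
have E : (mu (X `|` ~` X) = mu X + mu (~` X))%E.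
  by apply: measureU => //; [exact: measurableC|rewrite setICr].
by rewrite -mu1 -[RHS](congr1 mu (setUCr X)) E muC adde0.
Qed.

Let mu_fin A : measurable A -> (mu A < +oo)%E.
Proof.
move=> mA; apply: (@le_lt_trans _ _ (mu setT)); last by rewrite mu1 ltry.
by apply: le_measure; rewrite ?inE.
Qed.

Let deficit_integrable : mu.-integrable X (EFin \o b).
Proof.
apply: measurable_bounded_integrable => //; first exact: mu_fin.
  by apply: measurable_funTS; exact: measurable_level_deficit.
have [C C0 bC] := level_deficit_bounded.
exists C; split; first exact: num_real.
by move=> C' CC' x _ /=; rewrite ger0_norm ?level_deficit_ge0// (le_trans (bC x))// ltW.
Qed.

Lemma competitor_deficit_le : (\int[mu]_(x in X) (b x)%:E <= deficit_mass)%E.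
Proof.
apply: ge0_le_measure_integral => //.
- move=> A mA; apply: (le_trans (muL mA)).
  by apply: le_measure; rewrite ?inE//; exact: measurableI.
- by move=> x; rewrite lee_fin level_deficit_ge0.
- by apply/measurable_EFinP; exact: measurable_level_deficit.
Qed.

Lemma competitor_integral : (\int[mu]_(x in X) (phi x)%:E =
  tau%:E - \int[mu]_(x in X) (b x)%:E + \int[mu]_(x in X) (a x)%:E)%E.
Proof.
have tau_int : mu.-integrable X (EFin \o cst tau).
  apply: measurable_bounded_integrable => //; first exact: mu_fin.
  by exists `|tau|; split=> [|M tM x _]; [exact: num_real|exact: ltW].
have tb_int : mu.-integrable X (EFin \o (fun x => tau - b x)).
  have := integrableB mX tau_int deficit_integrable.
  by apply: eq_integrable => // x _; rewrite /= EFinB.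
rewrite (eq_integral (fun x => ((tau - b x) + a x)%:E)) => [|x /set_mem Xx]; last first.
  by rewrite -c_transform_level.
rewrite (integralD_ge0 mX tb_int); last 2 first.
- by apply: measurable_funTS; exact: measurable_level_excess.
- by move=> x _; exact: level_excess_ge0.
congr (_ + _)%E.
under eq_integral do rewrite EFinB.
rewrite integralB_EFin// integral_cst// muX mule1//.
Qed.

Let deficit_fin : (\int[mu]_(x in X) (b x)%:E)%E \is a fin_num.
Proof. exact: integrable_fin_num. Qed.

Lemma bathtub_ge : (tau%:E - deficit_mass <= \int[mu]_(x in X) (phi x)%:E)%E.
Proof.
rewrite competitor_integral -[leLHS]adde0 leeD//.
  by rewrite leeB// competitor_deficit_le.
by apply: integral_ge0 => x _; rewrite lee_fin level_excess_ge0.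
Qed.

(** Equality forces the excess to vanish [mu]-almost everywhere, so [mu] is
    concentrated on [D]; it lies below Lebesgue measure there and both have
    mass 1. *)
Lemma bathtub_eq : (\int[mu]_(x in X) (phi x)%:E <= tau%:E - deficit_mass)%E ->
  L D = 1%E -> forall A, measurable A -> mu A = L (A `&` D).
Proof.
move=> le_bt LD1.
have a0 : (\int[mu]_(x in X) (a x)%:E = 0)%E.
  apply/eqP; rewrite eq_le integral_ge0 ?andbT; last first.
    by move=> x _; rewrite lee_fin level_excess_ge0.
  have := le_bt; rewrite competitor_integral.
  have := competitor_deficit_le; have := deficit_mass_fin; move: deficit_fin.
  set bm := (\int[mu]_(x in X) (b x)%:E)%E; set am := (\int[mu]_(x in X) (a x)%:E)%E.
  move: bm deficit_mass => [bm| |]// [J| |]// _ _; case: am => [am| |]//=.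
  by rewrite !lee_fin; lra.
have ma : measurable_fun X (EFin \o a).
  by apply/measurable_EFinP; apply: measurable_funTS; exact: measurable_level_excess.
have [+ _] := ae_eq_integral_abs mu mX ma.
have -> : (\int[mu]_(x in X) `|(EFin \o a) x| = 0)%E.
  rewrite -[RHS]a0; apply: eq_integral => x _; rewrite gee0_abs//.
  by rewrite lee_fin level_excess_ge0.
move=> /(_ erefl) [N [mN N0 aN]].
have muCX : mu (~` X) = 0%E.
  apply/eqP; rewrite eq_le measure_ge0 andbT.
  by have := muL (measurableC mX); rewrite setICl measure0.
have muCD : mu (~` D) = 0%E.
  apply/eqP; rewrite eq_le measure_ge0 andbT.
  have mCX : measurable (~` X) by exact: measurableC.
  have U2 : (mu (N `|` ~` X) <= mu N + mu (~` X))%E by exact: measureU2.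
  rewrite N0 muCX add0e in U2; apply: le_trans U2.
  apply: le_measure; rewrite ?inE; [exact: measurableC|exact: measurableU|].
  move=> x nDx; have [Xx|nXx] := pselect (X x); [left|by right].
  apply: aN => /= /(_ Xx) [] ax; apply: nDx; split=> //.
  move: ax; rewrite level_excessE// => ax.
  by rewrite -subr_le0 -ax le_max lexx orbT.
have muD A : measurable A -> (mu A <= L (A `&` D))%E.
  move=> mA.
  have mAD : measurable (A `&` D) by exact: measurableI.
  have mCD : measurable (~` D) by exact: measurableC.
  have U2 : (mu ((A `&` D) `|` ~` D) <= mu (A `&` D) + mu (~` D))%E by exact: measureU2.
  rewrite muCD adde0 in U2; apply: (@le_trans _ _ (mu ((A `&` D) `|` ~` D))).
    apply: le_measure; rewrite ?inE//; first exact: measurableU.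
    by move=> x Ax; have [Dx|nDx] := pselect (D x); [left|right].
  apply: (le_trans U2); apply: (le_trans (muL mAD)).
  by apply: le_measure; rewrite ?inE//; exact: measurableI.
move=> A mA; have mCA : measurable (~` A) by exact: measurableC.
have muE : (mu A + mu (~` A) = 1)%E.
  by rewrite -measureU// ?setICr// setUCr.
have LE : (L (A `&` D) + L (~` A `&` D) = 1)%E.
  rewrite -measureU; [|exact: measurableI|exact: measurableI|].
    by rewrite -setIUl setUCr setTI.
  by rewrite setIACA setICr set0I.
move: (muD _ mA) (muD _ mCA) muE LE.
move: (mu A) (mu (~` A)) (L (A `&` D)) (L (~` A `&` D)).
move=> [r1| |] [r2| |] [r3| |] [r4| |]//=; rewrite !lee_fin => h1 h2 [h3] [h4].
by congr EFin; lra.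
Qed.

End competitor.

(** Filling [D] has no excess, and all of the deficit is supported in [D]. *)
Lemma bathtub_attained (mu : {measure set source -> \bar R}) :
  L D = 1%E -> (forall A, measurable A -> mu A = L (A `&` D)) ->
  (\int[mu]_(x in X) (phi x)%:E = tau%:E - deficit_mass)%E.
Proof.
move=> LD1 muE.
have mu1 : mu setT = 1%E by rewrite muE// setTI.
have muL A : measurable A -> (mu A <= L (A `&` X))%E.
  move=> mA; rewrite muE//; apply: le_measure; rewrite ?inE; [exact: measurableI|exact: measurableI|].
  by move=> x [Ax [Xx _]].
rewrite (competitor_integral mu1 muL).
have ma : measurable_fun X (EFin \o a).
  by apply/measurable_EFinP; apply: measurable_funTS; exact: measurable_level_excess.
have -> : (\int[mu]_(x in X) (a x)%:E = 0)%E.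
  have [_ H] := ae_eq_integral_abs mu mX ma.
  rewrite -[RHS]H; last first.
    exists (X `\` D); split; first exact: measurableD.
      rewrite muE; last exact: measurableD.
      rewrite (_ : (X `\` D) `&` D = set0) ?measure0//.
      by apply/seteqP; split=> // x [[_ nDx] /nDx].
    move=> x /= /not_implyP[Xx ax]; split=> // -[_ phix]; apply: ax.
    by rewrite level_excessE// max_l// subr_le0.
  by apply: eq_integral => x _; rewrite gee0_abs// lee_fin level_excess_ge0.
rewrite adde0; congr (_ - _)%E.
have restrict (m : {measure set source -> \bar R}) :
    (\int[m]_(x in X) (b x)%:E = \int[m]_(x in X `&` D) (b x)%:E)%E.
  rewrite [RHS]integral_mkcondr; apply: eq_integral => x _; rewrite patchE.
  by case: ifPn => // /negP nDx; rewrite level_deficit_outside// => Dx; apply: nDx; exact: mem_set.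
rewrite /deficit_mass !restrict; apply: eq_measure_integral => A mA AXD.
by rewrite muE// setIidl// => x /AXD[].
Qed.

End bathtub.

(** * The value of the dual functional *)

Section dual_value.
Context {R : realType} {d : nat}.
Variables (B : set 'rV[R]_d.-1) (Y : set 'rV[R]_d) (c : 'rV[R]_d.-1 * R -> 'rV[R]_d -> R).
Hypothesis setting : transport_setting B Y c.
Local Notation source := ('rV[R]_d.-1 * measurableTypeR R)%type.
Let X : set source := half_cylinder B.
Let L : {measure set source -> \bar R} := @lebesgue_source R d.
Let mX : measurable X := measurable_half_cylinder setting.

(** The part of the subgraph of [p] above that of [p'] is null for both measures,
    hence for Lebesgue measure, and its section at [s] is the interval from
    [p' s] to [p s]. *)
Lemma mu_of_le_ae (p p' : 'rV[R]_d.-1 -> R) : measurable_fun B p -> measurable_fun B p' ->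
  (forall s, B s -> 0 <= p' s) ->
  (forall A : set source, measurable A -> mu_of B p A = mu_of B p' A) ->
  {ae lebesgue_rV d.-1, forall s, B s -> p s <= p' s}.
Proof.
move=> mp mp' p'0 pp'.
pose A : set source := under_graph B p `\` under_graph B p'.
have mA : measurable A by apply: measurableD; exact: (measurable_under_graph setting).
have A0 : L A = 0%E.
  have := pp' A mA; rewrite /mu_of setIidl; last by move=> x [].
  by rewrite (_ : A `&` under_graph B p' = set0) ?measure0//; apply/seteqP; split=> // x [[_ n] /n].
have mh := @measurable_fun_xsection _ _ _ _ R (@lebesgue_measure R) A mA.
have [+ _] := ae_eq_integral_abs (lebesgue_rV d.-1) measurableT mh.
have -> : (\int[lebesgue_rV d.-1]_x `|(@lebesgue_measure R \o xsection A) x| = 0)%E.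
  rewrite -[RHS]A0; apply: eq_integral => s _; rewrite gee0_abs//.
move=> /(_ erefl); apply: filterS => s /= /(_ I) As0 Bs; rewrite leNgt; apply/negP => p'p.
suff : (0 < @lebesgue_measure R (xsection A s))%E by rewrite As0 ltxx.
rewrite (_ : xsection A s = `]p' s, p s]%classic).
  by rewrite lebesgue_measure_itv/= lte_fin p'p lte_fin subr_gt0.
apply/seteqP; split=> t.
  move=> /xsectionP[[[/= _ t0] tp] /= nU]; rewrite in_itv/= tp andbT ltNge; apply/negP => tp'.
  by apply: nU; split.
rewrite /= in_itv/= => /andP[p't tp]; apply/xsectionP; split.
  by split=> //; split=> //=; rewrite (le_trans (p'0 _ Bs))// ltW.
by move=> [_ /=]; rewrite leNgt p't.
Qed.

Lemma mu_of_inj (p p' : 'rV[R]_d.-1 -> R) : measurable_fun B p -> measurable_fun B p' ->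
  (forall s, B s -> 0 <= p s) -> (forall s, B s -> 0 <= p' s) ->
  (forall A : set source, measurable A -> mu_of B p A = mu_of B p' A) ->
  p = p' %[ae lebesgue_rV d.-1 in B].
Proof.
move=> mp mp' p0 p'0 pp'.
have h1 := mu_of_le_ae mp mp' p'0 pp'.
have h2 : {ae lebesgue_rV d.-1, forall s, B s -> p' s <= p s}.
  by apply: (mu_of_le_ae mp' mp p0) => A mA; rewrite pp'.
move: h1 h2; apply: filterS2 => s h1 h2 Bs; apply/eqP.
by rewrite eq_le h1// h2.
Qed.

Section P_ac_measure.
Variable p : 'rV[R]_d.-1 -> R.
Hypothesis Pp : P_ac B p.

Lemma P_ac_measurable : measurable_fun B p. Proof. by case: Pp. Qed.

Let m : {measure set source -> \bar R} := under_graph_measure setting P_ac_measurable.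

Lemma mu_of_setT : m setT = 1%E.
Proof.
rewrite -mu_ofE /mu_of setTI; case: Pp => mp p0 <-.
exact: under_graph_mass.
Qed.

Lemma mu_of_le (A : set source) : measurable A -> (m A <= L (A `&` X))%E.
Proof.
move=> mA; rewrite -mu_ofE; apply: le_measure; rewrite ?inE.
- by apply: measurableI => //; exact: (measurable_under_graph setting P_ac_measurable).
- exact: measurableI.
- by move=> x [Ax [Xx _]].
Qed.

End P_ac_measure.

Variable nu : probability 'rV[R]_d R.

Lemma measurable_target : measurable Y.
Proof. exact: compact_rV_measurable (target_compact setting). Qed.

Lemma potential_measurable psi : C_Y Y psi -> measurable_fun Y psi.
Proof.
move=> Cpsi; apply: (@within_continuous_measurable R 'rV[R]_d _ 'rV[R]_d id Y psi) => //.
exact: open_measurable_rV.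
Qed.

Lemma potential_integrable psi : C_Y Y psi -> nu.-integrable Y (EFin \o psi).
Proof.
move=> Cpsi; apply: measurable_bounded_integrable.
- exact: measurable_target.
- by apply: le_lt_trans (probability_le1 nu measurable_target) _; rewrite ltry.
- exact: potential_measurable.
- have [K K0 psiK] := potential_bounded setting Cpsi.
  exists K; split; first exact: num_real.
  by move=> K' KK' y Yy; apply: (le_trans (psiK _ Yy)); exact: ltW.
Qed.

Lemma potential_integral_fin psi : C_Y Y psi ->
  (\int[nu]_(y in Y) (psi y)%:E)%E \is a fin_num.
Proof. by move=> /potential_integrable; apply: integrable_fin_num; exact: measurable_target. Qed.

Lemma potential_integralE psi : C_Y Y psi ->
  (\int[nu]_(y in Y) (psi y)%:E = (\int[nu]_(y in Y) psi y)%:E)%E.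
Proof. by move=> Cpsi; rewrite /Rintegral fineK// potential_integral_fin. Qed.

Section potential.
Variable psi : 'rV[R]_d -> R.
Hypothesis Cpsi : C_Y Y psi.
Local Notation dens := (density_of B Y c psi).
Local Notation tau := (tau_of B Y c psi).
Let J t : \bar R := deficit_mass B Y c psi t.

Lemma P_ac_density_of : P_ac B dens.
Proof.
have [t Lt] := exists_level setting Cpsi.
rewrite /density_of /tau_of; case: xgetP => [t' _ //|/(_ t)[]].
exact/(P_ac_densityP setting Cpsi).
Qed.

Let level_mass : L (sublevel B Y c psi tau) = 1%E.
Proof. exact/(P_ac_densityP setting Cpsi)/P_ac_density_of. Qed.

Lemma kantorovich_ge t p : P_ac B p ->
  (t%:E - J t + \int[nu]_(y in Y) (psi y)%:E <= kantorovich B Y c psi (mu_of B p) nu)%E.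
Proof.
move=> Pp; apply: leeD => //.
exact: (bathtub_ge setting t Cpsi (mu_of_setT Pp) (mu_of_le Pp)).
Qed.

Lemma kantorovich_density :
  (kantorovich B Y c psi (mu_of B dens) nu = tau%:E - J tau + \int[nu]_(y in Y) (psi y)%:E)%E.
Proof.
congr (_ + _)%E; rewrite (mu_ofE setting (P_ac_measurable P_ac_density_of)).
apply: (bathtub_attained setting Cpsi level_mass) => A mA.
by rewrite -mu_ofE; exact: (mu_of_density setting Cpsi).
Qed.

Lemma dualE : dual B Y c nu psi = kantorovich B Y c psi (mu_of B dens) nu.
Proof.
apply/eqP; rewrite eq_le; apply/andP; split.
  by apply: ereal_inf_lbound; exists dens => //; exact: P_ac_density_of.
by apply: le_ereal_inf_tmp => _ [p Pp <-]; rewrite kantorovich_density; exact: kantorovich_ge.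
Qed.

Lemma dual_value : (dual B Y c nu psi = tau%:E - J tau + \int[nu]_(y in Y) (psi y)%:E)%E.
Proof. by rewrite dualE kantorovich_density. Qed.

(** The bathtub bound holds at every level, not only at the one that normalises the
    density. *)
Lemma dual_ge t : (t%:E - J t + \int[nu]_(y in Y) (psi y)%:E <= dual B Y c nu psi)%E.
Proof. by rewrite dualE; apply: kantorovich_ge; exact: P_ac_density_of. Qed.

Lemma dual_le_kantorovich p : P_ac B p ->
  (dual B Y c nu psi <= kantorovich B Y c psi (mu_of B p) nu)%E.
Proof. by move=> Pp; apply: ereal_inf_lbound; exists p. Qed.

Lemma deficit_mass_E t : J t = (fine (J t))%:E.
Proof. by rewrite fineK// (deficit_mass_fin setting). Qed.

(** Stated for any measure below Lebesgue measure: the first marginal of the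
    coupling constructed below is not known in advance to be that of a density. *)
Lemma bathtub_competitor (mu : {measure set source -> \bar R}) :
  mu setT = 1%E -> (forall A, measurable A -> (mu A <= L (A `&` X))%E) ->
  (kantorovich B Y c psi mu nu <= dual B Y c nu psi)%E ->
  forall A, measurable A -> mu A = mu_of B dens A.
Proof.
move=> mu1 muL; rewrite dual_value /kantorovich potential_integralE// leeD2rE// => le_mu A mA.
by rewrite (bathtub_eq setting Cpsi mu1 muL le_mu level_mass mA) -(mu_of_density setting Cpsi).
Qed.

Lemma kantorovich_le_dual_eq p : P_ac B p ->
  (kantorovich B Y c psi (mu_of B p) nu <= dual B Y c nu psi)%E ->
  p = dens %[ae lebesgue_rV d.-1 in B].
Proof.
move=> Pp le_p; have [mp p0 _] := Pp; have [md d0 _] := P_ac_density_of.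
apply: mu_of_inj => // A mA.
by rewrite (mu_ofE setting (P_ac_measurable Pp)) (bathtub_competitor (mu_of_setT Pp) (mu_of_le Pp)).
Qed.

End potential.
End dual_value.

(** * Weak duality *)

Section weak_duality.
Context {R : realType} {d : nat}.
Variables (B : set 'rV[R]_d.-1) (Y : set 'rV[R]_d) (c : 'rV[R]_d.-1 * R -> 'rV[R]_d -> R).
Hypothesis setting : transport_setting B Y c.
Local Notation source := ('rV[R]_d.-1 * measurableTypeR R)%type.
Local Notation target := 'rV[R]_d.
Let X : set source := half_cylinder B.
Let L : {measure set source -> \bar R} := @lebesgue_source R d.
Let mX : measurable X := measurable_half_cylinder setting.
Let mY : measurable Y := measurable_target setting.
Variable nu : probability target R.
Hypothesis nuY : nu Y = 1%E.

Lemma cost_measurable : measurable_fun (X `*` Y) (fun z : source * target => c z.1 z.2).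
Proof.
apply: (@within_continuous_measurable R (('rV[R]_d.-1 * R) * target)%type _
  (source * target)%type id (X `*` Y) (fun z => c z.1 z.2)).
  exact: open_measurable_source_target.
exact: (cost_continuous setting).
Qed.

Let nuCY : nu (~` Y) = 0%E.
Proof. by rewrite probability_setC// nuY subee. Qed.

(** With [K] a bound of [psi], the inequality
    [c_transform Y c psi x + K <= c x y + (K - psi y)] is integrated against [g].
    All its terms are non-negative, so the integrals pass between [g] and its
    marginals without being known to be finite. *)
Lemma weak_duality (mu : {measure set source -> \bar R}) (g : probability (source * target)%type R) psi :
  C_Y Y psi -> mu setT = 1%E -> (forall A, measurable A -> (mu A <= L (A `&` X))%E) ->
  couplings mu nu g ->
  (kantorovich B Y c psi mu nu <= \int[g]_(z in X `*` Y) (c z.1 z.2)%:E)%E.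
Proof.
move=> Cpsi mu1 muL [g1 g2].
have [K K0 psiK] := potential_bounded setting Cpsi.
pose phi : source -> R := c_transform Y c psi.
have mphi : measurable_fun X phi := c_transform_measurable setting Cpsi.
have mpsi : measurable_fun Y psi := potential_measurable Cpsi.
have phiK x : X x -> 0 <= phi x + K.
  move=> Xx; have [y Yy [Ey _]] := c_transform_attained setting Cpsi Xx.
  have := psiK _ Yy; rewrite ler_norml => /andP[_]; have := cost_ge0 setting Xx Yy.
  by rewrite /phi Ey; lra.
have psi0 y : Y y -> 0 <= K - psi y.
  by move=> Yy; have := psiK _ Yy; rewrite ler_norml => /andP[_]; lra.
have muCX : mu (~` X) = 0%E.
  apply/eqP; rewrite eq_le measure_ge0 andbT.
  by have := muL _ (measurableC mX); rewrite setICl measure0.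
have muX : mu X = 1%E.
  have E : (mu (X `|` ~` X) = mu X + mu (~` X))%E.
    by apply: measureU => //; [exact: measurableC|rewrite setICr].
  by rewrite -mu1 -[RHS](congr1 mu (setUCr X)) E muCX adde0.
have mphiK : measurable_fun X (fun x => phi x + K).
  by apply: measurable_funD => //; exact: measurable_cst.
have mKpsi : measurable_fun Y (fun y => K - psi y).
  by apply: measurable_funB => //; exact: measurable_cst.
have cstK : mu.-integrable X (EFin \o cst (- K)).
  apply: measurable_bounded_integrable => //; first by rewrite muX ltry.
  by exists `|- K|; split=> [|M tM x _]; [exact: num_real|exact: ltW].
have I1 : (\int[mu]_(x in X) (phi x)%:E = (- K)%:E + \int[mu]_(x in X) (phi x + K)%:E)%E.
  have hc : (\int[mu]_(x in X) (cst (- K) x)%:E = (- K)%:E)%E.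
    by apply: etrans (integral_cst mu mX (- K)%:E) _; rewrite muX mule1.
  have := integralD_ge0 mX cstK mphiK phiK; rewrite hc => <-.
  by apply: eq_integral => x _; congr EFin => /=; ring.
have I2 : (\int[nu]_(y in Y) (K - psi y)%:E = K%:E - \int[nu]_(y in Y) (psi y)%:E)%E.
  under eq_integral do rewrite EFinB.
  rewrite integralB_EFin//; last 2 first.
  - apply: measurable_bounded_integrable => //.
      by apply: le_lt_trans (probability_le1 nu mY) _; rewrite ltry.
    by exists `|K|; split=> [|M tM x _]; [exact: num_real|exact: ltW].
  - exact: (potential_integrable setting).
  rewrite integral_cst//; congr (_ - _)%E.
  exact: etrans (congr1 (fun z => K%:E * z)%E nuY) (mule1 _).
have mXT : measurable (fst @^-1` X : set (source * target)).
  by rewrite -[X in measurable X]setTI; exact: measurable_fst.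
have mTY : measurable (snd @^-1` Y : set (source * target)).
  by rewrite -[X in measurable X]setTI; exact: measurable_snd.
have mphi1 : measurable_fun (fst @^-1` X) (fun z : source * target => phi z.1 + K).
  apply: (@measurable_comp _ _ _ _ _ _ X (fun x => phi x + K) _ fst) => //; first by move=> _ [z Xz <-].
  by apply: measurable_funTS; exact: measurable_fst.
have mpsi2 : measurable_fun (snd @^-1` Y) (fun z : source * target => K - psi z.2).
  apply: (@measurable_comp _ _ _ _ _ _ Y (fun y => K - psi y) _ snd) => //; first by move=> _ [z Xz <-].
  by apply: measurable_funTS; exact: measurable_snd.
have mXY : measurable (X `*` Y : set (source * target)) by exact: measurableX.
have mTCY : measurable (snd @^-1` (~` Y) : set (source * target)).
  by rewrite -preimage_setC; exact: measurableC.
have mCXT : measurable (fst @^-1` (~` X) : set (source * target)).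
  by rewrite -preimage_setC; exact: measurableC.
have P1 : (\int[mu]_(x in X) (phi x + K)%:E = \int[g]_(z in X `*` Y) (phi z.1 + K)%:E)%E.
  pose g_fst := pushforward_measure g (@measurable_fst _ _ source target).
  rewrite (@eq_measure_integral _ source R X g_fst mu); last by move=> A mA _; rewrite -g1.
  rewrite (ge0_integral_pushforward (@measurable_fst _ _ source target) g mX); last 2 first.
  - exact/measurable_EFinP.
  - by move=> x /set_mem Xx; rewrite lee_fin phiK.
  have nul : g (snd @^-1` (~` Y)) = 0%E by rewrite g2//; exact: measurableC.
  have ge0 (z : source * target) : (fst @^-1` X) z -> (0 <= (phi z.1 + K)%:E)%E.
    by move=> Xz; rewrite lee_fin phiK.
  have mE := iffRL (measurable_EFinP _ _) mphi1.
  apply: etrans (ge0_negligible_integral mTCY mXT mE ge0 nul) _.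
  congr (integral _ _ _); apply/seteqP; split=> z [/= Xz].
    by move=> nYz; split=> //; exact: contrapT.
  by move=> Yz; split=> // nYz; exact: nYz.
have P2 : (\int[nu]_(y in Y) (K - psi y)%:E = \int[g]_(z in X `*` Y) (K - psi z.2)%:E)%E.
  pose g_snd := pushforward_measure g (@measurable_snd _ _ source target).
  rewrite (@eq_measure_integral _ target R Y g_snd nu); last by move=> A mA _; exact: esym (g2 _ mA).
  rewrite (ge0_integral_pushforward (@measurable_snd _ _ source target) g mY); last 2 first.
  - exact/measurable_EFinP.
  - by move=> y /set_mem Yy; rewrite lee_fin psi0.
  have nul : g (fst @^-1` (~` X)) = 0%E by rewrite g1//; exact: measurableC.
  have ge0 (z : source * target) : (snd @^-1` Y) z -> (0 <= (K - psi z.2)%:E)%E.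
    by move=> Yz; rewrite lee_fin psi0.
  have mE := iffRL (measurable_EFinP _ _) mpsi2.
  apply: etrans (ge0_negligible_integral mCXT mTY mE ge0 nul) _.
  congr (integral _ _ _); apply/seteqP; split=> z [/= h1 h2].
    by split=> //; exact: contrapT.
  by split=> // nXz; exact: nXz.
have key : (\int[mu]_(x in X) (phi x + K)%:E <=
    \int[g]_(z in X `*` Y) (c z.1 z.2)%:E + \int[nu]_(y in Y) (K - psi y)%:E)%E.
  rewrite P1 P2 -ge0_integralD//; last 4 first.
  - by move=> z [Xz Yz]; rewrite lee_fin; exact: (cost_ge0 setting).
  - by apply/measurable_EFinP; exact: cost_measurable.
  - by move=> z [Xz Yz]; rewrite lee_fin psi0.
  - apply/measurable_EFinP; apply: measurable_funS mpsi2 => //; by move=> z [].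
  apply: ge0_le_integral => //.
  - by move=> z [Xz Yz]; rewrite lee_fin phiK.
  - apply/measurable_EFinP; apply: measurable_funS mphi1 => //; by move=> z [].
  - apply/measurable_EFinP; apply: measurable_funD; first exact: cost_measurable.
    by apply: measurable_funS mpsi2 => //; move=> z [].
  - move=> z [Xz Yz]; rewrite lee_fin.
    by have := c_transform_le setting Cpsi Xz Yz; rewrite -/phi; lra.
rewrite /kantorovich I1.
move: key; rewrite I2 (potential_integralE setting)//.
move: (\int[nu]_(y in Y) psi y) => I.
have : (0 <= \int[mu]_(x in X) (phi x + K)%:E)%E.
  by apply: integral_ge0 => x Xx; rewrite lee_fin phiK.
have : (0 <= \int[g]_(z in X `*` Y) (c z.1 z.2)%:E)%E.
  by apply: integral_ge0 => z [Xz Yz]; rewrite lee_fin; exact: (cost_ge0 setting).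
move: (\int[mu]_(x in X) (phi x + K)%:E)%E (\int[g]_(z in X `*` Y) (c z.1 z.2)%:E)%E.
by move=> [r1| |] [r2| |]//=; rewrite ?leey// !lee_fin; lra.
Qed.

Lemma kantorovich_le_primal p psi : P_ac B p -> C_Y Y psi ->
  (kantorovich B Y c psi (mu_of B p) nu <= primal B Y c nu p)%E.
Proof.
move=> Pp Cpsi; apply: le_ereal_inf_tmp => _ [g cg <-].
exact: (weak_duality Cpsi (mu_of_setT setting Pp) (mu_of_le setting Pp) cg).
Qed.

End weak_duality.

(** * The dual of the truncated relaxed problem *)

Section truncated_dual.
Context {R : realType} {d : nat}.
Variables (B : set 'rV[R]_d.-1) (Y : set 'rV[R]_d) (c : 'rV[R]_d.-1 * R -> 'rV[R]_d -> R).
Hypothesis setting : transport_setting B Y c.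
Local Notation source := ('rV[R]_d.-1 * measurableTypeR R)%type.
Local Notation target := 'rV[R]_d.
Let X : set source := half_cylinder B.
Let L : {measure set source -> \bar R} := @lebesgue_source R d.
Let mY : measurable Y := measurable_target setting.
Variable nu : probability target R.
Hypothesis nuY : nu Y = 1%E.
Variable M : R.
Let XM : set source := cylinder_to B M.
Let mXM : measurable XM := measurable_cylinder_to setting M.
Let LXM_lty : (L XM < +oo)%E := cylinder_to_mass_lty setting M.
Let V : R := fine (L XM).

Let V0 : 0 <= V. Proof. exact: fine_ge0. Qed.

Let XMX x : XM x -> X x. Proof. exact: cylinder_to_sub. Qed.

Lemma bounded_integrable_truncated (f : source -> R) (K : R) : measurable_fun XM f ->
  (forall x, XM x -> `|f x| <= K) -> L.-integrable XM (EFin \o f).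
Proof.
move=> mf fK; apply: measurable_bounded_integrable => //.
exists K; split; first exact: num_real.
by move=> K' KK' x Xx; apply: (le_trans (fK _ Xx)); exact: ltW.
Qed.

Definition negative_part (psi : target -> R) (x : source) : R :=
  Num.max 0 (- c_transform Y c psi x).

(** The dual objective of transporting to [nu] a measure below Lebesgue measure on
    the cylinder of height [M]: a positive value of the transform leaves the
    mass at that point unused. *)
Definition truncated_dual (psi : target -> R) : R :=
  \int[nu]_(y in Y) psi y - \int[L]_(x in XM) negative_part psi x.
Local Notation H := truncated_dual.

Lemma negative_part_ge0 psi x : 0 <= negative_part psi x.
Proof. by rewrite /negative_part le_max lexx. Qed.

Lemma c_transform_close psi psi' e x : C_Y Y psi -> C_Y Y psi' ->
  (forall y, Y y -> `|psi y - psi' y| <= e) -> X x ->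
  c_transform Y c psi' x <= c_transform Y c psi x + e.
Proof.
move=> Cpsi Cpsi' psie Xx.
have [y Yy [-> _]] := c_transform_attained setting Cpsi Xx.
apply: (le_trans (c_transform_le setting Cpsi' Xx Yy)).
by have := psie _ Yy; rewrite ler_norml => /andP[]; lra.
Qed.

Lemma negative_part_measurable psi : C_Y Y psi -> measurable_fun XM (negative_part psi).
Proof.
move=> Cpsi; apply: measurable_maxr; first exact: measurable_cst.
apply/measurableT_comp => //.
apply: measurable_funS (c_transform_measurable setting Cpsi) => //.
exact: (measurable_half_cylinder setting).
Qed.

Lemma negative_part_le psi K x : C_Y Y psi -> (forall y, Y y -> psi y <= K) -> 0 <= K ->
  X x -> negative_part psi x <= K.
Proof.
move=> Cpsi psiK K0 Xx; rewrite /negative_part ge_max K0/=.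
have [y Yy [-> _]] := c_transform_attained setting Cpsi Xx.
by have := psiK _ Yy; have := cost_ge0 setting Xx Yy; lra.
Qed.

Lemma negative_part_integrable psi : C_Y Y psi -> L.-integrable XM (EFin \o negative_part psi).
Proof.
move=> Cpsi; have [K K0 psiK] := potential_bounded setting Cpsi.
apply: (@bounded_integrable_truncated _ K) => [|x /XMX Xx]; first exact: negative_part_measurable.
rewrite ger0_norm ?negative_part_ge0// negative_part_le// ?ltW// => y Yy.
by have := psiK _ Yy; rewrite ler_norml => /andP[].
Qed.

Lemma Rintegral_cst_target a : \int[nu]_(y in Y) cst a y = a.
Proof.
rewrite Rintegral_cst// [X in _ * fine X](_ : _ = 1%E) ?mulr1//; exact: nuY.
Qed.

Lemma Rintegral_cst_source a : \int[L]_(x in XM) cst a x = a * V.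
Proof. by rewrite Rintegral_cst. Qed.

(** Lipschitz continuity in the uniform norm, with constant the mass of [nu] plus
    the volume of the cylinder. *)
Lemma truncated_dual_close psi psi' e : C_Y Y psi -> C_Y Y psi' -> 0 <= e ->
  (forall y, Y y -> `|psi y - psi' y| <= e) -> H psi <= H psi' + e * (1 + V).
Proof.
move=> Cpsi Cpsi' e0 psie.
have Cpe := C_YD Cpsi' (@C_Y_cst _ _ Y e).
have h1 : \int[nu]_(y in Y) psi y <= \int[nu]_(y in Y) psi' y + e.
  rewrite -[X in _ + X](Rintegral_cst_target e) -RintegralD//; last 2 first.
  - exact: (potential_integrable setting).
  - exact: (potential_integrable setting nu (@C_Y_cst _ _ Y e)).
  apply: le_Rintegral => //.
  - exact: (potential_integrable setting).
  - exact: (potential_integrable setting nu Cpe).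
  - by move=> y Yy /=; have := psie _ Yy; rewrite ler_norml => /andP[]; lra.
have h2 : \int[L]_(x in XM) negative_part psi' x <= \int[L]_(x in XM) negative_part psi x + e * V.
  have cst_int : L.-integrable XM (EFin \o cst e).
    by apply: (@bounded_integrable_truncated _ `|e|) => // x _; exact: lexx.
  have s_int : L.-integrable XM (EFin \o (fun x => negative_part psi x + cst e x)).
    have := integrableD mXM (negative_part_integrable Cpsi) cst_int.
    by apply: eq_integrable => // x _ /=; rewrite EFinD.
  rewrite -Rintegral_cst_source -RintegralD//; last exact: negative_part_integrable.
  apply: le_Rintegral => //; first exact: negative_part_integrable.
  move=> x Xx; rewrite /= {1}/negative_part ge_max addr_ge0 ?negative_part_ge0//=.
  have psie' y : Y y -> `|psi' y - psi y| <= e by move=> Yy; rewrite distrC psie.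
  have := c_transform_close Cpsi' Cpsi psie' (XMX Xx).
  have : - c_transform Y c psi x <= negative_part psi x by rewrite le_max lexx orbT.
  by lra.
by rewrite /H; lra.
Qed.

Lemma truncated_dual_le psi psi' : C_Y Y psi -> C_Y Y psi' ->
  (forall y, Y y -> psi y <= psi' y) ->
  (forall x, XM x -> c_transform Y c psi x <= c_transform Y c psi' x) ->
  H psi <= H psi'.
Proof.
move=> Cpsi Cpsi' le_psi le_ct; apply: lerB.
  by apply: le_Rintegral => //; exact: (potential_integrable setting).
apply: le_Rintegral => //; [exact: negative_part_integrable|exact: negative_part_integrable|].
move=> x Xx; rewrite /negative_part ge_max !le_max lexx/= lerN2.
by rewrite le_ct// orbT.
Qed.

Lemma truncated_dual0 : H (cst 0) = 0.
Proof.
rewrite /H Rintegral_cst_target sub0r (@eq_Rintegral _ _ _ _ _ (cst 0)).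
  by rewrite Rintegral_cst_source mul0r oppr0.
move=> x /set_mem /XMX Xx; rewrite /negative_part; apply: max_l.
rewrite oppr_le0; apply: (c_transform_ge setting (@C_Y_cst _ _ Y 0) Xx) => y Yy.
by rewrite subr0; exact: (cost_ge0 setting).
Qed.

Lemma truncated_dual_le_max psi K : C_Y Y psi -> (forall y, Y y -> psi y <= K) -> H psi <= K.
Proof.
move=> Cpsi psiK; rewrite /H lerBlDr.
apply: (@le_trans _ _ K); last by rewrite lerDl Rintegral_ge0// => x _; exact: negative_part_ge0.
rewrite -[leRHS](Rintegral_cst_target K); apply: le_Rintegral => //.
- exact: (potential_integrable setting).
- exact: (potential_integrable setting nu (@C_Y_cst _ _ Y K)).
Qed.

(** On the cylinder of height [P] the transform is at most [C - psi y0], and the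
    volume 2 of that cylinder outweighs the unit mass of [nu]. *)
Lemma truncated_dual_upper psi C (P : R) y0 : C_Y Y psi -> 0 <= P -> P <= M ->
  (fine (L (cylinder_to B P)) = 2) ->
  (forall x y, cylinder_to B P x -> Y y -> c x y <= C) ->
  Y y0 -> (forall y, Y y -> psi y <= psi y0) ->
  H psi <= C *+ 2 - psi y0.
Proof.
move=> Cpsi P0 PM LP cC Yy0 psi_max.
have mXP := measurable_cylinder_to setting P.
have XPM : cylinder_to B P `<=` XM.
  by move=> [s p] [/= Bs]; rewrite /= !in_itv/= => /andP[p0 pP]; split=> //=; rewrite in_itv/= p0 (le_trans pP).
have nint := negative_part_integrable Cpsi.
have h1 : \int[L]_(x in cylinder_to B P) negative_part psi x <= \int[L]_(x in XM) negative_part psi x.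
  rewrite /Rintegral fine_le//; last 1 first.
  - apply: ge0_subset_integral => //.
    + by case/integrableP: nint.
    + by move=> x _; rewrite lee_fin negative_part_ge0.
  - by apply: integrable_fin_num => //; apply: integrableS nint.
  - exact: integrable_fin_num.
have h2 : 2 * (psi y0 - C) <= \int[L]_(x in cylinder_to B P) negative_part psi x.
  rewrite mulrC -LP -Rintegral_cst//; apply: le_Rintegral => //.
  - apply: (@measurable_bounded_integrable _ source _ L) => //; first exact: (cylinder_to_mass_lty setting).
    by exists `|psi y0 - C|; split=> [|K' KK' x _]; [exact: num_real|exact: ltW].
  - exact: integrableS nint.
  - move=> x Px; rewrite /negative_part le_max; apply/orP; right.
    have := c_transform_le setting Cpsi (XMX (XPM _ Px)) Yy0.
    by have := cC _ _ Px Yy0; rewrite /cst; lra.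
have h3 : \int[nu]_(y in Y) psi y <= psi y0.
  rewrite -[leRHS](Rintegral_cst_target (psi y0)); apply: le_Rintegral => //.
  - exact: (potential_integrable setting).
  - exact: (potential_integrable setting nu (@C_Y_cst _ _ Y (psi y0))).
by rewrite /H mulr2n; lra.
Qed.

End truncated_dual.

(** * A maximiser of the truncated dual *)

Section maximiser.
Context {R : realType} {d : nat}.
Variables (B : set 'rV[R]_d.-1) (Y : set 'rV[R]_d) (c : 'rV[R]_d.-1 * R -> 'rV[R]_d -> R).
Hypothesis setting : transport_setting B Y c.
Local Notation source := ('rV[R]_d.-1 * measurableTypeR R)%type.
Local Notation target := 'rV[R]_d.
Let X : set ('rV[R]_d.-1 * R) := half_cylinder B.
Variable nu : probability target R.
Hypothesis nuY : nu Y = 1%E.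
Variable M : R.
Hypothesis M0 : 0 <= M.
Let XM : set ('rV[R]_d.-1 * R) := cylinder_to B M.
Let XMX x : XM x -> X x. Proof. exact: cylinder_to_sub. Qed.
Local Notation H := (truncated_dual B Y c nu M).
Let cXM : compact XM := @compact_cylinder_to _ _ _ _ _ setting M.

Let XM0 : XM !=set0.
Proof.
have [s Bs] := base_interior setting; exists (s, 0); split=> /=; first exact: interior_subset.
by rewrite in_itv/= lexx.
Qed.

(** Lipschitz continuity for the pseudo-distance [sup_x `|c x y - c x y'|] on
    [Y]. It yields equicontinuity and passes to pointwise limits. *)
Definition cost_modulus (psi : target -> R) : Prop :=
  forall y y' e, Y y -> Y y' -> (forall x, XM x -> `|c x y - c x y'| <= e) ->
  psi y - psi y' <= e.

Lemma cost_modulus_C_Y psi : cost_modulus psi -> C_Y Y psi.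
Proof.
move=> mpsi; apply/within_continuous_nearP => y Yy e e0.
have e20 : 0 < e / 2 by rewrite divr_gt0.
have := cost_equicontinuous_target setting cXM
  (@cylinder_to_sub _ _ B M) Yy e20.
apply: filterS => y' Hy' Yy'.
apply: (@le_lt_trans _ _ (e / 2)); last by rewrite ltr_pdivrMr// mulr_natr mulr2n ltrDl.
have h1 := mpsi _ _ _ Yy Yy' (Hy' Yy').
have h2 : psi y' - psi y <= e / 2.
  by apply: mpsi => // x Xx; rewrite distrC; exact: Hy'.
by rewrite ler_norml; apply/andP; split; lra.
Qed.

(** The second transform, with the infimum taken over the truncated cylinder. *)
Definition back_transform (psi : target -> R) (y : target) : R :=
  inf [set c x y - c_transform Y c psi x | x in XM].
Local Notation hat := back_transform.

Section back.
Variable psi : target -> R.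
Hypothesis Cpsi : C_Y Y psi.

Lemma back_transform_attained y : Y y -> exists2 x, XM x &
  hat psi y = c x y - c_transform Y c psi x /\
  forall x', XM x' -> hat psi y <= c x' y - c_transform Y c psi x'.
Proof.
move=> Yy.
have cont : {within XM, continuous (fun x => c x y - c_transform Y c psi x)}.
  have /within_continuous_nearP cc := cost_continuous setting.
  have /within_continuous_nearP ct := c_transform_continuous setting Cpsi.
  apply/within_continuous_nearP => x /XMX Xx e e0.
  have e20 : 0 < e / 2 by rewrite divr_gt0.
  have [[V W] /= [Vx Wy] VW] := cc (x, y) (conj Xx Yy) _ e20.
  have := ct x Xx _ e20; apply: filterS2 Vx => x' Vx' h /XMX Xx'.
  have := VW (x', y) (conj Vx' (nbhs_singleton Wy)) (conj Xx' Yy).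
  move=> /= h2; have h3 := h Xx'.
  rewrite (_ : _ - _ = (c x y - c x' y) - (c_transform Y c psi x - c_transform Y c psi x')); last by ring.
  by apply: (le_lt_trans (ler_normB _ _)); rewrite [ltRHS]splitr ltrD.
have [x /set_mem Xx xmin] := compact_EVT_min XM0 cXM cont.
have lb : lbound [set c x y - c_transform Y c psi x | x in XM] (c x y - c_transform Y c psi x).
  by move=> _ [x' Xx' <-]; exact/xmin/mem_set.
exists x => //; suff E : hat psi y = c x y - c_transform Y c psi x.
  by split=> // x' Xx'; rewrite E; exact/xmin/mem_set.
apply/eqP; rewrite eq_le; apply/andP; split.
  by apply: ge_inf; [exists (c x y - c_transform Y c psi x)|exists x].
by apply: lb_le_inf => //; exists (c x y - c_transform Y c psi x), x.
Qed.

Lemma back_transform_modulus : cost_modulus (hat psi).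
Proof.
move=> y y' e Yy Yy' ce.
have [x' Xx' [-> _]] := back_transform_attained Yy'.
have [x Xx [_ hle]] := back_transform_attained Yy.
by have := hle _ Xx'; have := ce _ Xx'; rewrite ler_norml => /andP[]; lra.
Qed.

Lemma back_transform_C_Y : C_Y Y (hat psi).
Proof. exact: cost_modulus_C_Y back_transform_modulus. Qed.

Lemma le_back_transform y : Y y -> psi y <= hat psi y.
Proof.
move=> Yy; have [x Xx [-> _]] := back_transform_attained Yy.
by have := c_transform_le setting Cpsi (XMX Xx) Yy; lra.
Qed.

Lemma c_transform_back_transform x : XM x ->
  c_transform Y c psi x <= c_transform Y c (hat psi) x.
Proof.
move=> Xx; apply: (c_transform_ge setting back_transform_C_Y (XMX Xx)) => y Yy.
by have [x' Xx' [_ hle]] := back_transform_attained Yy; have := hle _ Xx; lra.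
Qed.

Lemma truncated_dual_back_transform : H psi <= H (hat psi).
Proof.
apply: (truncated_dual_le setting nu Cpsi back_transform_C_Y) => //.
  exact: le_back_transform.
exact: c_transform_back_transform.
Qed.

End back.

Lemma continuous_max psi : C_Y Y psi -> exists2 y0, Y y0 & forall y, Y y -> psi y <= psi y0.
Proof.
move=> Cpsi; have [y0 /set_mem Yy0 ymax] :=
  compact_EVT_max (target_neq0 setting) (target_compact setting) Cpsi.
by exists y0 => // y Yy; exact/ymax/mem_set.
Qed.

Variables (C P : R).
Hypotheses (P0 : 0 <= P) (PM : P <= M).
Hypothesis LP : fine (@lebesgue_source R d (cylinder_to B P)) = 2.
Hypothesis cC : forall x y, cylinder_to B P x -> Y y -> c x y <= C.

Lemma truncated_dual_bounded psi : C_Y Y psi -> H psi <= C.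
Proof.
move=> Cpsi; have [y0 Yy0 ymax] := continuous_max Cpsi.
have := truncated_dual_le_max setting nuY M Cpsi ymax.
have := truncated_dual_upper setting nuY Cpsi P0 PM LP cC Yy0 ymax.
by rewrite mulr2n; lra.
Qed.

(** Normalisation: a non-negative objective bounds the maximum of the potential,
    and then, through [cost_modulus], also its minimum. *)
Lemma truncated_dual_ge0_le psi y : C_Y Y psi -> 0 <= H psi -> Y y -> psi y <= C *+ 2.
Proof.
move=> Cpsi Hpsi Yy; have [y0 Yy0 ymax] := continuous_max Cpsi.
have := truncated_dual_upper setting nuY Cpsi P0 PM LP cC Yy0 ymax.
by have := ymax _ Yy; lra.
Qed.

Lemma truncated_dual_ge0_ge psi K y : cost_modulus psi -> 0 <= H psi ->
  (forall x y, XM x -> Y y -> c x y <= K) -> Y y -> - K <= psi y.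
Proof.
move=> mpsi Hpsi cK Yy; have Cpsi := cost_modulus_C_Y mpsi.
have [y0 Yy0 ymax] := continuous_max Cpsi.
have h0 := truncated_dual_le_max setting nuY M Cpsi ymax.
have : psi y0 - psi y <= K.
  apply: mpsi => // x Xx; have := cK _ _ Xx Yy0; have := cK _ _ Xx Yy.
  have := cost_ge0 setting (XMX Xx) Yy; have := cost_ge0 setting (XMX Xx) Yy0.
  by move=> *; rewrite ler_norml; apply/andP; split; lra.
by lra.
Qed.

Let T := prod_topology (fun _ : target => R).

Lemma pointwise_nbhs (f0 : T) (e : R) (s : seq target) : 0 < e ->
  nbhs f0 [set f : T | forall y, y \in s -> `|f0 y - f y| < e].
Proof.
move=> e0; elim: s => [|y s IH]; first by apply: filterS filterT => f _ y.
have ny : nbhs f0 [set f : T | `|f0 y - f y| < e].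
  exact: (@proj_continuous target (fun _ => R) y f0 _ (nbhsx_ballx (f0 y : R) e e0)).
apply: filterS2 ny IH => f fy fs z; rewrite inE => /predU1P[->//|]; exact: fs.
Qed.

(** Nearly optimal potentials with the common modulus form a filter base in a
    product of compact intervals. A cluster point keeps the modulus; closeness
    to it on a finite net of [Y] is uniform closeness, so by
    [truncated_dual_close] the supremum is attained there. *)
Lemma truncated_dual_max : exists2 psi0, C_Y Y psi0 & forall psi, C_Y Y psi -> H psi <= H psi0.
Proof.
have C0 := @C_Y_cst _ _ Y 0.
pose S := [set H psi | psi in C_Y Y].
have S_sup : has_sup S.
  split; first by exists (H (cst 0)), (cst 0).
  by exists C => _ [psi Cpsi <-]; exact: truncated_dual_bounded.
pose h := sup S.
have leh psi : C_Y Y psi -> H psi <= h.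
  by move=> Cpsi; apply: (ub_le_sup S_sup.2); exists psi.
have [K K0 cK] := cost_bounded setting M.
pose E e : set T := [set f | cost_modulus f /\ h - e < H f /\ 0 <= H f].
pose box : set T := [set f : T | forall y, `[- (`|K| + `|C *+ 2|), `|K| + `|C *+ 2|]%classic (f y)].
have cbox : compact box.
  exact: (@tychonoff target (fun _ => R) (fun _ => _) (fun _ => @segment_compact _ _ _)).
pose F : set_system T := filter_from [set e : R | 0 < e] (fun e => E e `&` box).
have H_ext psi psi' : C_Y Y psi -> C_Y Y psi' -> {in Y, psi =1 psi'} -> H psi = H psi'.
  move=> Cpsi Cpsi' pp; apply/eqP; rewrite eq_le; apply/andP; split.
    have := truncated_dual_close setting nuY M Cpsi Cpsi' (lexx 0).
    by rewrite mul0r addr0; apply => y Yy; rewrite pp ?subrr ?normr0//; exact: mem_set.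
  have := truncated_dual_close setting nuY M Cpsi' Cpsi (lexx 0).
  by rewrite mul0r addr0; apply => y Yy; rewrite pp ?subrr ?normr0//; exact: mem_set.
have E0 e : 0 < e -> exists f, (E e `&` box) f.
  move=> e0.
  have [psi Cpsi [psi_e psi0]] : exists2 psi, C_Y Y psi & h - e < H psi /\ 0 <= H psi.
    have [_ [psi Cpsi <-] psi_e] := sup_adherent e0 S_sup.
    have [psi0|psi0] := leP 0 (H psi); first by exists psi.
    exists (cst 0) => //; rewrite truncated_dual0//.
    by split=> //; apply: lt_trans psi0.
  (* values outside [Y] are set to 0 to stay in the compact product *)
  pose f : target -> R := (back_transform psi) \_ Y.
  have fE y : Y y -> f y = back_transform psi y by move=> Yy; rewrite /f patchE mem_set.
  have mf : cost_modulus f.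
    by move=> y y' e' Yy Yy' ce; rewrite !fE//; exact: (back_transform_modulus Cpsi).
  have Hf : H psi <= H f.
    rewrite (H_ext f (back_transform psi) (cost_modulus_C_Y mf) (back_transform_C_Y Cpsi)).
      exact: truncated_dual_back_transform.
    by move=> y /set_mem Yy; rewrite fE.
  have Hf0 := le_trans psi0 Hf.
  exists f; split; first by split=> //; split=> //; exact: lt_le_trans Hf.
  move=> y; rewrite /= in_itv/= -ler_norml.
  have [Yy|nYy] := pselect (Y y); last by rewrite /f patchE memNset// normr0.
  have h1 := truncated_dual_ge0_le (cost_modulus_C_Y mf) Hf0 Yy.
  have h2 := truncated_dual_ge0_ge mf Hf0 cK Yy.
  rewrite ler_norml; apply/andP; split.
    by have := ler_norm K; have := normr_ge0 (C *+ 2); lra.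
  by have := ler_norm (C *+ 2); have := normr_ge0 K; lra.
have FF : ProperFilter F.
  apply: filter_from_proper; last by move=> e e0; exact: E0.
  apply: filter_from_filter; first by exists 1 => /=.
  move=> e e' /= e0 e'0; exists (Num.min e e') => /=; first by rewrite lt_min e0.
  move=> f [[mf [fe f0]] bf]; split; split=> //; split=> //; split=> //; apply: le_lt_trans fe;
    by rewrite lerD2l lerN2 ge_min lexx ?orbT.
have [f0 [bf0 cf0]] : (box `&` cluster F) !=set0.
  by apply: cbox; exists 1 => //= f [].
have near_f0 e (s : seq target) : 0 < e -> exists2 f, E e f & forall y, y \in s -> `|f0 y - f y| < e.
  move=> e0; have FE : F (E e `&` box) by exists e.
  by have [f [[Ef _] ff]] := cf0 _ _ FE (pointwise_nbhs f0 s e0); exists f.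
have mf0 : cost_modulus f0.
  move=> y y' e Yy Yy' ce; apply/ler_addgt0Pr => r r0.
  have r20 : 0 < r / 2 by rewrite divr_gt0.
  have [f [mf _] ff] := near_f0 _ [:: y; y'] r20.
  have := mf _ _ _ Yy Yy' ce.
  have := ff y; rewrite !inE eqxx => /(_ isT); rewrite ltr_norml => /andP[? ?].
  have := ff y'; rewrite !inE eqxx orbT => /(_ isT); rewrite ltr_norml => /andP[? ?].
  by lra.
have Cf0 := cost_modulus_C_Y mf0.
exists f0 => // psi Cpsi; apply: (le_trans (leh _ Cpsi)).
pose V := fine (@lebesgue_source R d (cylinder_to B M)).
have V0 : 0 <= V by exact: fine_ge0.
apply/ler_addgt0Pr => r r0.
(* [3 * e] will be the uniform distance and [1 + V] is the Lipschitz constant *)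
pose e := r / (1 + 3 * (1 + V)).
have D0 : 0 < 1 + 3 * (1 + V) by rewrite ltr_wpDr// mulr_ge0// addr_ge0.
have e0 : 0 < e by rewrite divr_gt0.
have [s sY] : exists s : seq target, (forall z, z \in s -> Y z) /\ forall y, Y y -> exists2 z, z \in s &
    forall x, XM x -> `|c x z - c x y| <= e.
  have tube z : exists U : set target, Y z -> [/\ open U, U z &
      forall y, U y -> Y y -> forall x, XM x -> `|c x z - c x y| <= e].
    have [Yz|] := pselect (Y z); last by exists set0.
    have := cost_equicontinuous_target setting cXM
      (@cylinder_to_sub _ _ B M) Yz e0.
    rewrite -[X in X -> _]/(nbhs z _) nbhsE => -[U [oU Uz] UH].
    by exists U => _; split.
  pose U z := projT1 (cid (tube z)).
  have UP z := projT2 (cid (tube z)).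
  have := target_compact setting; rewrite compact_cover => /(_ _ Y U)[z /UP[]//|z Yz|D DY YD].
    by exists z => //; have [] := UP z Yz.
  exists (enum_fset D); split=> [z zD|y Yy]; first exact/set_mem/DY.
  have [z zD Uzy] := YD _ Yy; exists z => //.
  by have [_ _] := UP z (set_mem (DY _ zD)); apply.
have [f [mf [fe _]] ff] := near_f0 e s e0.
have Cf := cost_modulus_C_Y mf.
have close y : Y y -> `|f y - f0 y| <= 3 * e.
  move=> Yy; have [sYY /(_ _ Yy) [z zs cz]] := sY.
  have Yz := sYY _ zs.
  have cz' x : XM x -> `|c x y - c x z| <= e by move=> Xx; rewrite distrC cz.
  have := ff _ zs; rewrite ltr_norml => /andP[? ?].
  have := mf _ _ _ Yz Yy cz; have := mf _ _ _ Yy Yz cz'.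
  have := mf0 _ _ _ Yz Yy cz; have := mf0 _ _ _ Yy Yz cz' => *.
  by rewrite ler_norml; apply/andP; split; lra.
have e30 : 0 <= 3 * e by rewrite mulr_ge0// ltW.
have := truncated_dual_close setting nuY M Cf Cf0 e30 close; rewrite -/V.
have : e * (1 + 3 * (1 + V)) = r by rewrite /e divfK// gt_eqF.
by lra.
Qed.

End maximiser.

(** * A coupling whose cost is the truncated dual value *)

Lemma ge0_integral_concentrated d (T : measurableType d) (R : realType)
    (m : {measure set T -> \bar R}) (D : set T) (f : T -> \bar R) :
  measurable D -> m (~` D) = 0%E -> measurable_fun setT f -> (forall x, 0 <= f x)%E ->
  (\int[m]_x f x = \int[m]_(x in D) f x)%E.
Proof.
move=> mD mD0 mf f0.
rewrite (@ge0_negligible_integral _ _ _ _ setT (~` D))//; last exact: measurableC.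
by rewrite setTD setCK.
Qed.

Section unit_mass.
Context d (T : measurableType d) (R : realType) (m : {measure set T -> \bar R}).
Hypothesis m1 : m setT = 1%E.

(** The proof of unit mass is an argument so that the instances below can use it. *)
Definition unit_mass_measure : set T -> \bar R := let _ := m1 in m.

HB.instance Definition _ := Measure.copy unit_mass_measure m.
HB.instance Definition _ := Measure_isProbability.Build _ _ _ unit_mass_measure m1.

End unit_mass.

Section coupling.
Context {R : realType} {d : nat}.
Variables (B : set 'rV[R]_d.-1) (Y : set 'rV[R]_d) (c : 'rV[R]_d.-1 * R -> 'rV[R]_d -> R).
Hypothesis setting : transport_setting B Y c.
Local Notation source := ('rV[R]_d.-1 * measurableTypeR R)%type.
Local Notation target := 'rV[R]_d.
Let X : set ('rV[R]_d.-1 * R) := half_cylinder B.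
Let L : {measure set source -> \bar R} := @lebesgue_source R d.
Variable nu : probability target R.
Hypothesis nuY : nu Y = 1%E.
Variable M : R.
Let XM : set ('rV[R]_d.-1 * R) := cylinder_to B M.
Let XMX x : XM x -> X x. Proof. exact: cylinder_to_sub. Qed.
Let mXM : measurable (XM : set source) := measurable_cylinder_to setting M.
Let mY : measurable Y := measurable_target setting.
Let cXM : compact XM := @compact_cylinder_to _ _ _ _ _ setting M.
Local Notation H := (truncated_dual B Y c nu M).

Let nuCY : nu (~` Y) = 0%E.
Proof. by rewrite probability_setC// nuY subee. Qed.

Variable h : R.
Hypothesis Hh : forall psi, C_Y Y psi -> H psi <= h.
Hypothesis LXM_ge1 : 1 <= fine (L XM).

Definition C_X : set ('rV[R]_d.-1 * R -> R) := [set u | {within XM, continuous u}].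

Lemma source_integrable u : C_X u -> L.-integrable XM (EFin \o u).
Proof.
move=> Cu; have [K K0 uK] := within_compact_bounded cXM Cu.
apply: (bounded_integrable_truncated setting (K := K)) => //.
apply: (@within_continuous_measurable R ('rV[R]_d.-1 * R)%type _ source id XM u) => //.
exact: open_measurable_source.
Qed.

Let IL (u : 'rV[R]_d.-1 * R -> R) : R := \int[L]_(x in XM) u x.
Let IN (v : target -> R) : R := \int[nu]_(y in Y) v y.

Lemma C_X_cst a : C_X (cst a).
Proof. by move=> x; exact: cst_continuous. Qed.

Lemma C_XD u v : C_X u -> C_X v -> C_X (fun x => u x + v x).
Proof. by move=> Cu Cv x; apply: cvgD; [exact: Cu|exact: Cv]. Qed.

Lemma C_XZ a u : C_X u -> C_X (fun x => a * u x).
Proof. by move=> Cu x; apply: cvgM; [exact: cvg_cst|exact: Cu]. Qed.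

Let ILD u v : C_X u -> C_X v -> IL (fun x => u x + v x) = IL u + IL v.
Proof. by move=> Cu Cv; apply: RintegralD => //; exact: source_integrable. Qed.

Let ILZ a u : C_X u -> IL (fun x => a * u x) = a * IL u.
Proof. by move=> Cu; apply: RintegralZl => //; exact: source_integrable. Qed.

Let IL_cst a : IL (cst a) = a * fine (L XM).
Proof. exact: (Rintegral_cst_source setting). Qed.

Let IL_le u v : C_X u -> C_X v -> (forall x, XM x -> u x <= v x) -> IL u <= IL v.
Proof. by move=> Cu Cv uv; apply: le_Rintegral => //; exact: source_integrable. Qed.

Let INint v : C_Y Y v -> nu.-integrable Y (EFin \o v).
Proof. exact: (potential_integrable setting). Qed.

Let IND u v : C_Y Y u -> C_Y Y v -> IN (fun x => u x + v x) = IN u + IN v.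
Proof. by move=> Cu Cv; apply: RintegralD => //; exact: INint. Qed.

Let INZ a u : C_Y Y u -> IN (fun x => a * u x) = a * IN u.
Proof. by move=> Cu; apply: RintegralZl => //; exact: INint. Qed.

Let IN_cst a : IN (cst a) = a.
Proof. exact: (Rintegral_cst_target setting). Qed.

Let IN_le u v : C_Y Y u -> C_Y Y v -> (forall x, Y x -> u x <= v x) -> IN u <= IN v.
Proof. by move=> Cu Cv uv; apply: le_Rintegral => //; exact: INint. Qed.

(** For [t > 0] this is the bound [h] for the potential [- v / t]: the negative
    part of its transform is at most [u / t]. For [t = 0], a negative minimum of
    [v] is compensated by [u] on a set of volume at least 1. *)
Lemma constraint_positive t u v : 0 <= t -> C_X u -> (forall x, XM x -> 0 <= u x) -> C_Y Y v ->
  (forall x y, XM x -> Y y -> 0 <= t * c x y + u x + v y) ->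
  0 <= t * h + IL u + IN v.
Proof.
rewrite le_eqVlt => /predU1P[<-|t0] Cu u0 Cv pos; last first.
  pose psi y := - t^-1 * v y.
  have Cpsi : C_Y Y psi := C_YZ (a := - t^-1) Cv.
  have npu x : XM x -> negative_part Y c psi x <= t^-1 * u x.
    move=> Xx; rewrite /negative_part ge_max mulr_ge0 ?invr_ge0 ?(ltW t0) ?u0//=.
    have [y Yy [-> _]] := c_transform_attained setting Cpsi (XMX Xx).
    rewrite /psi -(ler_pM2l t0) mulrA divff ?gt_eqF// mul1r.
    rewrite (_ : t * _ = - (t * c x y) - (t / t) * v y); last by ring.
    by rewrite divff ?gt_eqF//; have := pos _ _ Xx Yy; lra.
  have Hpsi := Hh Cpsi.
  have : IN psi - t^-1 * IL u <= h.
    apply: le_trans Hpsi; rewrite lerB// -ILZ//.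
    apply: le_Rintegral => //; first exact: negative_part_integrable.
    exact: (source_integrable (C_XZ (a := t^-1) Cu)).
  rewrite INZ// -(ler_pM2l t0) mulrBr !mulrA mulrN divff ?gt_eqF//; lra.
have [y0 Yy0 ymin] : exists2 y0, Y y0 & forall y, Y y -> v y0 <= v y.
  have [y0 /set_mem Yy0 ymin] := compact_EVT_min (target_neq0 setting) (target_compact setting) Cv.
  by exists y0 => // y Yy; exact/ymin/mem_set.
have le_v : v y0 <= IN v by rewrite -[leLHS]IN_cst; apply: IN_le => //; exact: C_Y_cst.
have [v0|v0] := leP 0 (v y0).
  have : 0 <= IL u by have := IL_le (C_X_cst (a := 0)) Cu u0; rewrite IL_cst mul0r.
  by lra.
have := IL_le (C_X_cst (a := - v y0)) Cu; rewrite IL_cst => le_u.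
have : - v y0 * fine (L XM) <= IL u.
  by apply: le_u => x Xx; have := pos _ _ Xx Yy0; rewrite /cst/=; lra.
have : - v y0 <= - v y0 * fine (L XM) by rewrite ler_peMr// oppr_ge0 ltW.
by lra.
Qed.

Variable pi : cantor_space -> ('rV[R]_d.-1 * R) * target.
Hypothesis pi_cont : continuous pi.
Hypothesis pi_range : range pi = XM `*` Y.

Let piX z : XM (pi z).1.
Proof. by have [] : (XM `*` Y) (pi z) by rewrite -pi_range; exists z. Qed.

Let piY z : Y (pi z).2.
Proof. by have [] : (XM `*` Y) (pi z) by rewrite -pi_range; exists z. Qed.

Let pi_onto x y : XM x -> Y y -> exists z, pi z = (x, y).
Proof.
by move=> Xx Yy; have [z _ ?] : (range pi) (x, y) by [rewrite pi_range]; exists z.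
Qed.

Lemma within_comp_continuous (T : topologicalType) (A : set T) (k : cantor_space -> T) (f : T -> R) :
  continuous k -> (forall z, A (k z)) -> {within A, continuous f} -> continuous (f \o k).
Proof.
move=> ck kA /within_continuous_nearP cf z; apply/cvgrPdist_lt => e e0.
have := ck z _ (cf (k z) (kA z) e e0).
by apply: (@filterS _ _ (nbhs_filter z)) => w; apply; exact: kA.
Qed.

Let continuous_pi1 : continuous (fun z => (pi z).1).
Proof. by move=> z; apply: continuous_comp (pi_cont (x := z)) (@cvg_fst _ _ _ _ _). Qed.

Let continuous_pi2 : continuous (fun z => (pi z).2).
Proof. by move=> z; apply: continuous_comp (pi_cont (x := z)) (@cvg_snd _ _ _ _ _). Qed.

Let measurable_pi : measurable_fun [set: cantor_measurable] (pi : cantor_measurable -> source * target).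
Proof.
apply/measurable_fun_pairP; split; last exact: (continuous_cantor_measurable_rV continuous_pi2).
apply/measurable_fun_pairP; split.
  apply: continuous_cantor_measurable_rV => z.
  exact: continuous_comp (continuous_pi1 (x := z)) (@cvg_fst _ _ _ _ _).
apply: (@continuous_cantor_measurable R) => z.
exact: continuous_comp (continuous_pi1 (x := z)) (@cvg_snd _ _ _ _ _).
Qed.

(** The measure lives on the Cantor space and is transported by [pi]. The bound for
    [u] is imposed for non-negative [u] only, which leaves the first marginal
    free below Lebesgue measure. *)
Lemma coupling_measure : exists m : {measure set cantor_measurable -> \bar R},
  [/\ m setT = 1%E, \int[m]_z c (pi z).1 (pi z).2 <= h,
    forall u, C_X u -> (forall x, XM x -> 0 <= u x) -> \int[m]_z u (pi z).1 <= IL u &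
    forall v, C_Y Y v -> \int[m]_z v (pi z).2 = IN v].
Proof.
pose S (f : cantor_space -> R) (a : R) := exists (t : R) u v,
  [/\ 0 <= t, C_X u, forall x, XM x -> 0 <= u x, C_Y Y v &
   (forall z, f z <= t * c (pi z).1 (pi z).2 + u (pi z).1 + v (pi z).2) /\
   a = t * h + IL u + IN v].
have C0 := C_X_cst (a := 0); have D0 := @C_Y_cst _ _ Y 0.
have [||||| m [m_lty mS]] := @riesz_cone R S 1.
- move=> f g a b [t [u [v [t0 Cu u0 Cv [fle ->]]]]] [t' [u' [v' [t'0 Cu' u'0 Cv' [gle ->]]]]].
  exists (t + t'), (fun x => u x + u' x), (fun y => v y + v' y); split.
  + exact: addr_ge0.
  + exact: C_XD.
  + by move=> x Xx; rewrite addr_ge0 ?u0 ?u'0.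
  + exact: C_YD.
  + split; last by rewrite ILD// IND//; ring.
    by move=> z; have := fle z; have := gle z; rewrite -[(f + g) z]/(f z + g z) /=; lra.
- move=> r f a r0 [t [u [v [t0 Cu u0 Cv [fle ->]]]]].
  exists (r * t), (fun x => r * u x), (fun y => r * v y); split.
  + by rewrite mulr_ge0// ltW.
  + exact: C_XZ.
  + by move=> x Xx; rewrite mulr_ge0 ?(ltW r0) ?u0.
  + exact: C_YZ.
  + split; last by rewrite ILZ// INZ//; ring.
    move=> z; have := fle z; rewrite -(ler_pM2l r0) => /le_trans; apply.
    by rewrite le_eqVlt; apply/orP; left; apply/eqP; ring.
- move=> f f0; exists 0, (cst 0), (cst 0); split=> //.
  by split=> [z|]; rewrite ?IL_cst ?IN_cst; [have := f0 z; rewrite /cst/=; lra|ring].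
- exists 0, (cst 0), (cst 1); split=> //; first exact: (@C_Y_cst _ _ Y 1).
  by split=> [z|]; rewrite ?IL_cst ?IN_cst; [rewrite /cst/=; lra|ring].
- move=> a [t [u [v [t0 Cu u0 Cv [fle ->]]]]].
  apply: constraint_positive => // x y Xx Yy; have [z Ez] := pi_onto Xx Yy.
  by have := fle z; rewrite Ez.
have vle v : C_Y Y v -> \int[m]_z v (pi z).2 <= IN v.
  move=> Cv; apply: mS; first exact: (within_comp_continuous continuous_pi2 piY Cv).
  exists 0, (cst 0), v; split=> //.
  by split=> [z|]; rewrite ?IL_cst; [rewrite /cst/=; lra|ring].
have vE v : C_Y Y v -> \int[m]_z v (pi z).2 = IN v.
  move=> Cv; apply/eqP; rewrite eq_le vle//=.
  have CNv := C_YZ (a := -1) Cv.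
  have := vle _ CNv; rewrite INZ// RintegralZl//; first by lra.
  apply: continuous_cantor_integrable => //.
  exact: (within_comp_continuous continuous_pi2 piY Cv).
exists m; split=> //.
- have := vE _ (@C_Y_cst _ _ Y 1); rewrite IN_cst Rintegral_cst// mul1r => E.
  by rewrite -E fineK// ge0_fin_numE.
- apply: mS.
    have cc : {within XM `*` Y, continuous (fun z => c z.1 z.2)}.
      apply: continuous_subspaceW (cost_continuous setting) => z [Xz Yz].
      by split=> //; exact: XMX.
    exact: (within_comp_continuous pi_cont (fun z => conj (piX z) (piY z)) cc).
  exists 1, (cst 0), (cst 0); split=> //.
  by split=> [z|]; rewrite ?IL_cst ?IN_cst; [rewrite /cst/=; lra|ring].
- move=> u Cu u0; apply: mS; first exact: (within_comp_continuous continuous_pi1 piX Cu).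
  exists 0, u, (cst 0); split=> //.
  by split=> [z|]; rewrite ?IL_cst ?IN_cst; [rewrite /cst/=; lra|ring].
Qed.

Section marginals.
Variable m : {measure set cantor_measurable -> \bar R}.
Hypothesis m1 : m setT = 1%E.

Let m_lty : (m setT < +oo)%E. Proof. by rewrite m1 ltry. Qed.

Let cantor_integral_EFin (f : cantor_space -> R) : continuous f ->
  (\int[m]_z (f z)%:E = (\int[m]_z f z)%:E)%E.
Proof.
move=> cf; rewrite /Rintegral fineK//; apply: integrable_fin_num => //.
exact: continuous_cantor_integrable.
Qed.

Let measurable_pi1 : measurable_fun [set: cantor_measurable] (fun z : cantor_measurable => (pi z).1 : source).
Proof. by have /measurable_fun_pairP[] := measurable_pi. Qed.

Let measurable_pi2 : measurable_fun [set: cantor_measurable] (fun z : cantor_measurable => (pi z).2 : target).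
Proof. by have /measurable_fun_pairP[] := measurable_pi. Qed.

Lemma continuous_source_measurable (f : 'rV[R]_d.-1 * R -> R) : continuous f ->
  measurable_fun [set: source] f.
Proof.
move=> cf; apply: (@within_continuous_measurable R ('rV[R]_d.-1 * R)%type _ source id setT f) => //.
  exact: open_measurable_source.
exact: continuous_subspaceT.
Qed.

Lemma target_marginal_eq : (forall v, C_Y Y v -> \int[m]_z v (pi z).2 = IN v) ->
  forall A : set target, measurable A -> m (fun z => A (pi z).2) = nu A.
Proof.
move=> mv; apply: (@rV_measure_eq R d (pushforward_measure m measurable_pi2) nu).
  exact: m_lty.
move=> f cf f01; have Cf : C_Y Y f by exact: continuous_subspaceT.
have f0 x : (0 <= (f x)%:E)%E by rewrite lee_fin; case/andP: (f01 x).
have mf : measurable_fun setT (EFin \o f).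
  by apply/measurable_EFinP; apply: continuous_rV_measurable.
have -> : (\int[pushforward_measure m measurable_pi2]_x (f x)%:E = \int[m]_z (f (pi z).2)%:E)%E.
  exact: (ge0_integral_pushforward measurable_pi2 m measurableT mf (fun y _ => f0 y)).
rewrite (cantor_integral_EFin (within_comp_continuous continuous_pi2 piY Cf)).
rewrite [X in X%:E](mv _ Cf) -(potential_integralE setting nu Cf).
apply: esym; exact: (ge0_integral_concentrated mY nuCY mf f0).
Qed.

(** The integral of [u] against Lebesgue measure minus that against [m] is a positive
    functional of [u], hence itself a measure [r] by [riesz_cone]. So the
    restricted Lebesgue measure is the sum of the marginal and of the image of
    [r], since both sides have the same integrals of continuous functions. *)
Lemma source_marginal_le :
  (forall u, C_X u -> (forall x, XM x -> 0 <= u x) -> \int[m]_z u (pi z).1 <= IL u) ->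
  forall A : set source, measurable A -> (m (fun z => A (pi z).1) <= L (A `&` X))%E.
Proof.
move=> mu.
have cpi1 u : C_X u -> continuous (u \o (fun z => (pi z).1)).
  exact: (within_comp_continuous continuous_pi1 piX).
have ipi1 u : C_X u -> m.-integrable setT (EFin \o (u \o (fun z => (pi z).1))).
  by move=> Cu; apply: continuous_cantor_integrable => //; exact: cpi1.
pose J (u : 'rV[R]_d.-1 * R -> R) : R := \int[m]_z u (pi z).1.
have JD u v : C_X u -> C_X v -> J (fun x => u x + v x) = J u + J v.
  by move=> Cu Cv; apply: RintegralD => //; exact: ipi1.
have JZ a u : C_X u -> J (fun x => a * u x) = a * J u.
  by move=> Cu; apply: RintegralZl => //; exact: ipi1.
have J_cst a : J (cst a) = a.
  by rewrite /J Rintegral_cst// m1 mulr1.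
pose S (f : cantor_space -> R) (a : R) := exists u,
  [/\ C_X u, forall z, f z <= u (pi z).1 & a = IL u - J u].
have C0 := C_X_cst (a := 0).
have [||||| r [r_lty rS]] := @riesz_cone R S (IL (cst 1) - 1).
- move=> f g a b [u [Cu fu ->]] [v [Cv gv ->]]; exists (fun x => u x + v x); split.
  + exact: C_XD.
  + by move=> z; rewrite -[(f + g) z]/(f z + g z) lerD.
  + by rewrite ILD// JD//; ring.
- move=> t f a t0 [u [Cu fu ->]]; exists (fun x => t * u x); split.
  + exact: C_XZ.
  + by move=> z; rewrite -[(t *: f) z]/(t * f z) ler_pM2l.
  + by rewrite ILZ// JZ//; ring.
- by move=> f f0; exists (cst 0); split=> //; rewrite IL_cst J_cst; ring.
- by exists (cst 1); split=> //; [exact: C_X_cst|rewrite J_cst].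
- move=> a [u [Cu u0 ->]]; rewrite subr_ge0; apply: mu => // x Xx.
  have [y Yy] := target_neq0 setting; have [z Ez] := pi_onto Xx Yy.
  by have := u0 z; rewrite Ez.
have rle u : C_X u -> \int[r]_z u (pi z).1 <= IL u - J u.
  by move=> Cu; apply: rS; [exact: cpi1|exists u].
have rE u : C_X u -> \int[r]_z u (pi z).1 = IL u - J u.
  move=> Cu; apply/eqP; rewrite eq_le rle//=.
  have := rle _ (C_XZ (a := -1) Cu); rewrite ILZ// JZ// RintegralZl//; first by lra.
  by apply: continuous_cantor_integrable => //; exact: cpi1.
pose mX := pushforward_measure m measurable_pi1.
pose rX := pushforward_measure r measurable_pi1.
pose LM : {measure set source -> \bar R} := mrestr L mXM.
have LME : forall A : set source, measurable A -> LM A = measure_add mX rX A.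
  apply: source_measure_eq; first by rewrite /LM /= /mrestr setTI; exact: (cylinder_to_mass_lty setting).
  move=> f cf f01; have Cf : C_X f by exact: continuous_subspaceT.
  have f0 x : (0 <= (f x)%:E)%E by rewrite lee_fin; case/andP: (f01 x).
  have mf : measurable_fun setT (EFin \o (f : source -> R)).
    by apply/measurable_EFinP; exact: continuous_source_measurable.
  rewrite (ge0_integral_measure_add mX rX measurableT)//.
  have push (n : {measure set cantor_measurable -> \bar R}) :
      (\int[pushforward_measure n measurable_pi1]_x (f x)%:E = \int[n]_z (f (pi z).1)%:E)%E.
    exact: (ge0_integral_pushforward measurable_pi1 n measurableT mf (fun y _ => f0 y)).
  rewrite !push.
  rewrite (ge0_integral_concentrated (D := XM : set source))//; last first.
    by rewrite /LM /= /mrestr setICl measure0.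
  rewrite (@eq_measure_integral _ _ _ _ L); last first.
    by move=> A mA AX; rewrite /LM /= /mrestr setIidl.
  have EL : (\int[L]_(x in XM) (f x)%:E = (IL f)%:E)%E.
    rewrite /IL /Rintegral fineK//; apply: integrable_fin_num => //.
    exact: source_integrable.
  have Er : (\int[r]_z (f (pi z).1)%:E = (IL f - J f)%:E)%E.
    rewrite -rE// /Rintegral fineK//; apply: integrable_fin_num => //.
    by apply: continuous_cantor_integrable => //; exact: cpi1.
  have Em : (\int[m]_z (f (pi z).1)%:E = (J f)%:E)%E.
    by apply: cantor_integral_EFin; exact: cpi1.
  rewrite [LHS]EL; apply: esym; apply: etrans (congr2 (fun a b => a + b)%E Em Er) _.
  by rewrite -EFinD; congr EFin; ring.
move=> A mA; apply: (@le_trans _ _ (L (A `&` XM))).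
  have E : (L (A `&` XM) = mX A + rX A)%E by have := LME A mA; rewrite measure_addE.
  by rewrite E leeDl.
apply: le_measure; rewrite ?inE.
- exact: measurableI.
- by apply: measurableI => //; exact: (measurable_half_cylinder setting).
- by move=> x [Ax Xx]; split=> //; exact: XMX.
Qed.

End marginals.

Lemma exists_coupling : exists g : probability (source * target)%type R,
  [/\ forall A, measurable A -> g (snd @^-1` A) = nu A,
      forall A, measurable A -> (g (fst @^-1` A) <= L (A `&` X))%E &
      (\int[g]_(z in X `*` Y) (c z.1 z.2)%:E <= h%:E)%E].
Proof.
have [m [m1 mc mu mv]] := coupling_measure.
pose g := unit_mass_measure (m := pushforward_measure m measurable_pi) m1.
exists g; split.
- exact: target_marginal_eq.
- exact: source_marginal_le.
have mXY : measurable (X `*` Y : set (source * target)).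
  by apply: measurableX => //; exact: (measurable_half_cylinder setting).
have cc : continuous (fun z => c (pi z).1 (pi z).2).
  have cc : {within XM `*` Y, continuous (fun z => c z.1 z.2)}.
    apply: continuous_subspaceW (cost_continuous setting) => z [Xz Yz].
    by split=> //; exact: XMX.
  exact: (within_comp_continuous pi_cont (fun z => conj (piX z) (piY z)) cc).
have -> : (\int[g]_(z in X `*` Y) (c z.1 z.2)%:E = \int[m]_z (c (pi z).1 (pi z).2)%:E)%E.
  have mc' : measurable_fun (X `*` Y : set (source * target)) (EFin \o (fun z => c z.1 z.2)).
    by apply/measurable_EFinP; exact: cost_measurable.
  rewrite (ge0_integral_pushforward measurable_pi m mXY mc').
    rewrite (_ : _ @^-1` _ = setT)//; apply/seteqP; split=> // z _ /=.
    by split; [exact: XMX|exact: piY].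
  by move=> z /set_mem[Xz Yz]; rewrite lee_fin; exact: (cost_ge0 setting).
apply: le_trans (_ : ((\int[m]_z c (pi z).1 (pi z).2)%:E <= _)%E); last by rewrite lee_fin.
rewrite /Rintegral fineK//; apply: integrable_fin_num => //.
by apply: continuous_cantor_integrable => //; rewrite m1 ltry.
Qed.

End coupling.

(** * Strong duality and optimality conditions *)

Section optimality.
Context {R : realType} {d : nat}.
Variables (B : set 'rV[R]_d.-1) (Y : set 'rV[R]_d) (c : 'rV[R]_d.-1 * R -> 'rV[R]_d -> R).
Hypothesis setting : transport_setting B Y c.
Local Notation source := ('rV[R]_d.-1 * measurableTypeR R)%type.
Local Notation target := 'rV[R]_d.
Let X : set source := half_cylinder B.
Let L : {measure set source -> \bar R} := @lebesgue_source R d.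
Variable nu : probability target R.
Hypothesis nuY : nu Y = 1%E.
Local Notation H := (truncated_dual B Y c nu).
Local Notation dual := (dual B Y c nu).
Local Notation primal := (primal B Y c nu).
Local Notation density := (density_of B Y c).

(** Adding [tau] to [psi] subtracts it from the transform, so the deficit below level
    [tau] becomes the negative part. *)
Lemma dual_le_truncated M psi : C_Y Y psi ->
  (dual psi <= (H M (fun y => psi y + tau_of B Y c psi)%R)%:E)%E.
Proof.
move=> Cpsi; set tau := tau_of B Y c psi.
have Ctau := C_YD Cpsi (@C_Y_cst _ _ Y tau).
have mXM := measurable_cylinder_to setting M.
have XMX x : cylinder_to B M x -> X x by exact: cylinder_to_sub.
rewrite (dual_value setting nu Cpsi) -/tau (deficit_mass_E setting Cpsi).
rewrite (potential_integralE setting nu Cpsi) -!EFinD lee_fin.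
have -> : H M (fun y => psi y + tau) = tau + \int[nu]_(y in Y) psi y -
    \int[L]_(x in cylinder_to B M) level_deficit B Y c psi tau x.
  rewrite /truncated_dual RintegralD//; last 3 first.
  - exact: (measurable_target setting).
  - exact: (potential_integrable setting).
  - exact: (potential_integrable setting nu (@C_Y_cst _ _ Y tau)).
  rewrite (Rintegral_cst_target setting nuY) [tau + _]addrC; congr (_ - _).
  apply: eq_Rintegral => x /set_mem XMx.
  rewrite level_deficitE; last exact: XMX.
  by rewrite /negative_part (c_transformD setting tau Cpsi (XMX _ XMx)) opprB.
have Jfin := deficit_mass_E setting Cpsi tau.
have md := measurable_level_deficit setting tau Cpsi.
have : \int[L]_(x in cylinder_to B M) level_deficit B Y c psi tau x <=
    fine (deficit_mass B Y c psi tau).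
  have le : (\int[L]_(x in cylinder_to B M) (level_deficit B Y c psi tau x)%:E <=
      deficit_mass B Y c psi tau)%E.
    apply: ge0_subset_integral => //.
    - exact: (measurable_half_cylinder setting).
    - by apply/measurable_EFinP; exact: measurable_funTS.
    - by move=> x _; rewrite lee_fin level_deficit_ge0.
  rewrite /Rintegral fine_le//; last by rewrite Jfin.
  rewrite ge0_fin_numE; first by apply: (le_lt_trans le); rewrite Jfin ltry.
  by apply: integral_ge0 => x _; rewrite lee_fin level_deficit_ge0.
by lra.
Qed.

(** Above height [M] the transform is positive, so the truncation loses no deficit at
    level 0, and [dual_ge] applies at that level. *)
Lemma truncated_le_dual M K psi : C_Y Y psi -> (forall y, Y y -> psi y <= K) ->
  (forall s p y, B s -> Y y -> M <= p -> K < c (s, p) y) ->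
  ((H M psi)%:E <= dual psi)%E.
Proof.
move=> Cpsi psiK cK; apply: le_trans (dual_ge setting nu Cpsi 0).
have mXM := measurable_cylinder_to setting M.
have XMX x : cylinder_to B M x -> X x by exact: cylinder_to_sub.
have -> : deficit_mass B Y c psi 0 = (\int[L]_(x in cylinder_to B M) negative_part Y c psi x)%:E.
  have nint := negative_part_integrable setting M Cpsi.
  rewrite /Rintegral fineK; last by apply: integrable_fin_num nint.
  rewrite /deficit_mass [LHS]integral_mkcond [RHS]integral_mkcond; apply: eq_integral => x _.
  rewrite !patchE; have [Xx|nXx] := pselect (X x); last first.
    by rewrite !memNset// => /XMX.
  rewrite mem_set// level_deficitE// sub0r; case: ifPn => // nXMx.
  have : ~ cylinder_to B M x by move=> XMx; case/negP: nXMx; exact: mem_set.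
  case: x Xx {nXMx} => s p [/= Bs p0] nXMx.
  have Mp : M <= p.
    rewrite leNgt; apply/negP => /ltW pM; apply: nXMx; split=> //=.
    by rewrite in_itv/= p0.
  rewrite max_l// oppr_le0; apply: (c_transform_ge setting Cpsi) => // y Yy.
  by have := psiK _ Yy; have := cK _ _ _ Bs Yy Mp; lra.
rewrite (potential_integralE setting nu Cpsi) -EFinN -!EFinD lee_fin /truncated_dual.
by lra.
Qed.

Lemma strong_duality : exists psi0, [/\ C_Y Y psi0,
  forall psi, C_Y Y psi -> (dual psi <= dual psi0)%E &
  (primal (density psi0) <= dual psi0)%E].
Proof.
pose LB := fine (lebesgue_rV d.-1 B).
have mB := measurable_base setting.
have LBfin : lebesgue_rV d.-1 B \is a fin_num.
  by rewrite ge0_fin_numE// (compact_lebesgue_lty (base_compact setting)).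
have LB0 : 0 < LB.
  rewrite -lte_fin fineK//.
  exact: (interior_lebesgue_gt0 mB (base_interior setting)).
(* the cylinder of height [P] has volume 2 *)
pose P := 2 / LB.
have P0 : 0 <= P by rewrite divr_ge0// ltW.
have mass Q : 0 <= Q -> fine (L (cylinder_to B Q)) = LB * Q.
  by move=> Q0; rewrite (cylinder_to_mass setting Q0) fineM.
have LP : fine (L (cylinder_to B P)) = 2 by rewrite mass// mulrC divfK// gt_eqF.
have [C C0 cC] := cost_bounded setting P.
(* [C *+ 2] bounds every potential with a non-negative objective *)
have [M1 M10 cM] := cost_uniformly_large setting (C *+ 2).
pose M := Num.max P M1.
have PM : P <= M by rewrite le_max lexx.
have M0 : 0 <= M := le_trans P0 PM.
have LM1 : 1 <= fine (L (cylinder_to B M)).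
  rewrite (mass _ M0); apply: (@le_trans _ _ (LB * P)); last by rewrite ler_pM2l.
  by rewrite -(mass _ P0) LP ler1n.
have [psi0 Cpsi0 psi0max] := truncated_dual_max setting nuY M0 P0 PM LP cC.
have h0 : 0 <= H M psi0.
  by have := psi0max _ (@C_Y_cst _ _ Y 0); rewrite (truncated_dual0 setting nuY).
have psi0C y : Y y -> psi0 y <= C *+ 2.
  exact: (truncated_dual_ge0_le setting nuY P0 PM LP cC Cpsi0 h0).
have H_dual : ((H M psi0)%:E <= dual psi0)%E.
  apply: (truncated_le_dual Cpsi0 psi0C) => s p y Bs Yy Mp.
  by apply: cM => //; apply: le_trans Mp; rewrite le_max lexx orbT.
have dual_H psi : C_Y Y psi -> (dual psi <= (H M psi0)%:E)%E.
  move=> Cpsi; apply: (le_trans (dual_le_truncated M Cpsi)).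
  by rewrite lee_fin; apply: psi0max; exact: (C_YD Cpsi (@C_Y_cst _ _ Y _)).
have [pi [pi_cont pi_range]] : exists pi : cantor_space -> ('rV[R]_d.-1 * R) * target,
    continuous pi /\ range pi = cylinder_to B M `*` Y.
  apply: (@compact_cantor_image R (('rV[R]_d.-1 * R) * target)%type).
  - exact: norm_hausdorff.
  - exact: compact_setX (@compact_cylinder_to _ _ _ _ _ setting M) (target_compact setting).
  - have [s Bs] := base_interior setting; have [y Yy] := target_neq0 setting.
    exists ((s, 0), y); split=> //; split=> /=; first exact: interior_subset.
    by rewrite in_itv/= lexx.
have [g [g_nu g_L gc]] := exists_coupling setting nuY psi0max LM1 pi_cont pi_range.
pose gX : {measure set source -> \bar R} :=
  pushforward_measure g (@measurable_fst _ _ source target).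
have gX1 : gX setT = 1%E by rewrite /gX/= /pushforward preimage_setT probability_setT.
have g_opt : (\int[g]_(z in X `*` Y) (c z.1 z.2)%:E <= dual psi0)%E.
  exact: le_trans gc H_dual.
have gX_eq : forall A, measurable A -> gX A = mu_of B (density psi0) A.
  apply: (bathtub_competitor setting Cpsi0 gX1 g_L).
  by apply: le_trans g_opt; apply: (weak_duality setting nuY Cpsi0 gX1 g_L); split.
exists psi0; split=> // [psi Cpsi|]; first by apply: le_trans H_dual; exact: dual_H.
apply: le_trans g_opt; apply: ereal_inf_lbound; by exists g.
Qed.

Lemma primal_ae_eq p p' : P_ac B p -> P_ac B p' -> p = p' %[ae lebesgue_rV d.-1 in B] ->
  primal p = primal p'.
Proof.
move=> Pp Pp' pp'; have E := mu_of_ae_eq setting (P_ac_measurable Pp) (P_ac_measurable Pp') pp'.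
suff C : couplings (mu_of B p) nu = couplings (mu_of B p') nu by rewrite /primal /transport_cost C.
apply/seteqP; split=> g [g1 g2]; split=> // A mA; first exact: etrans (g1 A mA) (E A mA).
exact: etrans (g1 A mA) (esym (E A mA)).
Qed.

Lemma kantorovich_ae_eq p p' psi : P_ac B p -> P_ac B p' ->
  p = p' %[ae lebesgue_rV d.-1 in B] ->
  kantorovich B Y c psi (mu_of B p) nu = kantorovich B Y c psi (mu_of B p') nu.
Proof.
move=> Pp Pp' pp'; have E := mu_of_ae_eq setting (P_ac_measurable Pp) (P_ac_measurable Pp') pp'.
suff C : (\int[mu_of B p]_(x in X) (c_transform Y c psi x)%:E =
    \int[mu_of B p']_(x in X) (c_transform Y c psi x)%:E)%E by rewrite /kantorovich C.
pose m := under_graph_measure setting (P_ac_measurable Pp).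
pose m' := under_graph_measure setting (P_ac_measurable Pp').
have mm' A : measurable A -> A `<=` X -> m A = m' A by move=> mA _; exact: E.
exact: (eq_measure_integral m' mm').
Qed.

End optimality.

Theorem theorem3p13 (R : realType) (d : nat) (d_ge2 : (2 <= d)%N)
  (B : set 'rV[R]_d.-1) (B_compact : compact B) (B_int : B° !=set0)
  (Y : set 'rV[R]_d) (Y_neq0 : Y !=set0) (Y_compact : compact Y)
  (c : 'rV[R]_d.-1 * R -> 'rV[R]_d -> R)
  (c_ge0 : forall x y, half_cylinder B x -> Y y -> 0 <= c x y)
  (c_lip : locally_lipschitz_cost B Y c)
  (c_incr : strictly_increasing_cost B Y c)
  (c_unbounded : unbounded_cost B Y c)
  (c_equi : equicontinuous_cost B Y c)
  (nu : probability 'rV[R]_d R) (nuY : nu Y = 1%E) :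
  [/\ exists p, minimises (P_ac B) (primal B Y c nu) p /\
        forall p', minimises (P_ac B) (primal B Y c nu) p' ->
          p' = p %[ae lebesgue_rV d.-1 in B],
      exists p psi,
        [/\ minimises (P_ac B) (primal B Y c nu) p,
            maximises (C_Y Y) (dual B Y c nu) psi &
            primal B Y c nu p = dual B Y c nu psi] &
      forall p psi, P_ac B p -> C_Y Y psi ->
        (minimises (P_ac B) (primal B Y c nu) p /\
         maximises (C_Y Y) (dual B Y c nu) psi) <->
        (p = density_of B Y c psi %[ae lebesgue_rV d.-1 in B] /\
         kantorovich_potential B Y c (mu_of B p) nu psi)].
Proof.
have setting : transport_setting B Y c by [].
have [psi0 [Cpsi0 psi0_max p0_le]] := strong_duality setting nuY.
set p0 := density_of B Y c psi0 in p0_le.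
have Pp0 : P_ac B p0 := P_ac_density_of setting Cpsi0.
have weak p psi : P_ac B p -> C_Y Y psi ->
    (dual B Y c nu psi <= kantorovich B Y c psi (mu_of B p) nu <= primal B Y c nu p)%E.
  move=> Pp Cpsi; rewrite (kantorovich_le_primal setting nuY Pp Cpsi) andbT.
  exact: dual_le_kantorovich.
have dual_le_primal p psi : P_ac B p -> C_Y Y psi -> (dual B Y c nu psi <= primal B Y c nu p)%E.
  by move=> Pp Cpsi; have /andP[] := weak _ _ Pp Cpsi; exact: le_trans.
have p0_opt : primal B Y c nu p0 = dual B Y c nu psi0.
  by apply/eqP; rewrite eq_le p0_le dual_le_primal.
have p0_min : minimises (P_ac B) (primal B Y c nu) p0.
  by split; [exact: Pp0|move=> p Pp; rewrite p0_opt; exact: dual_le_primal].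
(* the equality case of the duality chain *)
have tight p psi : P_ac B p -> C_Y Y psi -> (primal B Y c nu p <= dual B Y c nu psi)%E ->
    p = density_of B Y c psi %[ae lebesgue_rV d.-1 in B].
  move=> Pp Cpsi le; have /andP[_ weak2] := weak _ _ Pp Cpsi.
  exact: (kantorovich_le_dual_eq setting Cpsi Pp (le_trans weak2 le)).
have ae_sym (f g : 'rV[R]_d.-1 -> R) : f = g %[ae lebesgue_rV d.-1 in B] ->
    g = f %[ae lebesgue_rV d.-1 in B].
  by apply: filterS => s fg Bs; rewrite fg.
have ae_trans (f g k : 'rV[R]_d.-1 -> R) : f = g %[ae lebesgue_rV d.-1 in B] ->
    g = k %[ae lebesgue_rV d.-1 in B] -> f = k %[ae lebesgue_rV d.-1 in B].
  by apply: filterS2 => s fg gk Bs; rewrite fg// gk.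
split.
- exists p0; split; first exact: p0_min.
  move=> p' [Pp' p'_min]; apply: (tight _ _ Pp' Cpsi0).
  by rewrite -p0_opt; exact: p'_min.
- exists p0, psi0; split; [exact: p0_min|exact: (conj Cpsi0 psi0_max)|exact: p0_opt].
move=> p psi Pp Cpsi; split=> [[[_ p_min] [_ psi_max]]|[p_psi [_ psi_pot]]].
  have p_le : (primal B Y c nu p <= dual B Y c nu psi)%E.
    by apply: (le_trans (p_min _ Pp0)); rewrite p0_opt; exact: psi_max.
  split; first exact: (tight _ _ Pp Cpsi p_le).
  split; first exact: Cpsi.
  move=> phi Cphi; have /andP[_ le] := weak _ _ Pp Cphi.
  apply: (le_trans le); apply: (le_trans p_le).
  by case/andP: (weak _ _ Pp Cpsi).
have Ppsi : P_ac B (density_of B Y c psi) := P_ac_density_of setting Cpsi.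
have psi_dual : dual B Y c nu psi = kantorovich B Y c psi (mu_of B p) nu.
  by rewrite (dualE setting nu Cpsi); exact/esym/(kantorovich_ae_eq setting).
have psi_max phi : C_Y Y phi -> (dual B Y c nu phi <= dual B Y c nu psi)%E.
  move=> Cphi; rewrite psi_dual; apply: le_trans (psi_pot _ Cphi).
  by case/andP: (weak _ _ Pp Cphi).
have p0_psi : p0 = density_of B Y c psi %[ae lebesgue_rV d.-1 in B].
  by apply: (tight _ _ Pp0 Cpsi); rewrite p0_opt; exact: psi_max.
split; last exact: (conj Cpsi psi_max).
split; first exact: Pp.
move=> p' Pp'; rewrite (primal_ae_eq setting nu Pp Pp0); first exact: p0_min.2.
exact: ae_trans p_psi (ae_sym _ _ p0_psi).
Qed.
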